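(* If $V\in\mathcal C^{1,1}(\mathbb T)$, then for every (real-valued) $\psi\in\mathsf H^1(\mathbb T)$, $$\lim_{\beta\to0}\sigma_\beta^V(\psi)=\sigma_0^V(\psi).$$
   Context: $\mathbb T=[-\pi,\pi]\simeq\mathbb R/2\pi\mathbb Z$ with metric $(x,y)\mapsto|e^{ix}-e^{iy}|$; $\mathcal C^{1,1}(\mathbb T)$: differentiable functions with Lipschitz derivative; $\mathsf H^m(\mathbb T)$: Sobolev space of $L^2$ functions whose first $m$ distributional derivatives are in $L^2$. $V$ is normalized so that $\mu_0^V(dx):=e^{-V(x)}\frac{dx}{2\pi}$ is a probability measure. For $\beta\ge0$ and a probability measure $\mu$ on $\mathbb T$, let $\mathcal E(\mu)=\iint\log|\sin(\frac{x-y}2)|^{-1}\mu(dx)\mu(dy)$, $\mathcal K(\mu|\mu_0^V)=\int\log\frac{d\mu}{d\mu_0^V}\,d\mu$ ($+\infty$ if $\mu\not\ll\mu_0^V$), $F_\beta^V(\mu)=\beta\mathcal E(\mu)+\mathcal K(\mu|\mu_0^V)$; $\mu_\beta^V$ is the unique minimizer of $F_\beta^V$ over probability measures, and $\mu_\beta^V(x)$ denotes its density with respect to $dx$. For $\beta>0$ let $H\psi(x)=-\mathrm{p.v.}\int_{\mathbb T}\frac{\psi(t)}{\tan(\frac{x-t}2)}\frac{dt}{2\pi}$ and $-\mathscr L_\beta\phi=\phi''+2\pi\beta H(\mu_\beta^V\phi')+(\log\mu_\beta^V)'\phi'$, regarded as a positive operator on the Hilbert space $\mathsf H_\beta=\{\psi\in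 L^2(\mathbb T):\psi'\in L^2(\mathbb T),\int\psi\,d\mu_\beta^V=0\}$ of real-valued functions with inner product $\langle\phi,\psi\rangle_{\mathsf H_\beta}=\int\phi'\psi'\,d\mu_\beta^V$, with inverse $\mathscr L_\beta^{-1}$ on $\mathsf H_\beta$. For $\psi\in\mathsf H^1(\mathbb T)$ and $\beta\ge0$ set $\psi_\beta=\psi-\int\psi\,d\mu_\beta^V$. Then $\sigma_\beta^V(\psi)\ge0$ is defined for $\beta>0$ by $\sigma_\beta^V(\psi)^2=\langle\psi_\beta,\mathscr L_\beta^{-1}\psi_\beta\rangle_{\mathsf H_\beta}$, and for $\beta=0$ by $\sigma_0^V(\psi)=\|\psi_0\|_{L^2(\mu_0^V)}=\big(\int\psi_0^2\,d\mu_0^V\big)^{1/2}$. *)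

(* Defs.v *)
From HB Require Import structures.
From mathcomp Require Import all_boot all_order all_algebra.
From mathcomp Require Import all_classical all_reals all_analysis.

Set Implicit Arguments.
Unset Strict Implicit.
Unset Printing Implicit Defensive.

Import Order.TTheory GRing.Theory Num.Theory.
Import numFieldNormedType.Exports.

Local Open Scope classical_set_scope.
Local Open Scope ring_scope.
Local Open Scope charge_scope.

(* The circle R / 2 pi Z is represented by the fundamental domain [-pi, pi[
   (the endpoints -pi and pi are identified).  A function on the circle is a
   function R -> R of which only the values on [-pi, pi[ are used; a
   probability measure on the circle is a Borel probability measure on R
   carried by [-pi, pi[. *)
Section circle.
Context {R : realType}.
Implicit Types (f g theta psi phi : R -> R) (x y t : R).

Definition circle : set R := `[- pi, pi[%classic.

(* |e^{ix} - e^{iy}| *)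
Definition circle_dist x y : R :=
  Num.sqrt ((cos x - cos y) ^+ 2 + (sin x - sin y) ^+ 2).

Definition C11 (V : R -> R) : Prop :=
  [/\ periodic V (2 * pi),
      forall x, derivable V x 1 &
      exists C : R, forall x y,
        `|derive1 V x - derive1 V y| <= C * circle_dist x y].

Definition test_function theta : Prop :=
  periodic theta (2 * pi) /\ forall n x, derivable (derive1n n theta) x 1.

(* [g] is the derivative of [f] in the sense of distributions on the circle;
   periodicity of the test functions excludes a jump of [f] at pi ~ -pi. *)
Definition weak_derivative f g : Prop :=
  [/\ lebesgue_measure.-integrable circle (EFin \o f),
      lebesgue_measure.-integrable circle (EFin \o g) &
      forall theta, test_function theta ->
        \int[lebesgue_measure]_(x in circle) (f x * derive1 theta x) =
        - \int[lebesgue_measure]_(x in circle) (g x * theta x)].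

Definition L2 f : Prop :=
  measurable_fun circle f /\
  lebesgue_measure.-integrable circle (EFin \o (fun x => f x ^+ 2)).

Fixpoint sobolev (m : nat) f : Prop :=
  if m is m'.+1 then
    L2 f /\ exists g, weak_derivative f g /\ sobolev m' g
  else L2 f.

(* a representative of the distributional derivative, unique up to a.e.
   equality *)
Definition wderiv f : R -> R := get [set g | weak_derivative f g].

Definition hilbert psi x : R :=
  - lim ((\int[lebesgue_measure]_(t in circle `&`
             [set t | eps < circle_dist x t])
           (psi t / tan ((x - t) / 2) / (2 * pi))) @[eps --> 0^'+]).

End circle.

Section free_energy.
Context {R : realType}.
Local Notation measR := (probability (measurableTypeR R) R).
Implicit Types (V : R -> R) (beta : R) (mu nu : measR).

Definition on_circle mu : Prop := mu circle = 1%E.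

(* the probability measure e^{-V(x)} dx / (2 pi) on the circle *)
Definition gibbs V : measR :=
  get [set P : measR | forall A, measurable A ->
         P A = (\int[lebesgue_measure]_(x in A `&` circle)
                   (expR (- V x) / (2 * pi))%:E)%E].

(* [lne 0 = -oo], so the kernel is +oo on the diagonal. *)
Definition log_energy mu : \bar R :=
  (\int[mu]_(x in circle) \int[mu]_(y in circle)
     - lne (`|sin ((x - y) / 2)|%:E))%E.

Definition relative_entropy mu nu : \bar R :=
  if `[< mu `<< nu >] then
    (\int[mu]_(x in circle)
       lne (('d (charge_of_finite_measure mu) '/d nu) x))%E
  else +oo%E.

Definition free_energy V beta mu : \bar R :=
  (beta%:E * log_energy mu + relative_entropy mu (gibbs V))%E.

Definition is_minimizer V beta mu : Prop :=
  on_circle mu /\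
  forall nu, on_circle nu ->
    (free_energy V beta mu <= free_energy V beta nu)%E.

Definition equilibrium V beta : measR := get [set mu | is_minimizer V beta mu].

Definition density mu (x : R) : R :=
  fine (('d (charge_of_finite_measure mu) '/d
            (@lebesgue_measure R)) x).

End free_energy.

Section variance.
Context {R : realType}.
Local Notation measR := (probability (measurableTypeR R) R).
Implicit Types (V phi psi : R -> R) (beta : R) (mu : measR).

Definition center mu psi (x : R) : R := psi x - \int[mu]_(t in circle) psi t.

Definition Hspace mu psi : Prop :=
  sobolev 1 psi /\ \int[mu]_(x in circle) psi x = 0.

Definition Hinner mu phi psi : R :=
  \int[mu]_(x in circle) (wderiv phi x * wderiv psi x).

Definition Lformula mu beta phi (x : R) : R :=
  - (wderiv (wderiv phi) x
     + 2 * pi * beta * hilbert (fun t => density mu t * wderiv phi t) x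
     + wderiv (fun t => ln (density mu t)) x * wderiv phi x).

(* [Lformula mu beta phi] need not have mean zero under [mu].  The inner
   product of H_beta only sees derivatives, i.e. H_beta is H^1 modulo constants
   with every class represented by its centered element; accordingly the
   operator on H_beta takes the centered representative. *)
Definition Lop mu beta phi : R -> R := center mu (Lformula mu beta phi).

Definition Linv mu beta psi : R -> R :=
  get [set phi | [/\ Hspace mu phi, sobolev 2 phi &
                     ae_eq lebesgue_measure circle (Lop mu beta phi) psi]].

Definition sigma V beta psi : R :=
  if beta == 0 then
    Num.sqrt (\int[gibbs V]_(x in circle) (center (gibbs V) psi x ^+ 2))
  else
    let mu := equilibrium V beta in
    Num.sqrt (Hinner mu (center mu psi) (Linv mu beta (center mu psi))).

End variance.

(* Main.v *)
From HB Require Import structures.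
From mathcomp Require Import all_boot all_order all_algebra.
From mathcomp Require Import all_classical all_reals all_analysis.
From mathcomp Require Import measurable_realfun.
From mathcomp Require Import ring lra.
Require Import Defs.
Import Order.TTheory GRing.Theory Num.Theory.
Import numFieldNormedType.Exports.
Local Open Scope classical_set_scope.
Local Open Scope ring_scope.
Set Implicit Arguments.
Unset Strict Implicit.
Unset Printing Implicit Defensive.

(** The proof is a perturbation argument in beta, with all errors O(beta).

    Equilibrium density. Write U_rho for the logarithmic potential of rho. For
    small beta the Euler-Lagrange equation log rho + V + 2 beta U_rho = const
    is solved by a contraction among C^{1,1} functions (small_density), and the
    solution is uniformly O(beta) close to exp (- V) / (2 pi). That it is the
    density of the equilibrium measure rests on two positivity facts: the
    logarithmic kernel is a series of positive semidefinite kernels, so that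
    the energy of a difference of probability measures is nonnegative
    (log_energy_cross); and the relative entropy obeys the Gibbs variational
    principle with the squared Hellinger distance as remainder (entropy_gap).
    Together they show that the measure with density rho minimizes the free
    energy and that it is the only minimizer (equilibrium_density).

    Operator. Weak derivatives are represented by absolutely continuous
    functions (weak_derivative_AC), and an integration by parts turns the
    principal value defining the Hilbert transform into a logarithmic
    potential (hilbertE). With w = (rho phi')' the operator becomes
    L phi = - (w / rho + 2 beta U_w), so that L phi = psi modulo constants is a
    small perturbation of w = - rho psi, solvable by a contraction
    (linear_equation, Linv_solution_exists). Integrating by parts, the inner
    product of psi with any solution phi is - int psi w for psi centered, which
    is the variance of psi under rho up to O(beta) (Hinner_estimate). As rho
    tends uniformly to the density of the Gibbs measure, sigma^2 tends to the
    variance of psi under that measure (sigma_estimate). *)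

(** * Integration without measurability *)

Section ae_integral.
Context d (T : measurableType d) (R : realType).
Variable mu : {measure set T -> \bar R}.
Implicit Types (D : set T).

Import HBNNSimple.

(** The integral of a nonnegative function is the supremum of the integrals of
    the simple functions below it, and a simple function below f, cut off on
    the exceptional null set, lies below g. This argument covers arbitrary
    functions, for instance representatives obtained from a choice operator. *)
Lemma ge0_ae_le_integral_any D (f g : T -> \bar R) :
  (forall x, D x -> 0 <= f x)%E -> (forall x, D x -> 0 <= g x)%E ->
  {ae mu, forall x, D x -> (f x <= g x)%E} ->
  (\int[mu]_(x in D) f x <= \int[mu]_(x in D) g x)%E.
Proof.
move=> f0 g0 [N [mN N0 fgN]].
rewrite !ge0_integralE//; apply: ge_ereal_sup => _ [h /= hf <-].
have mNc : measurable (~` N) by exact: measurableC.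
have projE x : proj_nnsfun h mNc x = (h \_ (~` N)) x by rewrite mrestrict.
suff -> : sintegral mu h = sintegral mu (proj_nnsfun h mNc).
  apply: ereal_sup_ubound; exists (proj_nnsfun h mNc) => // x.
  rewrite projE.
  have [xN|xN] := pselect (N x).
    rewrite patchE memNset/=; last by move=> /(_ xN).
    by rewrite patchE; case: ifPn => // /set_mem; exact: g0.
  rewrite patchE mem_set//=; have := hf x.
  rewrite !patchE; case: ifPn => // /set_mem Dx.
  move=> /le_trans; apply.
  by apply: contrapT => fg; apply: xN; apply: fgN => /= /(_ Dx).
rewrite -!integralT_nnsfun (@ge0_negligible_integral _ _ _ _ _ N)//=; last first.
- by move=> x _; rewrite lee_fin.
- by apply/measurable_EFinP.
rewrite setTD integral_mkcond; apply: eq_integral => x _.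
by rewrite patchE/= mindicE; case: (x \in ~` N); rewrite ?mulr1// mulr0.
Qed.

Lemma ae_le_integral_any D (f g : T -> \bar R) :
  {ae mu, forall x, D x -> (f x <= g x)%E} ->
  (\int[mu]_(x in D) f x <= \int[mu]_(x in D) g x)%E.
Proof.
move=> fg; rewrite integralE [leRHS]integralE; apply: leeB.
  apply: ge0_ae_le_integral_any => //; apply: filterS fg => x h Dx.
  by rewrite !funeposE; apply: (@Order.TotalTheory.le_max2 _ (\bar R)%type) => //; exact: h.
apply: ge0_ae_le_integral_any => //; apply: filterS fg => x h Dx.
by rewrite !funenegE; apply: (@Order.TotalTheory.le_max2 _ (\bar R)%type) => //; rewrite leeN2 h.
Qed.

Lemma ae_eq_integral_any D (f g : T -> \bar R) :
  {ae mu, forall x, D x -> f x = g x} ->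
  (\int[mu]_(x in D) f x = \int[mu]_(x in D) g x)%E.
Proof.
by move=> fg; apply/eqP; rewrite eq_le !ae_le_integral_any//; apply: filterS fg => x h Dx; rewrite h.
Qed.

Lemma ae_eq_Rintegral D (f g : T -> R) :
  {ae mu, forall x, D x -> f x = g x} ->
  \int[mu]_(x in D) f x = \int[mu]_(x in D) g x.
Proof.
move=> fg; congr fine; apply: ae_eq_integral_any.
by apply: filterS fg => x fg Dx; rewrite fg.
Qed.

End ae_integral.

(** * Real-valued integrals and Fubini on measurable rectangles *)

Section real_integral.
Context d (T : measurableType d) (R : realType).
Variable mu : {measure set T -> \bar R}.
Implicit Types (D : set T) (f g k : T -> R).

Lemma EFin_Rintegral D f : measurable D -> mu.-integrable D (EFin \o f) ->
  (\int[mu]_(x in D) f x)%:E = (\int[mu]_(x in D) (f x)%:E)%E.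
Proof. by move=> mD fi; rewrite fineK//; exact: integrable_fin_num. Qed.

Lemma integrableM_bounded D f k (M : R) : measurable D ->
  mu.-integrable D (EFin \o f) -> measurable_fun D k ->
  (forall x, D x -> `|k x| <= M) -> mu.-integrable D (EFin \o (fun x => f x * k x)).
Proof.
move=> mD fi mk kM.
rewrite (_ : EFin \o _ = ((EFin \o f) \* (EFin \o k))%E)//.
apply: integrableMl => //; exists M; split; first exact: num_real.
move=> y My x Dx /=.
by rewrite (le_trans (kM _ Dx))// ltW.
Qed.

Lemma integrableEFinD D f g : measurable D ->
  mu.-integrable D (EFin \o f) -> mu.-integrable D (EFin \o g) ->
  mu.-integrable D (EFin \o (fun x => f x + g x)).
Proof.
move=> mD fi gi; rewrite (_ : EFin \o _ = ((EFin \o f) \+ (EFin \o g))%E)//.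
exact: integrableD.
Qed.

Lemma integrableEFinB D f g : measurable D ->
  mu.-integrable D (EFin \o f) -> mu.-integrable D (EFin \o g) ->
  mu.-integrable D (EFin \o (fun x => f x - g x)).
Proof.
move=> mD fi gi; rewrite (_ : EFin \o _ = ((EFin \o f) \- (EFin \o g))%E)//.
exact: integrableB.
Qed.

Lemma integrableEFinZ D (c : R) f : measurable D ->
  mu.-integrable D (EFin \o f) -> mu.-integrable D (EFin \o (fun x => c * f x)).
Proof.
move=> mD fi; rewrite (_ : EFin \o _ = (fun x => c%:E * (f x)%:E)%E)//.
exact: integrableZl.
Qed.

Lemma integrable_EFin_measurable D f :
  mu.-integrable D (EFin \o f) -> measurable_fun D f.
Proof. by move/measurable_int/measurable_EFinP. Qed.

Lemma le_integrable_EFin D f g : measurable D -> measurable_fun D f ->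
  (forall x, D x -> `|f x| <= g x) -> mu.-integrable D (EFin \o g) ->
  mu.-integrable D (EFin \o f).
Proof.
move=> mD mf fg gi; apply: (le_integrable mD _ _ gi); first exact/measurable_EFinP.
by move=> x Dx /=; rewrite lee_fin (le_trans (fg _ Dx))// ler_norm.
Qed.

Lemma eq_integrable_EFin D f g : measurable D ->
  mu.-integrable D (EFin \o f) -> (forall x, D x -> f x = g x) ->
  mu.-integrable D (EFin \o g).
Proof.
move=> mD fi fg; apply: eq_integrable fi => // x /set_mem Dx.
by rewrite /= fg.
Qed.

Lemma ae_eq_integrable D f g : measurable D ->
  {ae mu, forall x, D x -> f x = g x} -> measurable_fun D g ->
  mu.-integrable D (EFin \o f) -> mu.-integrable D (EFin \o g).
Proof.
move=> mD fg mg /integrableP[mf fi]; apply/integrableP; split.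
  exact/measurable_EFinP.
rewrite (@ae_eq_integral_any _ _ _ _ _ _ (fun x => `|(EFin \o f) x|)%E)//.
by apply: filterS fg => x fg Dx /=; rewrite fg.
Qed.

Lemma normr_Rintegral_le D f g : measurable D -> measurable_fun D f ->
  (forall x, D x -> `|f x| <= g x) -> mu.-integrable D (EFin \o g) ->
  `|\int[mu]_(x in D) f x| <= \int[mu]_(x in D) g x.
Proof.
move=> mD mf fg gi; have fi := le_integrable_EFin mD mf fg gi.
rewrite (le_trans (le_normr_Rintegral mD fi))//.
by apply: le_Rintegral => //; exact: integrable_norm.
Qed.

Lemma fine_integrable D (g : T -> \bar R) : measurable D -> mu.-integrable D g ->
  mu.-integrable D (EFin \o (fine \o g)) /\
  (\int[mu]_(x in D) g x = \int[mu]_(x in D) (fine (g x))%:E)%E.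
Proof.
move=> mD gi; have gfin := integrable_ae mD gi.
have mg := measurable_int _ gi.
have gE : {ae mu, forall x, D x -> (EFin \o (fine \o g)) x = g x}.
  by apply: filterS gfin => x gfin Dx /=; rewrite fineK// gfin.
split; last by apply/esym/ae_eq_integral_any.
apply/integrableP; split.
  by apply/measurable_EFinP; apply: measurableT_comp => //; exact: measurable_fine.
case/integrableP : gi => _; rewrite (@ae_eq_integral_any _ _ _ _ _ _ (fun x => `|(EFin \o (fine \o g)) x|)%E)//.
by apply: filterS gE => x gE Dx; rewrite gE.
Qed.

End real_integral.

Section Rfubini.
Local Open Scope ereal_scope.
Context d1 d2 (T1 : measurableType d1) (T2 : measurableType d2) (R : realType).
Variables (m1 : {sigma_finite_measure set T1 -> \bar R})
          (m2 : {sigma_finite_measure set T2 -> \bar R}).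
Variables (A : set T1) (B : set T2) (mA : measurable A) (mB : measurable B).

Section tonelli.
Variable f : T1 -> T2 -> \bar R.
Hypothesis mf : measurable_fun (A `*` B) (fun z => f z.1 z.2).
Let F := (fun z => f z.1 z.2) \_ (A `*` B).

Let patchF x y : F (x, y) = ((fun x' => (f x' \_ B) y) \_ A) x.
Proof.
rewrite /F !patchE; case: ifPn => [|].
  by rewrite in_setX/= => /andP[-> ->].
by rewrite in_setX/= negb_and; case: (x \in A) => //=; case: (y \in B).
Qed.

Let mF : measurable_fun setT F.
Proof.
by apply/(measurable_restrictT _ (measurableX mA mB)).
Qed.

Let innerE x : \int[m2]_y F (x, y) = ((fun x => \int[m2]_(y in B) f x y) \_ A) x.
Proof.
rewrite patchE; case: ifPn => xA.
  by rewrite [RHS]integral_mkcond; apply: eq_integral => y _; rewrite patchF patchE xA.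
by rewrite -[RHS](@integral0 _ _ _ m2 setT); apply: eq_integral => y _; rewrite patchF patchE (negbTE xA).
Qed.

Let innerE2 y : \int[m1]_x F (x, y) = ((fun y => \int[m1]_(x in A) f x y) \_ B) y.
Proof.
rewrite patchE; case: ifPn => yB.
  by rewrite [RHS]integral_mkcond; apply: eq_integral => x _; rewrite patchF !patchE yB.
rewrite -[RHS](@integral0 _ _ _ m1 setT); apply: eq_integral => x _.
by rewrite patchF !patchE (negbTE yB); case: ifPn.
Qed.

(** Extending f by zero outside the rectangle A x B turns iterated integrals
    over A and B into integrals over the whole spaces. *)
Lemma tonelli_set : (forall x y, A x -> B y -> 0 <= f x y) ->
  \int[m1]_(x in A) \int[m2]_(y in B) f x y =
  \int[m2]_(y in B) \int[m1]_(x in A) f x y.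
Proof.
move=> f0.
have F0 z : 0 <= F z.
  rewrite /F patchE; case: ifPn => //; rewrite inE => -[? ?]; exact: f0.
rewrite integral_mkcond [RHS]integral_mkcond.
under eq_integral do rewrite -innerE.
under [RHS]eq_integral do rewrite -innerE2.
by apply: (@fubini_tonelli _ _ _ _ _ m1 m2 F).
Qed.

Lemma tonelli_measurable : (forall x y, A x -> B y -> 0 <= f x y) ->
  measurable_fun A (fun x => \int[m2]_(y in B) f x y).
Proof.
move=> f0.
have F0 z : 0 <= F z.
  rewrite /F patchE; case: ifPn => //; rewrite inE => -[? ?]; exact: f0.
apply/(measurable_restrictT _ mA).
rewrite (_ : _ \_ _ = fun x => \int[m2]_y F (x, y)); last exact/funext.
exact: measurable_fun_fubini_tonelli_F.
Qed.

Hypothesis fi : \int[m1]_(x in A) \int[m2]_(y in B) `|f x y| < +oo.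

Let iF : (m1 \x m2)%E.-integrable setT F.
Proof.
apply/(integrable12ltyP _ _ mF).
suff -> : \int[m1]_x \int[m2]_y `|F (x, y)| = \int[m1]_(x in A) \int[m2]_(y in B) `|f x y| by [].
rewrite [RHS]integral_mkcond; apply: eq_integral => x _.
rewrite patchE; case: ifPn => xA.
  rewrite [RHS]integral_mkcond; apply: eq_integral => y _.
  by rewrite patchF patchE xA !patchE; case: ifPn => // _; rewrite abse0.
rewrite -[RHS](@integral0 _ _ _ m2 setT); apply: eq_integral => y _.
by rewrite patchF patchE (negbTE xA) abse0.
Qed.

Lemma fubini_set_integrable : m1.-integrable A (fun x => \int[m2]_(y in B) f x y).
Proof.
apply/(integrable_mkcond _ mA).
rewrite (_ : _ \_ _ = fun x => \int[m2]_y F (x, y)); last exact/funext.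
exact: integrable_fubini_F.
Qed.

Lemma fubini_set_integrable2 : m2.-integrable B (fun y => \int[m1]_(x in A) f x y).
Proof.
apply/(integrable_mkcond _ mB).
rewrite (_ : _ \_ _ = fun y => \int[m1]_x F (x, y)); last exact/funext.
have mG := measurable_fubini_G iF.
apply/integrableP; split; first exact: mG.
apply: le_lt_trans ((integrable21ltyP m1 m2 mF).1 iF).
have mFa : measurable_fun setT (abse \o F) by exact: measurableT_comp.
apply: ge0_le_integral => //.
- exact: measurableT_comp mG.
- by apply: (@measurable_fun_fubini_tonelli_G _ _ _ _ _ m1 (abse \o F)) => // z; exact: abse_ge0.
- move=> y _; apply: le_abse_integral => //.
  by apply: measurableT_comp mF _; exact: pair2_measurable.
Qed.

Lemma fubini_set_ae : {ae m1, forall x, A x -> m2.-integrable B (f x)}.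
Proof.
apply: filterS (ae_integrable1 iF) => x xF Ax; apply/(integrable_mkcond _ mB).
rewrite (_ : _ \_ _ = fun y => F (x, y))//; apply/funext => y.
by rewrite patchF [RHS]patchE mem_set.
Qed.

Lemma fubini_set : \int[m1]_(x in A) \int[m2]_(y in B) f x y =
  \int[m2]_(y in B) \int[m1]_(x in A) f x y.
Proof.
rewrite integral_mkcond [RHS]integral_mkcond.
under eq_integral do rewrite -innerE.
under [RHS]eq_integral do rewrite -innerE2.
exact: (Fubini iF).
Qed.

End tonelli.

Section real.
Variable f : T1 -> T2 -> R.
Hypothesis mf : measurable_fun (A `*` B) (fun z => f z.1 z.2).
Hypothesis fi : \int[m1]_(x in A) \int[m2]_(y in B) `|f x y|%:E < +oo.
Let mf' : measurable_fun (A `*` B) (fun z => (f z.1 z.2)%:E).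
Proof. exact/measurable_EFinP. Qed.

Let fE x y := (f x y)%:E.
Let fi' : \int[m1]_(x in A) \int[m2]_(y in B) `|fE x y| < +oo.
Proof. exact: fi. Qed.
Let int1 := fine_integrable mA (@fubini_set_integrable fE mf' fi').
Let int2 := fine_integrable mB (@fubini_set_integrable2 fE mf' fi').

Lemma Rfubini_integrable :
  m1.-integrable A (EFin \o (fun x => \int[m2]_(y in B) f x y)%R).
Proof. exact: int1.1. Qed.

Lemma Rfubini_integrable2 :
  m2.-integrable B (EFin \o (fun y => \int[m1]_(x in A) f x y)%R).
Proof. exact: int2.1. Qed.

Lemma Rfubini_ae : {ae m1, forall x, A x -> m2.-integrable B (EFin \o f x)}.
Proof. exact: (@fubini_set_ae fE mf' fi'). Qed.

Lemma Rfubini : (\int[m1]_(x in A) \int[m2]_(y in B) f x y =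
  \int[m2]_(y in B) \int[m1]_(x in A) f x y)%R.
Proof.
by congr fine; rewrite -[LHS]int1.2 -[RHS]int2.2; exact: (@fubini_set fE mf' fi').
Qed.

End real.
End Rfubini.

(** * Lebesgue measure on the circle *)

Section circle_integral.
Context {R : realType}.
Notation lam := (@lebesgue_measure R).
Notation pi := (@pi R).

Lemma measurable_circle : measurable (@circle R : set (measurableTypeR R)).
Proof. exact: measurable_itv. Qed.

Lemma lebesgue_circle : lam circle = (2 * pi)%:E.
Proof.
rewrite /circle lebesgue_measure_itv/= lte_fin.
have := @pi_gt0 R => pi0.
by rewrite ifT; [rewrite -EFinD; congr EFin; ring|lra].
Qed.

Lemma circle_bounded_integrable (f : R -> R) (M : R) : measurable_fun circle f ->
  (forall x, circle x -> `|f x| <= M) -> lam.-integrable circle (EFin \o f).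
Proof.
move=> mf fM; apply: measurable_bounded_integrable => //.
- exact: measurable_circle.
- by rewrite [ltLHS]lebesgue_circle ltry.
- exists M; split; first exact: num_real.
  by move=> y My x Dx; rewrite /= (le_trans (fM _ Dx))// ltW.
Qed.

Section reflection.
Variable x : R.
Let refl0 (t : R) : R := x - t.
Let refl : measurableTypeR R -> measurableTypeR R := refl0.

Let mrefl : measurable_fun setT refl.
Proof. by apply: measurable_funB => //; exact: measurable_id. Qed.

Let preimage_refl (b0 b1 : bool) (a b : R) :
  refl0 @^-1` [set` Interval (BSide b0 a) (BSide b1 b)] =
  [set` Interval (BSide (~~ b1) (x - b)) (BSide (~~ b0) (x - a))].
Proof.
by apply/seteqP; split => t /=; rewrite !in_itv/= /refl0; case: b0; case: b1 => /=;
  move=> /andP[h1 h2]; apply/andP; split; lra.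
Qed.

(** A reflection preserves the lengths of intervals, which determine the
    measure. *)
Lemma lebesgue_measure_reflection (A : set R) : measurable A ->
  pushforward lam refl A = lam A.
Proof.
move=> mA; apply/esym/lebesgue_measure_unique => //= _ [[a b]] _ <-.
rewrite /pushforward [_ @^-1` _]preimage_refl !lebesgue_measure_itv/= !lte_fin ltrD2l ltrN2.
by case: ifP => // _; rewrite -!EFinD; congr EFin; ring.
Qed.

Lemma ge0_integral_reflection (b0 b1 : bool) (a b : R) (f : R -> \bar R) :
  measurable_fun setT f -> (forall t, 0 <= f t)%E ->
  (\int[lam]_(t in [set` Interval (BSide b0 a) (BSide b1 b)]) f t =
  \int[lam]_(t in [set` Interval (BSide (~~ b1) (x - b)%R) (BSide (~~ b0) (x - a)%R)]) f (x - t)%R)%E.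
Proof.
move=> mf f0; rewrite -preimage_refl.
rewrite -(@ge0_integral_pushforward _ _ _ _ _ refl mrefl lam _ f)//; last exact: measurable_funS mf.
by apply: eq_measure_integral => //= A mA AS; exact/esym/lebesgue_measure_reflection.
Qed.

End reflection.

Lemma ge0_integral_shift (b0 b1 : bool) (c a b : R) (f : R -> \bar R) :
  measurable_fun setT f -> (forall t, 0 <= f t)%E ->
  (\int[lam]_(t in [set` Interval (BSide b0 a) (BSide b1 b)]) f t =
  \int[lam]_(t in [set` Interval (BSide b0 (a - c)%R) (BSide b1 (b - c)%R)]) f (t + c)%R)%E.
Proof.
move=> mf f0; rewrite (ge0_integral_reflection 0)//.
rewrite [RHS](@ge0_integral_reflection (- c))//; last first.
  by apply: measurableT_comp mf _; apply: measurable_funD => //; exact: measurable_id.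
rewrite (_ : 0 - b = - c - (b - c)); last by ring.
rewrite (_ : 0 - a = - c - (a - c)); last by ring.
by apply: eq_integral => t _; congr f; ring.
Qed.

(** The reflection maps the fundamental domain onto ]x - pi, x + pi], and by
    periodicity the part of it outside the fundamental domain can be moved
    back by 2 pi. *)
Lemma ge0_integral_circle_reflection x (f : R -> \bar R) :
  circle x -> measurable_fun setT f -> (forall t, 0 <= f t)%E ->
  (forall t, f (t + 2 * pi)%R = f t) ->
  (\int[lam]_(t in circle) f (x - t)%R = \int[lam]_(t in circle) f t)%E.
Proof.
move=> cx mf f0 pf; have pi0 := @pi_gt0 R.
have [xl xr] : - pi <= x /\ x < pi by move: cx; rewrite /circle/= in_itv/= => /andP.
have mU (D : set R) : measurable_fun D f by exact: measurable_funS mf.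
have -> : (\int[lam]_(t in circle) f (x - t)%R =
           \int[lam]_(t in `](x - pi)%R, (x + pi)%R]) f t)%E.
  rewrite [RHS](@ge0_integral_reflection x)//=.
  rewrite (_ : x - (x + pi) = - pi); last by ring.
  by rewrite (_ : x - (x - pi) = pi); last by ring.
have bnd (a b : R) : (\int[lam]_(t in `]a, b]) f t = \int[lam]_(t in `[a, b[) f t)%E.
  by rewrite integral_itv_obnd_cbnd ?integral_itv_bndo_bndc//.
have cut (a b c : R) : a <= b -> b <= c -> (\int[lam]_(t in `[a, c[) f t =
    \int[lam]_(t in `[a, b[) f t + \int[lam]_(t in `[b, c[) f t)%E.
  move=> ab bc; rewrite (@itv_bndbnd_setU _ _ (BLeft a) (BLeft b)) ?bnd_simp//.
  rewrite ge0_integral_setU//; first exact: mU.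
  apply/disj_setPS => t [] /=.
  by rewrite !in_itv/= => /andP[_ ?] /andP[? _]; lra.
have shift (a b : R) : (\int[lam]_(t in `[a, b[) f t =
    \int[lam]_(t in `[(a - 2 * pi)%R, (b - 2 * pi)%R[) f t)%E.
  by rewrite (@ge0_integral_shift _ _ (2 * pi))//; apply: eq_integral => t _; rewrite pf.
rewrite bnd /circle.
have [x0|x0] := leP 0 x.
  rewrite (cut _ pi (x + pi)); [|lra..]; rewrite (cut (- pi) (x - pi)); [|lra..].
  rewrite addeC; congr (_ + _)%E; rewrite shift.
  rewrite (_ : pi - 2 * pi = - pi); last by ring.
  by rewrite (_ : x + pi - 2 * pi = x - pi); last by ring.
rewrite (cut _ (- pi) (x + pi)); [|lra..]; rewrite (cut _ (x + pi) pi); [|lra..].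
rewrite addeC; congr (_ + _)%E; rewrite [RHS]shift.
rewrite (_ : pi - 2 * pi = - pi); last by ring.
by rewrite (_ : x + pi - 2 * pi = x - pi); last by ring.
Qed.

End circle_integral.

(** * The logarithmic kernel *)

Section FTC.
Context {R : realType}.
Notation lam := (@lebesgue_measure R).
Implicit Types (f F : R -> R) (a b : R).

Lemma FTC2_halfopen f F a b : a <= b ->
  (forall x, a <= x <= b -> is_derive x 1 F (f x)) ->
  (forall x, a <= x <= b -> {for x, continuous f}) ->
  lam.-integrable `[a, b[ (EFin \o f) /\
  \int[lam]_(x in `[a, b[) f x = F b - F a.
Proof.
rewrite le_eqVlt => /orP[/eqP <- _ _|ab dF cf].
  by rewrite set_itv_ge ?bnd_simp// Rintegral_set0 subrr; split => //; exact: integrable_set0.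
have cfab : {within `[a, b], continuous f}.
  by apply: continuous_in_subspaceT => x; rewrite inE/= in_itv/=; exact: cf.
have fi : lam.-integrable `[a, b] (EFin \o f).
  exact: continuous_compact_integrable (@segment_compact _ _ _) cfab.
have fi' : lam.-integrable `[a, b[ (EFin \o f).
  by apply: integrableS fi => //; exact: subset_itv_co_cc.
split => //; rewrite Rintegral_itv_bndo_bndc// /Rintegral.
have cF x : a <= x <= b -> {for x, continuous F}.
  by move=> /dF[+ _] => /derivable1_diffP/differentiable_continuous.
rewrite (continuous_FTC2 ab cfab (F := F))//.
- split.
  + by move=> x; rewrite in_itv/= => /andP[ax xb]; have [] := dF x _; rewrite ?(ltW ax) ?(ltW xb).
  + by apply: cvg_at_right_filter; apply: cF; rewrite lexx ltW.
  + by apply: cvg_at_left_filter; apply: cF; rewrite lexx ltW.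
- move=> x; rewrite in_itv/= => /andP[ax xb]; rewrite derive1E.
  by apply: derive_val; apply: dF; rewrite !ltW.
Qed.

End FTC.

Section log_kernel.
Context {R : realType}.
Notation lam := (@lebesgue_measure R).
Notation pi := (@pi R).
Implicit Types (f : R -> R) (s t x y : R).

(** The singularity at 0 is replaced by the value 0, since ln 0 = 0; this
    affects only null sets of measures with a density. *)
Definition logker s : R := - ln `|sin (s / 2)|.

Lemma logkerN s : logker (- s) = logker s.
Proof. by rewrite /logker mulNr sinN normrN. Qed.

Lemma logkerD2pi s : logker (s + 2 * pi) = logker s.
Proof.
rewrite /logker (_ : (s + 2 * pi) / 2 = s / 2 + pi); last by field.
by rewrite sinDpi normrN.
Qed.

Lemma logker_ge0 s : 0 <= logker s.
Proof.
rewrite /logker oppr_ge0 ln_le0// ler_norml sin_le1 andbT.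
exact: sin_geN1.
Qed.

Lemma measurable_logker : measurable_fun setT logker.
Proof.
apply: measurableT_comp => //; apply: measurableT_comp; first exact: measurable_ln.
apply: measurableT_comp => //; apply: continuous_measurable_fun => s.
apply: continuous_comp; first by apply: cvgM => //; exact: cvg_cst.
exact: continuous_sin.
Qed.

(** sin y = 2 sin (y / 2) cos (y / 2), where sin (y / 2) >= (y / 2) cos (y / 2)
    by the mean value theorem and 2 cos^2 (y / 2) = 1 + cos y >= 1. *)
Lemma sin_ge_half y : 0 <= y <= pi / 2 -> y / 2 <= sin y.
Proof.
move=> /andP[y0 ypi].
have pi0 := @pi_gt0 R.
have cosy : 0 <= cos y by apply: cos_ge0_pihalf; apply/andP; split; lra.
have -> : sin y = 2 * sin (y / 2) * cos (y / 2).
  by rewrite {1}(_ : y = (y / 2) *+ 2) ?sin_mulr2n; [ring|field].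
have c2 : cos y = 2 * cos (y / 2) ^+ 2 - 1.
  by rewrite {1}(_ : y = (y / 2) *+ 2) ?cos_mulr2n; [ring|field].
have c0 : 0 <= cos (y / 2) by apply: cos_ge0_pihalf; apply/andP; split; lra.
have sc : (y / 2) * cos (y / 2) <= sin (y / 2).
  have [<-|yn0] := eqVneq 0 y; first by rewrite mul0r mul0r sin0.
  have y20 : 0 < y / 2 by lra.
  have [|c] := @MVT R sin cos 0 (y / 2) y20 (fun x _ => is_derive_sin x).
    by apply: continuous_subspaceT => z; exact: continuous_sin.
  rewrite in_itv/= => /andP[c_gt0 cy]; rewrite sin0 !subr0 => ->.
  rewrite mulrC ler_wpM2r//; first lra.
  by apply: ltW; rewrite ltr_cos ?in_itv/= ?ltW//; lra.
nra.
Qed.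

Lemma logker_le s : s != 0 -> `|s| <= pi -> logker s <= - ln (`|s| / 4).
Proof.
move=> s0 spi; have ns0 : 0 < `|s| by rewrite normr_gt0.
have h : `|s| / 2 / 2 <= sin (`|s| / 2) by apply: sin_ge_half; apply/andP; split; lra.
have sE : `|sin (s / 2)| = sin (`|s| / 2).
  have [s_ge0|s_lt0] := leP 0 s.
    by rewrite (ger0_norm s_ge0) in h *; rewrite ger0_norm// (le_trans _ h)//; lra.
  rewrite (ltr0_norm s_lt0) in h *.
  have -> : s / 2 = - (- s / 2) by field.
  by rewrite sinN normrN ger0_norm// (le_trans _ h)//; lra.
rewrite /logker lerN2 sE ler_ln ?posrE; lra.
Qed.

(** The kernel lies below - ln (s / 4), whose primitive s - s ln (s / 4) stays
    bounded at 0; this bounds the integrals over [1 / (n + 1), pi[ uniformly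
    in n. *)
Lemma logker_integral_half : (\int[lam]_(s in `]0%R, pi[) (logker s)%:E < +oo)%E.
Proof.
pose F n := `[n.+1%:R^-1, pi[%classic : set R.
have n0 (n : nat) : (0 : R) < n.+1%:R^-1 by rewrite invr_gt0.
have Fn n s : F n s -> 0 < s < pi.
  by rewrite /F/= in_itv/= => /andP[ns ->]; rewrite (lt_le_trans (n0 n) ns).
have -> : `]0, pi[%classic = \bigcup_n F n.
  apply/seteqP; split => [s/=|s [n _] /Fn]; last by rewrite /= in_itv.
  rewrite in_itv/= => /andP[s0 spi].
  exists (Num.truncn s^-1) => //; rewrite /F/= in_itv/= spi andbT.
  rewrite invf_ple ?posrE ?ltr0n//.
  by rewrite ltW// truncnS_gt.
have mL (D : set R) : measurable_fun D (fun s : R => (logker s)%:E).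
  by apply/measurable_EFinP; exact: measurable_funS measurable_logker.
have L0 s : (0 <= (logker s)%:E)%E by rewrite lee_fin logker_ge0.
have nF : {homo F : n m / (n <= m)%N >-> (n <= m)%O}.
  move=> n m nm; apply/subsetPset => s; rewrite /F/= !in_itv/= => /andP[ns ->].
  by rewrite andbT (le_trans _ ns)// lef_pV2 ?posrE ?ltr0n// ler_nat ltnS.
pose B : R := pi - pi * ln (pi / 4).
apply: (@le_lt_trans _ _ B%:E); last exact: ltry.
have mF n : measurable (F n) by exact: measurable_itv.
have /cvg_lim <- // := @ge0_nondecreasing_set_cvg_integral _ (measurableTypeR R) _ F
  (fun s => (logker s)%:E) lam nF mF (fun n => mL _) (fun n s _ => L0 s).
apply: lime_le.
  apply: ereal_nondecreasing_is_cvgn.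
  exact: (@ge0_nondecreasing_set_nondecreasing_integral _ (measurableTypeR R) _ F
    (fun s => (logker s)%:E) lam nF mF (fun n => mL _) (fun n s _ => L0 s)).
near=> n; have npi : n.+1%:R^-1 <= pi.
  by rewrite (@le_trans _ _ 1) ?invf_le1 ?ltr0n ?ler1n// (le_trans _ (@pi_ge2 R))// ler1n.
have dl s : 0 < s -> is_derive s 1 (fun s : R => s - s * ln (s / 4)) (- ln (s / 4)).
  move=> s0; have s40 : 0 < s / 4 by lra.
  have d0 : is_derive s 1 (fun s : R => s / 4) 4^-1.
    by apply: (is_derive_eq (is_deriveM (is_derive_id s 1) (is_derive_cst (4^-1 : R) s 1)));
      rewrite scaler0 add0r /GRing.scale/= mulr1.
  have d1 := @is_derive1_comp R (@ln R) (fun s => s / 4) s _ _ (is_derive1_ln s40) d0.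
  apply: (is_derive_eq (is_deriveB (is_derive_id s 1) (is_deriveM (is_derive_id s 1) d1))).
  by rewrite /GRing.scale/=; field; exact: lt0r_neq0.

have cl s : 0 < s -> {for s, continuous (fun s : R => - ln (s / 4))}.
  move=> s0; apply: continuousN; apply: (@continuous_comp _ _ _ (fun s : R => s / 4) (@ln R)).
    by apply: cvgM => //; exact: cvg_cst.
  by apply: continuous_ln; lra.

have [fi fE] := @FTC2_halfopen R (fun s => - ln (s / 4))
  (fun s => s - s * ln (s / 4)) n.+1%:R^-1 pi npi
  (fun s h => dl s (lt_le_trans (n0 n) (andP h).1))
  (fun s h => cl s (lt_le_trans (n0 n) (andP h).1)).
apply: (@le_trans _ _ (\int[lam]_(s in F n) (- ln (s / 4))%:E)%E).
  apply: ge0_le_integral => //; [exact: mF|exact: mL| |].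
  - by case/integrableP : fi.
  - move=> s /Fn /andP[s0 spi]; rewrite lee_fin.
    have := @logker_le s (lt0r_neq0 s0); rewrite gtr0_norm//; apply; exact: ltW.
rewrite -(EFin_Rintegral _ fi)// fE lee_fin lerBlDr lerDl.
rewrite subr_ge0.
have : (n.+1%:R^-1 : R) <= 1 by rewrite invf_le1 ?ltr0n// ler1n.
have := n0 n; set e := n.+1%:R^-1 => e0 e1.
have : ln (e / 4) <= 0 by apply: ln_le0; lra.
nra.
Unshelve. all: end_near. Qed.

Lemma integrable_logker : lam.-integrable circle (EFin \o logker).
Proof.
apply/integrableP; split.
  by apply/measurable_EFinP; exact: measurable_funS measurable_logker.
have L0 s : (0 <= (logker s)%:E)%E by rewrite lee_fin logker_ge0.
have mL (D : set R) : measurable_fun D (fun s : R => (logker s)%:E).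
  by apply/measurable_EFinP; exact: measurable_funS measurable_logker.
have pi0 := @pi_gt0 R.
rewrite (_ : (\int[lam]_(x in circle) _)%E = (\int[lam]_(x in circle) (logker x)%:E)%E); last first.
  by apply: eq_integral => s _; rewrite /= ger0_norm ?logker_ge0.
rewrite /circle (@itv_bndbnd_setU _ _ (BLeft (- pi)) (BLeft 0)) ?bnd_simp//; [|lra..].
rewrite ge0_integral_setU//; [|exact: mL|]; last first.
  by apply/disj_setPS => t [] /=; rewrite !in_itv/= => /andP[_ ?] /andP[? _]; lra.
have e1 : (\int[lam]_(s in `[(- pi)%R, 0%R[) (logker s)%:E =
    \int[lam]_(s in `]0%R, pi[) (logker s)%:E)%E.
  apply: etrans (@ge0_integral_reflection R 0 true true (- pi) 0 _ (mL setT) L0) _.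
  rewrite /= (_ : 0 - 0 = 0) ?subrr// (_ : 0 - - pi = pi) ?sub0r ?opprK//.
  rewrite -integral_itv_bndo_bndc//; last first.
    by apply: measurable_funTS; apply: measurableT_comp (mL setT) _; apply: measurable_funB => //; exact: measurable_id.
  by apply: eq_integral => t _; rewrite sub0r logkerN.
have e2 : (\int[lam]_(s in `[0%R, pi[) (logker s)%:E =
    \int[lam]_(s in `]0%R, pi[) (logker s)%:E)%E.
  by rewrite integral_itv_obnd_cbnd.
by apply: lte_add_pinfty; [rewrite e1|rewrite e2]; exact: logker_integral_half.
Qed.

End log_kernel.

Section real_reflection.
Context {R : realType}.
Notation lam := (@lebesgue_measure R).
Notation pi := (@pi R).

Lemma Rintegral_circle_reflection x (f : R -> R) :
  circle x -> measurable_fun setT f -> (forall t, f (t + 2 * pi) = f t) ->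
  \int[lam]_(t in circle) f (x - t) = \int[lam]_(t in circle) f t.
Proof.
move=> cx mf pf; congr fine; rewrite integralE [RHS]integralE; congr (_ - _)%E.
  rewrite -[RHS](ge0_integral_circle_reflection cx)//.
  - by apply: eq_integral => t _; rewrite !funeposE.
  - by apply: measurable_funepos; exact/measurable_EFinP.
  - by move=> t; rewrite !funeposE pf.
rewrite -[RHS](ge0_integral_circle_reflection cx)//.
- by apply: eq_integral => t _; rewrite !funenegE.
- by apply: measurable_funeneg; exact/measurable_EFinP.
- by move=> t; rewrite !funenegE pf.
Qed.

Lemma integrable_circle_reflection x (f : R -> R) :
  circle x -> measurable_fun setT f -> (forall t, f (t + 2 * pi) = f t) ->
  lam.-integrable circle (EFin \o f) ->
  lam.-integrable circle (EFin \o (fun t => f (x - t))).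
Proof.
move=> cx mf pf /integrableP[_ fi]; apply/integrableP; split.
  apply/measurable_EFinP; apply: measurable_funTS; apply: measurableT_comp mf _.
  by apply: measurable_funB => //; exact: measurable_id.
rewrite (ge0_integral_circle_reflection (f := fun t => `|(f t)%:E|%E) cx)//.
- by apply: measurableT_comp => //; exact/measurable_EFinP.
- by move=> t; rewrite pf.
Qed.

End real_reflection.

Section product_dominated.
Context d1 d2 (T1 : measurableType d1) (T2 : measurableType d2) (R : realType).
Variables (m1 : {sigma_finite_measure set T1 -> \bar R})
          (m2 : {sigma_finite_measure set T2 -> \bar R}).
Variables (A : set T1) (B : set T2) (mA : measurable A) (mB : measurable B).

(** A product of integrable functions is integrable on the product space, and
    hence so is every function that it dominates. *)
Lemma product_dominated_finite (f : T1 -> T2 -> R) (a : T1 -> R) (b : T2 -> R) :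
  measurable_fun (A `*` B) (fun z => f z.1 z.2) ->
  (forall x y, A x -> B y -> `|f x y| <= `|a x| * `|b y|) ->
  m1.-integrable A (EFin \o a) -> m2.-integrable B (EFin \o b) ->
  (\int[m1]_(x in A) \int[m2]_(y in B) `|f x y|%:E < +oo)%E.
Proof.
move=> mf fab ai bi.
have mb := integrable_EFin_measurable bi.
have ma := integrable_EFin_measurable ai.
have mfE : measurable_fun (A `*` B) (fun z => `|f z.1 z.2|%:E).
  by apply/measurable_EFinP; exact: measurableT_comp.
have bfin : (\int[m2]_(y in B) `|b y|%:E)%E \is a fin_num.
  by apply: integrable_fin_num => //; exact: integrable_norm bi.
pose c := fine (\int[m2]_(y in B) `|b y|%:E)%E.
apply: (@le_lt_trans _ _ (\int[m1]_(x in A) (c * `|a x|)%:E)%E); last first.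
  apply: integrable_lty => //.
  exact: (@integrableEFinZ _ _ _ m1 A c _ mA (integrable_norm ai)).
apply: ge0_le_integral => //.
- by move=> x Ax; apply: integral_ge0 => y _; rewrite lee_fin.
- by apply: (@tonelli_measurable _ _ _ _ _ m2 A B mA mB (fun x y => `|f x y|%:E)).
- by apply/measurable_EFinP; apply: measurable_funM => //; exact: measurableT_comp.
move=> x Ax.
rewrite mulrC EFinM /c fineK// -ge0_integralZl//; last first.
  by apply/measurable_EFinP; exact: measurableT_comp.
apply: ge0_le_integral => //.
- suff : measurable_fun B ((fun z : T1 * T2 => `|f z.1 z.2|%:E) \o pair x) by [].
  apply: (measurable_comp (F := A `*` B)) => //; first exact: measurableX.
  + by move=> _ [y By <-].
  + exact: measurable_funTS (pair1_measurable x).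
- by apply/measurable_EFinP; apply: measurable_funM => //; exact: measurableT_comp.
- by move=> y By; rewrite lee_fin fab.
Qed.

End product_dominated.

(** * Absolutely continuous functions and integration by parts *)

Section absolutely_continuous.
Context {R : realType}.
Notation lam := (@lebesgue_measure R).
Notation pi := (@pi R).
Notation integ f := (lam.-integrable circle (EFin \o f)).
Notation I f := (\int[lam]_(x in circle) f x).
Implicit Types (f F k K w : R -> R) (x y t s : R).

Definition prim w x : R := \int[lam]_(t in `[- pi, x[) w t.

(** Absolute continuity on [-pi, pi[ with almost everywhere derivative w. The
    function matches up at the identified endpoints exactly when w has
    integral 0. *)
Definition AC f w : Prop :=
  integ w /\ forall x, circle x -> f x = f (- pi) + prim w x.

Lemma circleE x : circle x = (- pi <= x < pi) :> Prop.
Proof. by rewrite /circle/= in_itv. Qed.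

Lemma circleNpi : circle (- pi).
Proof. by rewrite circleE; have := @pi_gt0 R => ?; apply/andP; split; lra. Qed.

Lemma sub_circle x : x <= pi -> `[- pi, x[ `<=` circle.
Proof.
by move=> xpi t; rewrite circleE /= in_itv/= => /andP[-> /lt_le_trans ->].
Qed.

Lemma integ_prim w x : x <= pi -> integ w ->
  lam.-integrable `[- pi, x[ (EFin \o w).
Proof.
move=> xpi; apply: integrableS => //; [exact: measurable_circle|exact: sub_circle].
Qed.

Lemma prim_pi w : prim w pi = I w. Proof. by []. Qed.

Lemma primNpi w : prim w (- pi) = 0.
Proof. by rewrite /prim set_itv_ge ?bnd_simp// Rintegral_set0. Qed.

Lemma prim_cut w x y : integ w -> - pi <= x -> x <= y -> y <= pi ->
  prim w y = prim w x + \int[lam]_(t in `[x, y[) w t.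
Proof.
move=> wi xl xy yr; rewrite /prim.
rewrite (@itv_bndbnd_setU _ _ (BLeft (- pi)) (BLeft x)) ?bnd_simp//.
rewrite Rintegral_setU//.
  by rewrite -itv_bndbnd_setU ?bnd_simp//; exact: integ_prim.
by apply/disj_setPS => t [] /=; rewrite !in_itv/= => /andP[_ ?] /andP[? _]; lra.
Qed.

Lemma prim_indic w x t : integ w -> x <= pi -> t <= x ->
  \int[lam]_(s in `[- pi, x[) (w s * (s < t)%R%:R) = prim w t.
Proof.
move=> wi xpi tx; rewrite /prim [RHS]Rintegral_mkcond [LHS]Rintegral_mkcond.
apply: eq_Rintegral => s _; rewrite !patchE !mem_setE !in_itv/=.
case: (- pi <= s) => //=; have [st|st] := ltP s t.
  by rewrite (lt_le_trans st tx) mulr1.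
by rewrite mulr0; case: ifP.
Qed.

Lemma prim_coindic w x s : integ w -> x <= pi -> - pi <= s -> s < x ->
  \int[lam]_(t in `[- pi, x[) (w t * (s < t)%R%:R) = prim w x - prim w s.
Proof.
move=> wi xpi ls sx.
rewrite (@prim_cut _ s x)//; last exact: ltW.
rewrite addrC addrA addNr add0r.
rewrite [LHS]Rintegral_mkcond -Rintegral_itv_obnd_cbnd; last first.
  apply: (integrableS _ _ _ (integ_prim xpi wi)) => //.
  move=> t /=; rewrite !in_itv/= => /andP[st ->]; rewrite andbT.
  by rewrite (le_trans ls)// ltW.
rewrite [RHS]Rintegral_mkcond; apply: eq_Rintegral => t _.
rewrite !patchE !mem_setE !in_itv/=.
have [st|st] := ltP s t.
  by rewrite mulr1 (le_trans ls (ltW st)).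
by rewrite mulr0; case: ifP.
Qed.

(** The square [-pi, x[^2 is cut along its diagonal, and the integral of
    f s * k t over one triangle is computed in both orders. *)
Lemma prim_ibp f k x : integ f -> integ k -> - pi <= x -> x <= pi ->
  [/\ lam.-integrable `[- pi, x[ (EFin \o (fun t => prim f t * k t)),
      lam.-integrable `[- pi, x[ (EFin \o (fun t => f t * prim k t)) &
  \int[lam]_(t in `[- pi, x[) (prim f t * k t) +
  \int[lam]_(t in `[- pi, x[) (f t * prim k t) = prim f x * prim k x].
Proof.
move=> fi ki lx xpi; pose A : set (measurableTypeR R) := `[- pi, x[%classic.
have mA : measurable A by exact: measurable_itv.
have fA := integ_prim xpi fi; have kA := integ_prim xpi ki.
have inA t : A t -> - pi <= t /\ t < x by rewrite /A/= in_itv/= => /andP[].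
pose g (t s : R) : R := k t * (f s * (s < t)%R%:R).
have mg : measurable_fun (A `*` A) (fun z => g z.1 z.2).
  have m1 (h : R -> R) : measurable_fun A h -> measurable_fun (A `*` A) (h \o fst).
    move=> mh; apply: (measurable_comp (F := A)) => //.
    - by move=> _ [z [? ?] <-].
    - exact: measurable_funTS measurable_fst.
  have m2 (h : R -> R) : measurable_fun A h -> measurable_fun (A `*` A) (h \o snd).
    move=> mh; apply: (measurable_comp (F := A)) => //.
    - by move=> _ [z [? ?] <-].
    - exact: measurable_funTS measurable_snd.
  apply: measurable_funM; first exact: (m1 k (integrable_EFin_measurable kA)).
  apply: measurable_funM; first exact: (m2 f (integrable_EFin_measurable fA)).
  rewrite (_ : (fun _ => _) = (fun z : R * R => if z.2 < z.1 then 1 else 0)); last first.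
    by apply/funext => z; case: ifP.
  apply: measurable_funTS; apply: measurable_fun_ifT => //.
  by apply: measurable_fun_ltr; [exact: measurable_snd|exact: measurable_fst].
have gfin : (\int[lam]_(t in A) \int[lam]_(s in A) `|g t s|%:E < +oo)%E.
  apply: (@product_dominated_finite _ _ _ _ R lam lam A A mA mA g k f mg _ kA fA) => t s _ _.
  rewrite /g !normrM ler_wpM2l// ler_piMr//.
  by case: (s < t); rewrite ?normr1 ?normr0.
have g1 t : A t -> \int[lam]_(s in A) g t s = prim f t * k t.
  move=> /inA[_ /ltW tx]; rewrite /g RintegralZl//; first by rewrite prim_indic// mulrC.
  apply: (integrableM_bounded (M := 1)) => //.
    rewrite (_ : (fun _ => _) = (fun s : R => if s < t then 1 else 0)); last first.
      by apply/funext => z; case: ifP.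
    by apply: measurable_funTS; apply: measurable_fun_ifT => //; exact: measurable_fun_ltr.
  by move=> s _; case: (s < t); rewrite ?normr1 ?normr0.
have g2 s : A s -> \int[lam]_(t in A) g t s = f s * (prim k x - prim k s).
  move=> /inA[ls sx].
  rewrite (_ : (fun t => g t s) = (fun t => f s * (k t * (s < t)%R%:R))); last first.
    by apply/funext => t; rewrite /g; ring.
  rewrite RintegralZl//; first by rewrite prim_coindic.
  apply: (integrableM_bounded (M := 1)) => //.
    rewrite (_ : (fun _ => _) = (fun t : R => if s < t then 1 else 0)); last first.
      by apply/funext => z; case: ifP.
    by apply: measurable_funTS; apply: measurable_fun_ifT => //; exact: measurable_fun_ltr.
  by move=> t _; case: (s < t); rewrite ?normr1 ?normr0.
have h1 := @Rfubini_integrable _ _ _ _ R lam lam A A mA mA g mg gfin.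
have h2 := @Rfubini_integrable2 _ _ _ _ R lam lam A A mA mA g mg gfin.
have h3 := @Rfubini _ _ _ _ R lam lam A A mA mA g mg gfin.
have i1 : lam.-integrable A (EFin \o (fun t => prim f t * k t)).
  exact: eq_integrable_EFin mA h1 g1.
have i2' : lam.-integrable A (EFin \o (fun s => f s * (prim k x - prim k s))).
  exact: eq_integrable_EFin mA h2 g2.
have i3 : lam.-integrable A (EFin \o (fun s => f s * prim k x)).
  by apply: eq_integrable_EFin mA (integrableEFinZ (prim k x) mA fA) _ => t _; rewrite mulrC.
have i2 : lam.-integrable A (EFin \o (fun s => f s * prim k s)).
  by apply: eq_integrable_EFin mA (integrableEFinB mA i3 i2') _ => t _; ring.
split; [exact: i1|exact: i2|].
have e1 : \int[lam]_(t in A) (\int[lam]_(s in A) g t s) =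
    \int[lam]_(t in A) (prim f t * k t).
  by apply: eq_Rintegral => t /set_mem At; rewrite g1.
have e2 : \int[lam]_(s in A) (\int[lam]_(t in A) g t s) =
    \int[lam]_(s in A) (f s * prim k x) - \int[lam]_(s in A) (f s * prim k s).
  rewrite -(RintegralB mA i3 i2); apply: eq_Rintegral => t /set_mem At.
  exact: etrans (g2 t At) (mulrBr _ _ _).
have e3 : \int[lam]_(t in A) (prim f t * k t) =
    \int[lam]_(s in A) (f s * prim k x) - \int[lam]_(s in A) (f s * prim k s).
  exact: etrans (esym e1) (etrans h3 e2).
rewrite -/A e3 (RintegralZr (prim k x) mA fA).
by rewrite -/(prim f x) subrK.
Qed.

Lemma integ_cst c : integ (fun=> c).
Proof.
apply: (@circle_bounded_integrable _ _ `|c|) => //; exact: measurable_cst.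
Qed.

Lemma integ_prim1 w : integ w -> integ (prim w).
Proof.
move=> wi; have pi0 := @pi_gt0 R.
have [||+ _ _] := @prim_ibp w (cst 1) pi wi (integ_cst 1); [lra|by []|].
move=> h; apply: (eq_integrable_EFin _ h); first exact: measurable_circle.
by move=> x _; rewrite mulr1.
Qed.

Lemma prim_bound w x : integ w -> circle x -> `|prim w x| <= I (fun t => `|w t|).
Proof.
move=> wi; rewrite circleE => /andP[lx xr].
have wA := integ_prim (ltW xr) wi.
apply: (le_trans (le_normr_Rintegral _ wA)) => //.
have nwi := integrable_norm wi.
change (prim (fun t => `|w t|) x <= prim (fun t => `|w t|) pi).
rewrite (@prim_cut (fun t => `|w t|) x pi)// ?lerDl; last exact: ltW.
by apply: Rintegral_ge0 => t _; exact: normr_ge0.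
Qed.

Lemma AC_integ f w : AC f w -> integ f.
Proof.
move=> [wi fE]; have mc := @measurable_circle R.
apply: (eq_integrable_EFin mc (integrableEFinD mc (integ_cst (f (- pi))) (integ_prim1 wi))).
by move=> x cx; rewrite -fE.
Qed.

Lemma AC_measurable f w : AC f w -> measurable_fun circle f.
Proof. by move/AC_integ/integrable_EFin_measurable. Qed.

Lemma AC_bound f w x : AC f w -> circle x ->
  `|f x| <= `|f (- pi)| + I (fun t => `|w t|).
Proof.
move=> [wi fE] cx; rewrite fE// (le_trans (ler_normD _ _))// lerD2l.
exact: prim_bound.
Qed.

Lemma integM f w g : AC f w -> integ g -> integ (fun x => g x * f x).
Proof.
move=> fw gi; apply: integrableM_bounded => //; first exact: measurable_circle.
- exact: AC_measurable fw.
- by move=> x cx; exact: AC_bound fw cx.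
Qed.

Lemma AC_prim w : integ w -> AC (prim w) w.
Proof. by move=> wi; split => // x _; rewrite primNpi add0r. Qed.

Lemma AC_cst c : AC (cst c) (cst 0).
Proof.
split; first exact: integ_cst.
by move=> x _; rewrite /prim/= Rintegral_cst// mul0r addr0.
Qed.

Lemma AC_ext f F w : (forall x, circle x -> f x = F x) -> AC f w -> AC F w.
Proof.
move=> fF [wi fE]; split => // x cx; rewrite -!fF//; first exact: fE.
exact: circleNpi.
Qed.

Lemma AC_ext_deriv f w w' : (forall x, circle x -> w x = w' x) -> AC f w -> AC f w'.
Proof.
move=> ww' [wi fE]; split; first exact: (eq_integrable_EFin (@measurable_circle R) wi ww').
move=> x cx; rewrite fE//; congr (_ + _); apply: eq_Rintegral => t /set_mem At.
apply: ww'; apply: sub_circle At; move: cx; rewrite circleE => /andP[_ /ltW//].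
Qed.

Lemma AC_linear f w F k (a b : R) : AC f w -> AC F k ->
  AC (fun x => a * f x + b * F x) (fun x => a * w x + b * k x).
Proof.
move=> [wi fE] [ki FE]; have mc := @measurable_circle R.
split.
  apply: integrableEFinD => //; exact: integrableEFinZ.
move=> x cx; have xpi : x <= pi by move: cx; rewrite circleE => /andP[_ /ltW].
have wx := integ_prim xpi wi; have kx := integ_prim xpi ki.
rewrite fE// FE// /prim RintegralD//; [|exact: integrableEFinZ..].
by rewrite !RintegralZl//; ring.
Qed.

Lemma AC_ibp f w F k x : AC f w -> AC F k -> - pi <= x -> x <= pi ->
  [/\ lam.-integrable `[- pi, x[ (EFin \o (fun t => w t * F t)),
      lam.-integrable `[- pi, x[ (EFin \o (fun t => f t * k t)) &
  \int[lam]_(t in `[- pi, x[) (w t * F t) + \int[lam]_(t in `[- pi, x[) (f t * k t)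
  = (f (- pi) + prim w x) * (F (- pi) + prim k x) - f (- pi) * F (- pi)].
Proof.
move=> fw Fk lx xpi; have [wi fE] := fw; have [ki FE] := Fk.
pose A : set (measurableTypeR R) := `[- pi, x[%classic.
have mA : measurable A by exact: measurable_itv.
have mc := @measurable_circle R.
have wx := integ_prim xpi wi; have kx := integ_prim xpi ki.
have i1 : lam.-integrable A (EFin \o (fun t => w t * F t)).
  apply: (integrableS mc mA (sub_circle xpi)); exact: integM Fk wi.
have i2 : lam.-integrable A (EFin \o (fun t => f t * k t)).
  apply: (integrableS mc mA (sub_circle xpi)).
  by apply: (eq_integrable_EFin mc (integM fw ki)) => t _; rewrite mulrC.
split => //.
have [j1 j2 e] := prim_ibp wi ki lx xpi.
have e1 : \int[lam]_(t in A) (w t * F t) = F (- pi) * prim w x +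
    \int[lam]_(t in A) (w t * prim k t).
  rewrite -RintegralZl// -RintegralD//; last exact: integrableEFinZ.
  apply: eq_Rintegral => t /set_mem At; rewrite FE; first by ring.
  exact: sub_circle At.
have e2 : \int[lam]_(t in A) (f t * k t) = f (- pi) * prim k x +
    \int[lam]_(t in A) (prim w t * k t).
  rewrite -RintegralZl// -RintegralD//; last exact: integrableEFinZ.
  apply: eq_Rintegral => t /set_mem At; rewrite fE; first by ring.
  exact: sub_circle At.
by rewrite -/A e1 e2 -/A in e *; nra.
Qed.

Lemma AC_mul f w F k : AC f w -> AC F k ->
  AC (fun x => f x * F x) (fun x => w x * F x + f x * k x).
Proof.
move=> fw Fk; have [wi fE] := fw; have [ki FE] := Fk.
have mc := @measurable_circle R.
split.
  apply: integrableEFinD => //; first exact: integM Fk wi.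
  by apply: (eq_integrable_EFin mc (integM fw ki)) => t _; rewrite mulrC.
move=> x cx; have /andP[lx xr] : - pi <= x < pi by rewrite -circleE.
have [i1 i2 e] := AC_ibp fw Fk lx (ltW xr).
by rewrite /prim RintegralD// e fE// FE//; ring.
Qed.

(** The boundary terms cancel, because a derivative of mean zero gives the
    function the same value at both ends of the circle. *)
Lemma ACper_ibp f w F k : AC f w -> I w = 0 -> AC F k -> I k = 0 ->
  I (fun x => f x * k x) = - I (fun x => w x * F x).
Proof.
move=> fw w0 Fk k0; have pi0 := @pi_gt0 R.
have [||_ _] := @AC_ibp f w F k pi fw Fk; [lra|by []|].
rewrite !prim_pi w0 k0 !addr0 subrr => /eqP; rewrite addr_eq0 => /eqP h.
by apply: oppr_inj; rewrite opprK -h.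
Qed.

End absolutely_continuous.

(** * Test functions and smooth cutoffs *)

Section test_functions.
Context {R : realType}.
Notation lam := (@lebesgue_measure R).
Notation pi := (@pi R).
Notation integ f := (lam.-integrable circle (EFin \o f)).
Notation I f := (\int[lam]_(x in circle) f x).
Implicit Types (f F k K w h theta : R -> R) (x y t s : R).

Lemma C1_AC f F : (forall x, is_derive x 1 F (f x)) -> continuous f ->
  AC F f /\ I f = F pi - F (- pi).
Proof.
move=> dF cf; have pi0 := @pi_gt0 R.
have ftc x : - pi <= x -> lam.-integrable `[- pi, x[ (EFin \o f) /\
    \int[lam]_(t in `[- pi, x[) f t = F x - F (- pi).
  by move=> lx; apply: FTC2_halfopen => // t _; exact: cf.
have [fi fE] := ftc pi ltac:(lra).
split => //; split => // x; rewrite circleE => /andP[lx _].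
have [_] := ftc x lx; rewrite /prim => ->; ring.
Qed.

Lemma antiderivative f : continuous f ->
  exists F, forall x, is_derive x 1 F (f x).
Proof.
move=> cf.
have fi (a b : R) : lam.-integrable `[a, b] (EFin \o f).
  apply: continuous_compact_integrable; first exact: segment_compact.
  exact: continuous_subspaceT.
pose F a x := \int[lam]_(t in `[a, x]) f t.
pose G x := F (- (`|x| + 1)) x - F (- (`|x| + 1)) 0.
have cut a a' b : a' <= a -> a <= b -> F a' b = F a' a + F a b.
  move=> aa ab; rewrite /F.
  have := @Rintegral_itvB R f (BLeft a') (BRight b) a (fi a' b).
  rewrite !bnd_simp => /(_ aa ab) e.
  rewrite -(@Rintegral_itv_obnd_cbnd _ a (BRight b)) -?e ?subrKC//.
  apply: (integrableS _ _ _ (fi a b)) => //.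
  exact: subset_itv_oc_cc.
have GE a x : a <= x -> a <= 0 -> G x = F a x - F a 0.
  move=> ax a0; rewrite /G; set a' := - _.
  have a'x : a' <= x by rewrite /a' lerNl (le_trans (ler_norm _))// normrN lerDl.
  have a'0 : a' <= 0 by rewrite /a' oppr_le0 addr_ge0.
  have [aa|/ltW aa] := leP a a'.
    by rewrite (cut a' a x)// (cut a' a 0)//; ring.
  by rewrite (cut a a' x)// (cut a a' 0)//; ring.
exists G => x; pose a := - (`|x| + 2).
have ax : a < x - 1.
  by have := ler_norm (- x); rewrite normrN /a; lra.
have a0 : a < 0 by rewrite /a; have := normr_ge0 x; lra.
have [dF FE] := @continuous_FTC1_closed R f a x (x + 1) ltac:(lra) (fi _ _) ltac:(lra) (cf x).
have dF1 : is_derive x 1 (fun y => F a y - F a 0) (f x).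
  have dF0 : is_derive x 1 (F a) (f x).
    by apply: DeriveDef; [exact: dF|rewrite -derive1E; exact: FE].
  have := is_deriveB dF0 (is_derive_cst (F a 0) x 1); rewrite subr0; apply.
apply: near_eq_is_derive dF1.
near=> y; rewrite (GE a)//; last exact: ltW.
have : `|x - y| < 1 by near: y; exact: (@cvgr_dist_lt _ _ _ _ _ id x cvg_id).
by rewrite ltr_norml; lra.
Unshelve. all: end_near. Qed.

Lemma test_derive theta x : test_function theta ->
  is_derive x 1 theta (derive1 theta x).
Proof.
move=> [_ /(_ 0 x)]; rewrite derive1n0 => dt.
by apply: DeriveDef => //; rewrite derive1E.
Qed.

Lemma test_derive_continuous theta : test_function theta ->
  continuous (derive1 theta).
Proof.
move=> [_ /(_ 1)]; rewrite derive1n1 => dt x.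
exact/differentiable_continuous/derivable1_diffP.
Qed.

Lemma test_AC theta : test_function theta ->
  AC theta (derive1 theta) /\ I (derive1 theta) = 0.
Proof.
move=> tt; have [h ->] := C1_AC (fun x => test_derive x tt) (test_derive_continuous tt).
split => //; have [+ _] := tt => /(_ (- pi)).
by rewrite (_ : - pi + 2 * pi = pi) => [->|]; [rewrite subrr|ring].
Qed.

Lemma ACper_weak_derivative f w : AC f w -> I w = 0 -> weak_derivative f w.
Proof.
move=> fw w0; split; [exact: AC_integ fw|by case: fw|].
move=> theta tt; have [h h0] := test_AC tt.
exact: (ACper_ibp fw w0 h h0).
Qed.

Section cutoff.
Variables (b : R) (n : nat).

(** By the product formula this is 2 cos (t / 2) sin ((b - t) / 2), positive
    on ]-pi, b[ and negative on ]b, pi[. The periodic smooth functions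
    exp (- exp (- n * arc_sign)) therefore tend to the indicator of ]-pi, b[. *)
Definition arc_sign t : R := sin (b / 2) + sin (b / 2 - t).
Definition cutoff_tail t : R := expR (- n%:R * arc_sign t).
Definition cutoff t : R := expR (- cutoff_tail t).

(** The cutoffs belong to a class of periodic functions closed under
    differentiation, so that their smoothness is proved by induction. *)
Inductive smooth_expr : (R -> R) -> Prop :=
| smooth_cst c : smooth_expr (fun=> c)
| smooth_sin : smooth_expr (fun t => sin (b / 2 - t))
| smooth_cos : smooth_expr (fun t => cos (b / 2 - t))
| smooth_tail : smooth_expr cutoff_tail
| smooth_cutoff : smooth_expr cutoff
| smooth_add f g of smooth_expr f & smooth_expr g : smooth_expr (fun t => f t + g t)
| smooth_mul f g of smooth_expr f & smooth_expr g : smooth_expr (fun t => f t * g t).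

Lemma smooth_expr_periodic f : smooth_expr f -> periodic f (2 * pi).
Proof.
have sinp t : sin (b / 2 - (t + 2 * pi)) = sin (b / 2 - t).
  by rewrite -(sinD2pi (b / 2 - (t + 2 * pi))); congr sin; rewrite mulr2n; ring.
have cosp t : cos (b / 2 - (t + 2 * pi)) = cos (b / 2 - t).
  by rewrite -(cosD2pi (b / 2 - (t + 2 * pi))); congr cos; rewrite mulr2n; ring.
elim => //=.
- by move=> t; rewrite /cutoff_tail /arc_sign sinp.
- by move=> t; rewrite /cutoff /cutoff_tail /arc_sign sinp.
- by move=> {}f g _ hf _ hg t; rewrite hf hg.
- by move=> {}f g _ hf _ hg t; rewrite hf hg.
Qed.

Lemma smooth_expr_derive f : smooth_expr f ->
  exists2 g, smooth_expr g & forall x, is_derive x 1 f (g x).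
Proof.
have dsub x : is_derive x 1 (fun t : R => b / 2 - t) (-1).
  by have := is_deriveB (is_derive_cst (b / 2) x 1) (is_derive_id x 1); rewrite sub0r; apply.
have dsin x : is_derive x 1 (fun t => sin (b / 2 - t)) (- 1 * cos (b / 2 - x)).
  apply: is_derive_eq (is_derive1_comp (is_derive_sin _) (dsub x)) _.
  by ring.
have dcos x : is_derive x 1 (fun t => cos (b / 2 - t)) (sin (b / 2 - x)).
  apply: is_derive_eq (is_derive1_comp (is_derive_cos _) (dsub x)) _.
  by ring.
have ds x : is_derive x 1 (fun t => - n%:R * arc_sign t) (n%:R * cos (b / 2 - x)).
  have -> : (fun t => - n%:R * arc_sign t) =
    (fun t => - n%:R * (sin (b / 2) + sin (b / 2 - t))) by [].
  have h1 := is_deriveD (is_derive_cst (sin (b / 2)) x 1) (dsin x).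
  have h2 := is_deriveM (is_derive_cst (- n%:R : R) x 1) h1.
  apply: (is_derive_eq h2) _.
  by rewrite /GRing.scale/=; ring.
have dt x : is_derive x 1 cutoff_tail (n%:R * cos (b / 2 - x) * cutoff_tail x).
  apply: is_derive_eq (is_derive1_comp (is_derive_expR _) (ds x)) _.
  by rewrite /cutoff_tail; ring.
have dc x : is_derive x 1 cutoff (- 1 * (n%:R * cos (b / 2 - x) * cutoff_tail x) * cutoff x).
  apply: is_derive_eq (is_derive1_comp (is_derive_expR _) (is_deriveN (dt x))) _.
  by rewrite /cutoff; ring.
elim.
- move=> c; exists (fun=> 0); first exact: smooth_cst.
  by move=> x; exact: is_derive_cst.
- exists (fun t => - 1 * cos (b / 2 - t)) => //.
  by apply: smooth_mul; [exact: smooth_cst|exact: smooth_cos].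
- by exists (fun t => sin (b / 2 - t)) => //; exact: smooth_sin.
- exists (fun t => n%:R * cos (b / 2 - t) * cutoff_tail t) => //.
  apply: smooth_mul; last exact: smooth_tail.
  by apply: smooth_mul; [exact: smooth_cst|exact: smooth_cos].
- exists (fun t => - 1 * (n%:R * cos (b / 2 - t) * cutoff_tail t) * cutoff t) => //.
  apply: smooth_mul; last exact: smooth_cutoff.
  apply: smooth_mul; first exact: smooth_cst.
  apply: smooth_mul; last exact: smooth_tail.
  by apply: smooth_mul; [exact: smooth_cst|exact: smooth_cos].
- move=> f1 f2 s1 [g1 t1 d1] s2 [g2 t2 d2].
  exists (fun t => g1 t + g2 t); first exact: smooth_add.
  by move=> x; exact: is_deriveD.
- move=> f1 f2 s1 [g1 t1 d1] s2 [g2 t2 d2].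
  exists (fun t => f1 t * g2 t + f2 t * g1 t).
    by apply: smooth_add; exact: smooth_mul.
  by move=> x; exact: (is_deriveM (d1 x) (d2 x)).
Qed.

Lemma smooth_expr_derive1n f (m : nat) : smooth_expr f -> smooth_expr (derive1n m f).
Proof.
move=> sf; elim: m => [|m ih]; first by rewrite derive1n0.
rewrite derive1nS; have [g sg dg] := smooth_expr_derive ih.
by rewrite (_ : derive1 _ = g)//; apply/funext => x; rewrite derive1E; exact: derive_val.
Qed.

Lemma smooth_expr_derivable f x : smooth_expr f -> derivable f x 1.
Proof. by move=> /smooth_expr_derive[g _ /(_ x)[]]. Qed.

Lemma smooth_expr_continuous f : smooth_expr f -> continuous f.
Proof.
move=> sf x; exact/differentiable_continuous/derivable1_diffP/smooth_expr_derivable.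
Qed.

(** An antiderivative is periodic exactly because f has mean zero. *)
Lemma smooth_expr_primitive f : smooth_expr f -> I f = 0 ->
  exists2 theta, test_function theta & derive1 theta = f.
Proof.
move=> sf f0; have [F dF] := antiderivative (smooth_expr_continuous sf).
have dFE : derive1 F = f.
  by apply/funext => x; rewrite derive1E; exact: derive_val.
exists F => //; split.
  have [_] := C1_AC dF (smooth_expr_continuous sf); rewrite f0 => FF x.
  have dD (z : R) : is_derive z 1 (fun z => F (z + 2 * pi) - F z) 0.
    have d1 : is_derive z 1 (fun z : R => z + 2 * pi) 1.
      by have := is_deriveD (is_derive_id z 1) (is_derive_cst (2 * pi) z 1); rewrite addr0; apply.
    apply: is_derive_eq (is_deriveB (is_derive1_comp (dF _) d1) (dF z)) _.
    by rewrite (smooth_expr_periodic sf) mulr1 subrr.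
  have := is_derive_0_is_cst x (- pi) dD.
  rewrite /= (_ : - pi + 2 * pi = pi); last by ring.
  by rewrite -FF => /eqP; rewrite subr_eq0 => /eqP.
move=> [|k] x; first by rewrite derive1n0; have [] := dF x.
rewrite (_ : derive1n k.+1 F = derive1n k f).
  by apply: smooth_expr_derivable; exact: smooth_expr_derive1n.
by rewrite /derive1n iterSr dFE.
Qed.

End cutoff.
End test_functions.

(** * Orthogonality to smooth cutoffs *)

Section real_dominated_convergence.
Context d (T : measurableType d) (R : realType).
Variable mu : {measure set T -> \bar R}.

Lemma Rdominated_cvg (D : set T) (f_ : nat -> T -> R) (f g : T -> R) :
  measurable D -> (forall n, measurable_fun D (f_ n)) -> measurable_fun D f ->
  {ae mu, forall x, D x -> f_ n x @[n --> \oo] --> f x} ->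
  mu.-integrable D (EFin \o g) ->
  {ae mu, forall x, D x -> forall n, `|f_ n x| <= g x} ->
  mu.-integrable D (EFin \o f) /\
  \int[mu]_(x in D) f_ n x @[n --> \oo] --> \int[mu]_(x in D) f x.
Proof.
move=> mD mf_ mf ff gi fg.
have [] := @dominated_convergence _ _ _ mu D mD (fun n => EFin \o f_ n) (EFin \o f)
  (EFin \o g).
- by move=> n; exact/measurable_EFinP.
- exact/measurable_EFinP.
- by apply: filterS ff => x fx Dx; apply: cvg_EFin; [exact: nearW|exact: fx].
- exact: gi.
- by apply: filterS fg => x fg n Dx; rewrite lee_fin; exact: fg.
move=> fi _ cvg; split => //.
apply: fine_cvg; rewrite fineK; last exact: integrable_fin_num.
exact: cvg.
Qed.

End real_dominated_convergence.

Section du_bois_reymond.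
Context {R : realType}.
Notation lam := (@lebesgue_measure R).
Notation pi := (@pi R).
Notation integ f := (lam.-integrable circle (EFin \o f)).
Notation I f := (\int[lam]_(x in circle) f x).
Implicit Types (f g d F w h theta : R -> R) (x y t s b : R).

Lemma arc_signE b t : arc_sign b t = 2 * cos (t / 2) * sin ((b - t) / 2).
Proof.
rewrite /arc_sign.
have -> : sin (b / 2) = sin (t / 2 + (b - t) / 2) by congr sin; field.
have -> : sin (b / 2 - t) = sin ((b - t) / 2 - t / 2) by congr sin; field.
rewrite !sinD cosN sinN; ring.
Qed.

Lemma arc_sign_gt0 b t : b < pi -> - pi < t -> t < b -> 0 < arc_sign b t.
Proof.
move=> bpi lt tb; rewrite arc_signE mulr_gt0//.
  by rewrite mulr_gt0// cos_gt0_pihalf//; apply/andP; split; lra.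
by rewrite sin_gt0_pi//; apply/andP; split; lra.
Qed.

Lemma arc_sign_lt0 b t : - pi < b -> b < t -> t < pi -> arc_sign b t < 0.
Proof.
move=> lb bt tpi; rewrite arc_signE pmulr_rlt0; last first.
  by rewrite mulr_gt0// cos_gt0_pihalf//; apply/andP; split; lra.
rewrite (_ : (b - t) / 2 = - ((t - b) / 2)); last by field.
by rewrite sinN oppr_lt0 sin_gt0_pi//; apply/andP; split; lra.
Qed.

Lemma cutoff_ge0 b n t : 0 <= cutoff b n t.
Proof. exact: expR_ge0. Qed.

Lemma cutoff_le1 b n t : cutoff b n t <= 1.
Proof. by rewrite /cutoff -expR0 ler_expR oppr_le0 expR_ge0. Qed.

Lemma inv_lin_cvg0 (c : R) : 0 < c -> (1 + n%:R * c)^-1 @[n --> \oo] --> (0 : R).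
Proof.
move=> c0; apply/cvgr0Pnorm_lt => e e0.
near=> n.
have nc : 0 < 1 + n%:R * c by rewrite ltr_wpDr// mulr_ge0// ltW.
rewrite ger0_norm ?invr_ge0 ?ltW// invf_plt ?posrE//.
have : (e * c)^-1 < n%:R.
  by near: n; exact: nbhs_infty_gtr.
rewrite invfM ltr_pdivrMr// => h; lra.
Unshelve. all: end_near. Qed.

(** All bounds come from exp x >= 1 + x, applied to n * arc_sign and to the
    tail, and give a rate of order 1 / n. *)
Lemma cutoff_cvg b t : - pi < b -> b < pi -> - pi < t -> t < pi -> t != b ->
  cutoff b n t @[n --> \oo] --> ((t < b)%R%:R : R).
Proof.
move=> lb br lt tr tb; case: ltP => [tlb|btl].
  have s0 := arc_sign_gt0 br lt tlb.
  have h n : 1 - (1 + n%:R * arc_sign b t)^-1 <= cutoff b n t <= 1.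
    rewrite cutoff_le1 andbT; apply: le_trans (expR_ge1Dx _); rewrite lerD2l lerN2.
    rewrite /cutoff_tail mulNr expRN lef_pV2 ?posrE ?expR_gt0//.
      exact: expR_ge1Dx.
    by rewrite ltr_wpDr// mulr_ge0// ltW.
  apply: (squeeze_cvgr (nearW _ h)); last exact: cvg_cst.
  rewrite -[X in _ --> X]subr0; apply: cvgB; first exact: cvg_cst.
  exact: inv_lin_cvg0.
have {btl}btl : b < t by rewrite lt_neqAle eq_sym tb.
have s0 : 0 < - arc_sign b t by rewrite oppr_gt0; exact: arc_sign_lt0.
have h n : 0 <= cutoff b n t <= (1 + n%:R * - arc_sign b t)^-1.
  rewrite cutoff_ge0/= /cutoff expRN lef_pV2 ?posrE ?expR_gt0//; last first.
    by rewrite ltr_wpDr// mulr_ge0// ltW.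
  apply: (@le_trans _ _ (cutoff_tail b n t)).
    by rewrite /cutoff_tail mulNr -mulrN; exact: expR_ge1Dx.
  by apply: le_trans (expR_ge1Dx _); rewrite lerDr.
apply: (squeeze_cvgr (nearW _ h)); first exact: cvg_cst.
exact: inv_lin_cvg0.
Qed.

Lemma cutoff_orthogonal_prim0 d b : - pi < b -> b < pi -> integ d ->
  (forall n, I (fun t => d t * cutoff b n t) = 0) -> prim d b = 0.
Proof.
move=> lb br di d0; have mc := @measurable_circle R.
have md := integrable_EFin_measurable di.
pose chi t : R := (t < b)%R%:R.
have mchi : measurable_fun circle chi.
  rewrite (_ : chi = fun t => if t < b then 1 else 0); last first.
    by apply/funext => z; rewrite /chi; case: ifP.
  by apply: measurable_funTS; apply: measurable_fun_ifT => //; exact: measurable_fun_ltr.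
have mcut n : measurable_fun circle (cutoff b n).
  apply: measurable_funTS; apply: continuous_measurable_fun.
  exact: smooth_expr_continuous (smooth_cutoff b n).
have -> : prim d b = I (fun t => d t * chi t).
  by rewrite -(prim_indic di (lexx pi) (ltW br)).
have [] := @Rdominated_cvg _ _ _ lam circle (fun n t => d t * cutoff b n t)
  (fun t => d t * chi t) (fun t => `|d t|) mc.
- by move=> n; apply: measurable_funM => //; exact: mcut.
- by apply: measurable_funM => //; exact: mchi.
- exists [set - pi; b]; split.
  + by apply: measurableU; exact: measurable_set1.
  + by apply: countable_lebesgue_measure0; apply: finite_set_countable; exact: finite_set2.
  move=> t /= ct; apply: contrapT => /not_orP[tpi tb]; apply: ct => ct.
  apply: cvgM; first exact: cvg_cst.
  move: ct; rewrite circleE => /andP[lt tr]; apply: cutoff_cvg => //.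
    by rewrite lt_neqAle lt andbT; apply/eqP => e; apply: tpi.
  exact/eqP.
- exact: integrable_norm.
- by apply/aeW => t _ n; rewrite normrM ler_piMr// ger0_norm ?cutoff_ge0// cutoff_le1.
move=> _; rewrite (_ : (fun n => _) = cst 0); last exact/funext.
by move=> /cvg_lim <- //; rewrite lim_cst.
Qed.

(** By Lebesgue's differentiation theorem d is almost everywhere the
    derivative of its primitive, which vanishes identically. *)
Lemma prim0_ae0 d : integ d -> (forall b, - pi < b -> b < pi -> prim d b = 0) ->
  {ae lam, forall x, circle x -> d x = 0}.
Proof.
move=> di d0; have mc := @measurable_circle R.
pose f := d \_ circle.
have fi : lam.-integrable setT (EFin \o f).
  by rewrite /f -restrict_EFin; apply/(integrable_mkcond _ mc).
have floc : locally_integrable [set: R] f by exact: (@integrable_locally R d circle mc di).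
have fiy y : lam.-integrable `]-oo, y] (EFin \o f).
  by apply: (integrableS _ _ _ fi) => //; exact: measurableT.
have FE x : circle x -> \int[lam]_(t in `]-oo, x]) f t = prim d x.
  rewrite circleE => /andP[lx xr].
  rewrite -Rintegral_mkcondr /prim Rintegral_itv_bndo_bndc; last exact: integ_prim (ltW xr) di.
  congr Rintegral; apply/seteqP; split => t /=; rewrite circleE !in_itv/=.
    by move=> [-> /andP[->]].
  by move=> /andP[-> tx]; rewrite tx (le_lt_trans tx xr).
have ne : {ae lam, forall x, x <> - pi}.
  exists [set - pi]; split => //; first exact: lebesgue_measure_set1.
  by move=> x /= /contrapT.
apply: (@filterS2 _ _ (ae_filter_ringOfSetsType lam) _ _ _ _ ne (FTC1Ny fiy floc)) => x xpi [dF F'] cx.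
have xin : - pi < x < pi.
  move: cx; rewrite circleE => /andP[lx ->]; rewrite andbT lt_neqAle lx andbT.
  by apply/eqP => e; apply: xpi.
have -> : d x = f x by rewrite /f patchE mem_set.
rewrite -F' derive1E.
rewrite (@near_eq_derive _ _ _ _ (cst 0)) ?derive_cst//.
near=> y.
have /andP[yl yr] : - pi < y < pi.
  have : y \in `]- pi, pi[ by near: y; apply: near_in_itvoo; rewrite in_itv.
  by rewrite in_itv.
by rewrite FE ?d0// circleE ltW.
Unshelve. all: end_near. Qed.
End du_bois_reymond.

(** * Weak derivatives on the circle *)

Section weak_derivatives.
Context {R : realType}.
Notation lam := (@lebesgue_measure R).
Notation pi := (@pi R).
Notation integ f := (lam.-integrable circle (EFin \o f)).
Notation I f := (\int[lam]_(x in circle) f x).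
Implicit Types (f g d F w h theta : R -> R) (x y t s b : R).

Lemma aeS (P Q : R -> Prop) : {ae lam, forall x, P x} ->
  (forall x, P x -> Q x) -> {ae lam, forall x, Q x}.
Proof. by move=> h PQ; apply: (@filterS _ _ (ae_filter_ringOfSetsType lam) _ _ PQ). Qed.

Lemma aeS2 (P Q S : R -> Prop) : {ae lam, forall x, P x} -> {ae lam, forall x, Q x} ->
  (forall x, P x -> Q x -> S x) -> {ae lam, forall x, S x}.
Proof. by move=> h k PQ; apply: (@filterS2 _ _ (ae_filter_ringOfSetsType lam) _ _ _ PQ). Qed.

Local Notation "f =ae g" := ({ae lam, forall x, circle x -> f x = g x})
  (at level 70, only parsing).

Lemma ae_sym f g : f =ae g -> g =ae f.
Proof. by move=> fg; apply: (aeS fg) => x h cx; rewrite h. Qed.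

Lemma ae_trans f g h : f =ae g -> g =ae h -> f =ae h.
Proof. by move=> fg gh; apply: (aeS2 fg gh) => x e1 e2 cx; rewrite e1// e2. Qed.

Lemma eq_I f g : (forall x, circle x -> f x = g x) -> I f = I g.
Proof. by move=> fg; apply: eq_Rintegral => x /set_mem; exact: fg. Qed.

Lemma smooth_expr_test b n f : smooth_expr b n f -> test_function f.
Proof.
move=> sf; split; first exact: smooth_expr_periodic sf.
by move=> k x; exact: smooth_expr_derivable (smooth_expr_derive1n k sf).
Qed.

Lemma test_cst (c : R) : test_function (fun=> c).
Proof. exact: (@smooth_expr_test 0 0 _ (smooth_cst 0 0 c)). Qed.

Lemma integ_smooth b n f : smooth_expr b n f -> integ f.
Proof. by move=> /smooth_expr_test/test_AC[/AC_integ]. Qed.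

Lemma integM_smooth b n f d : integ d -> smooth_expr b n f ->
  integ (fun t => d t * f t).
Proof. by move=> di /smooth_expr_test/test_AC[h _]; exact: integM h di. Qed.

Lemma test_orthogonal_ae0 d : integ d ->
  (forall theta, test_function theta -> I (fun t => d t * theta t) = 0) ->
  d =ae (fun=> 0).
Proof.
move=> di d0; apply: prim0_ae0 => // b lb br.
apply: cutoff_orthogonal_prim0 => // n; apply: d0.
exact: smooth_expr_test (smooth_cutoff b n).
Qed.

Lemma I_cst (c : R) : I (fun=> c) = c * (2 * pi).
Proof.
rewrite Rintegral_cst; last exact: measurable_circle.
by congr (_ * _); rewrite -[RHS]/(fine (2 * pi)%:E) -lebesgue_circle.
Qed.

(** The lemma of du Bois-Reymond. A cutoff minus its mean is the derivative of
    a test function, so that d minus its mean is orthogonal to all cutoffs. *)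
Lemma test_derive_orthogonal_cst d : integ d ->
  (forall theta, test_function theta -> I (fun t => d t * derive1 theta t) = 0) ->
  exists m, d =ae (fun=> m).
Proof.
move=> di d0; have mc := @measurable_circle R; have pi0 := @pi_gt0 R.
pose m := I d / (2 * pi); exists m.
have dmi : integ (fun t => d t - m) by apply: integrableEFinB => //; exact: integ_cst.
suff : (fun t => d t - m) =ae (fun=> 0).
  by move=> h; apply: (aeS h) => x e cx; apply/eqP; rewrite -subr_eq0 e.
apply: prim0_ae0 => // b lb br.
apply: cutoff_orthogonal_prim0 => // n.
have sc := smooth_cutoff b n.
pose k := I (cutoff b n) / (2 * pi).
have hi := integ_smooth sc.
have s0 : smooth_expr b n (fun t => cutoff b n t + (- k)).
  by apply: smooth_add => //; exact: smooth_cst.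
have k0 : I (fun t => cutoff b n t + (- k)) = 0.
  rewrite RintegralD//; last exact: integ_cst.
  by rewrite I_cst mulNr /k divfK ?subrr// mulf_neq0 ?pnatr_eq0// lt0r_neq0.
have [theta tt te] := smooth_expr_primitive s0 k0.
have := d0 _ tt; rewrite te.
have -> : I (fun t => d t * (cutoff b n t - k)) =
    I (fun t => d t * cutoff b n t) - k * I d.
  rewrite -RintegralZl// -RintegralB//; first by apply: eq_Rintegral => t _; ring.
  - exact: integM_smooth di sc.
  - exact: integrableEFinZ.
move=> e.
have -> : I (fun t => (d t - m) * cutoff b n t) =
    I (fun t => d t * cutoff b n t) - m * I (cutoff b n).
  rewrite -RintegralZl// -RintegralB//; first by apply: eq_Rintegral => t _; ring.
  - exact: integM_smooth di sc.
  - exact: integrableEFinZ.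
by rewrite -[RHS]e /m /k; congr (_ - _); ring.
Qed.

(** The constant 1 is a test function on the circle. *)
Lemma weak_derivative_mean0 f w : weak_derivative f w -> I w = 0.
Proof.
move=> [fi wi /(_ _ (test_cst 1))].
have -> : I (fun x => w x * 1) = I w by apply: eq_Rintegral => x _; rewrite mulr1.
have -> : I (fun x => f x * derive1 (fun=> 1 : R) x) = 0.
  rewrite -[RHS](mul0r (2 * pi)) -I_cst; apply: eq_Rintegral => x _.
  by rewrite derive1_cst mulr0.
by move=> /eqP; rewrite eq_sym oppr_eq0 => /eqP.
Qed.

(** The difference between f and the primitive of w is orthogonal to the
    derivatives of all test functions, hence constant up to a null set. *)
Lemma weak_derivative_AC f w : weak_derivative f w ->
  exists F, AC F w /\ f =ae F.
Proof.
move=> fw; have w0 := weak_derivative_mean0 fw.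
have [fi wi fE] := fw; have mc := @measurable_circle R.
have Pw := AC_prim wi; have [Pi _ PE] := ACper_weak_derivative Pw w0.
have di : integ (fun t => f t - prim w t) by exact: integrableEFinB.
have [|m h] := @test_derive_orthogonal_cst (fun t => f t - prim w t) di.
  move=> theta tt; have [th _] := test_AC tt.
  have td : exists M, forall x, circle x -> `|derive1 theta x| <= M.
    have cd := test_derive_continuous tt.
    have [M [_ hM]] := compact_bounded (continuous_compact (continuous_subspaceT cd) (@segment_compact _ (- pi) pi)).
    exists (M + 1) => x; rewrite circleE => /andP[lx xr].
    apply: (hM (M + 1)); first by rewrite ltrDl.
    by exists x => //=; rewrite in_itv/= lx ltW.
  have [M hM] := td.
  have mdt : measurable_fun circle (derive1 theta).
    exact: measurable_funTS (continuous_measurable_fun (test_derive_continuous tt)).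
  rewrite (@eq_I _ (fun t => f t * derive1 theta t - prim w t * derive1 theta t)); last first.
    by move=> t _; rewrite mulrBl.
  rewrite RintegralB//; [|exact: (integrableM_bounded mc _ mdt hM)..].
  by rewrite fE// PE// subrr.
exists (fun x => prim w x + m); split.
  split => // x cx; rewrite primNpi add0r; ring.
by apply: (aeS h) => x e cx; rewrite -(e cx); ring.
Qed.

Lemma weak_derivative_ae_eq f f' w : f =ae f' -> integ f' ->
  weak_derivative f w -> weak_derivative f' w.
Proof.
move=> ff f'i [fi wi h]; split => // theta tt; rewrite -h//.
by apply: ae_eq_Rintegral; apply: (aeS ff) => x e cx; rewrite e.
Qed.

Lemma weak_derivative_unique f w w' : weak_derivative f w ->
  weak_derivative f w' -> w =ae w'.
Proof.
move=> [_ wi e] [_ w'i e']; have mc := @measurable_circle R.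
suff h : (fun t => w t - w' t) =ae (fun=> 0).
  by apply: (aeS h) => x ex cx; apply/eqP; rewrite -subr_eq0 ex.
apply: test_orthogonal_ae0; first exact: integrableEFinB.
move=> theta tt; have [th _] := test_AC tt.
rewrite (@eq_I _ (fun t => w t * theta t - w' t * theta t)); last first.
  by move=> t _; rewrite mulrBl.
rewrite RintegralB//; [|exact: integM th _..].
by have := e _ tt; rewrite (e' _ tt) => /oppr_inj ->; rewrite subrr.
Qed.

Lemma wderivP f w : weak_derivative f w -> weak_derivative f (wderiv f).
Proof. by move=> fw; apply: (@getPex _ (fun g => weak_derivative f g)); exists w. Qed.

(** As wderiv picks some weak derivative, it is computed by exhibiting an
    absolutely continuous representative and using uniqueness. *)
Lemma wderiv_ae f F w : AC F w -> I w = 0 -> f =ae F -> integ f ->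
  weak_derivative f (wderiv f) /\ wderiv f =ae w.
Proof.
move=> Fw w0 fF fi.
have h := weak_derivative_ae_eq (ae_sym fF) fi (ACper_weak_derivative Fw w0).
have h' := wderivP h; split => //; exact: weak_derivative_unique h' h.
Qed.

End weak_derivatives.

(** * Truncations of the logarithmic kernel *)

Section hilbert_log_potential.
Context {R : realType}.
Notation lam := (@lebesgue_measure R).
Notation pi := (@pi R).
Notation integ f := (lam.-integrable circle (EFin \o f)).
Notation I f := (\int[lam]_(x in circle) f x).
Implicit Types (f g F K k w c u : R -> R) (x y t s a b : R).

Definition log_potential w x : R := I (fun t => logker (x - t) * w t).

(** The integrated form of the relation K' = k. It can be glued along adjacent
    intervals even when K has a corner at the common endpoint. *)
Definition local_primitive K k a b : Prop := forall t, a <= t <= b ->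
  lam.-integrable `[a, t[ (EFin \o k) /\ \int[lam]_(s in `[a, t[) k s = K t - K a.

Lemma local_primitive_cat K k a b e : a <= b -> b <= e ->
  local_primitive K k a b -> local_primitive K k b e -> local_primitive K k a e.
Proof.
move=> ab bc h1 h2 t /andP[at_ tc]; have [tb|/ltW bt] := leP t b.
  by apply: h1; rewrite at_.
have [i1 E1] := h1 b ltac:(by rewrite ab lexx).
have [i2 E2] := h2 t ltac:(by rewrite bt tc).
have U : `[a, t[%classic = `[a, b[ `|` `[b, t[ :> set (measurableTypeR R).
  by rewrite -itv_bndbnd_setU ?bnd_simp.
have iU : lam.-integrable `[a, t[ (EFin \o k).
  rewrite U; apply/integrableP; split.
    by apply/measurable_funU => //; split; [exact: measurable_int i1|exact: measurable_int i2].
  rewrite ge0_integral_setU//.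
  - by apply: lte_add_pinfty; [case/integrableP : i1|case/integrableP : i2].
  - apply: measurableT_comp => //; apply/measurable_funU => //.
    by split; [exact: measurable_int i1|exact: measurable_int i2].
  - by apply/disj_setPS => s [] /=; rewrite !in_itv/= => /andP[_ ?] /andP[? _]; lra.
split => //; rewrite U Rintegral_setU//.
- by rewrite E1 E2; ring.
- by rewrite -U.
- by apply/disj_setPS => s [] /=; rewrite !in_itv/= => /andP[_ ?] /andP[? _]; lra.
Qed.

Lemma local_primitive_FTC K k K' c a b :
  (forall t, a <= t <= b -> is_derive t 1 K' (c t)) ->
  (forall t, a <= t <= b -> {for t, continuous c}) ->
  (forall t, a <= t <= b -> K t = K' t) -> (forall t, a <= t < b -> k t = c t) ->
  local_primitive K k a b.
Proof.
move=> dK cc KK kc t /andP[at_ tb].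
have [ci e] := @FTC2_halfopen R c K' a t at_
  (fun s h => dK s ltac:(by case/andP: h => -> /le_trans ->))
  (fun s h => cc s ltac:(by case/andP: h => -> /le_trans ->)).
have ck s : `[a, t[%classic s -> c s = k s.
  by rewrite /= in_itv/= => /andP[as_ st]; rewrite kc// as_ (lt_le_trans st tb).
have mI : measurable (`[a, t[%classic : set (measurableTypeR R)).
  exact: measurable_itv.
split; first exact: eq_integrable_EFin mI ci ck.
rewrite !KK ?lexx ?at_ ?(le_trans at_)// -e.
by apply: eq_Rintegral => s /set_mem h; rewrite ck.
Qed.

Lemma local_primitive_AC K k : local_primitive K k (- pi) pi ->
  AC K k /\ I k = K pi - K (- pi).
Proof.
have pi0 := @pi_gt0 R => h.
have [|ki e] := h pi; first by rewrite lexx andbT; lra.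
split => //; split => // x; rewrite circleE => /andP[lx xr].
have [|_] := h x; first by rewrite lx ltW.
by rewrite /prim => ->; ring.
Qed.

Lemma circle_distE x t : circle_dist x t = 2 * `|sin ((x - t) / 2)|.
Proof.
set S := sin _; have -> : 2 * `|S| = `|2 * S| by rewrite normrM ger0_norm.
rewrite /circle_dist -sqrtr_sqr; congr Num.sqrt; rewrite {}/S.
have c2 : cos (x - t) = 1 - 2 * sin ((x - t) / 2) ^+ 2.
  rewrite {1}(_ : x - t = ((x - t) / 2) *+ 2) ?cos_mulr2n ?cos2sin2; first by ring.
  by field.
have : cos (x - t) = cos x * cos t + sin x * sin t by exact: cosB.
rewrite c2; have := cos2Dsin2 x; have := cos2Dsin2 t; nra.
Qed.

Lemma logkerE (z : R) : logker z = - (ln (sin (z / 2) ^+ 2) / 2).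
Proof.
rewrite /logker; have [->|s0] := eqVneq (sin (z / 2)) 0.
  by rewrite normr0 expr0n/= ln0// mul0r.
by rewrite -(real_normK (num_real (sin (z / 2)))) lnXn ?normr_gt0// mulr2n; field.
Qed.

Definition half_cot x t : R := (tan ((x - t) / 2))^-1 / 2.

Lemma half_cotE x t : half_cot x t = cos ((x - t) / 2) / sin ((x - t) / 2) / 2.
Proof. by rewrite /half_cot /tan invf_div. Qed.

Lemma is_derive_half x t : is_derive t 1 (fun t => (x - t) / 2) (- 2^-1).
Proof.
have h1 := is_deriveB (is_derive_cst (x : R) t 1) (is_derive_id t 1).
have h2 := is_deriveM h1 (is_derive_cst (2^-1 : R) t 1).
by apply: (is_derive_eq h2); rewrite /GRing.scale/=; ring.
Qed.

Lemma is_derive_logker x t : sin ((x - t) / 2) != 0 ->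
  is_derive t 1 (fun t => logker (x - t)) (half_cot x t).
Proof.
move=> s0.
have -> : (fun t => logker (x - t)) =
    (fun t => (- 2^-1) * ln (sin ((x - t) / 2) * sin ((x - t) / 2))).
  by apply/funext => z; rewrite logkerE expr2; field.
have d1 := is_derive1_comp (is_derive_sin _) (is_derive_half x t).
have d2 := is_deriveM d1 d1.
have p0 : 0 < sin ((x - t) / 2) * sin ((x - t) / 2).
  by rewrite -expr2 exprn_even_gt0.
have d3 := @is_derive1_comp R (@ln R) (fun t => sin ((x - t) / 2) * sin ((x - t) / 2)) t _ _
  (is_derive1_ln p0) d2.
have d4 := is_deriveM (is_derive_cst (- 2^-1 : R) t 1) d3.
apply: (is_derive_eq d4); rewrite half_cotE /GRing.scale/=; field.
exact: s0.
Qed.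

Lemma continuous_half_cot x t : sin ((x - t) / 2) != 0 -> {for t, continuous (half_cot x)}.
Proof.
move=> s0.
rewrite (_ : half_cot x = fun t => cos ((x - t) / 2) * (sin ((x - t) / 2))^-1 * 2^-1); last first.
  by apply/funext => z; rewrite half_cotE.
have cl : {for t, continuous (fun t => (x - t) / 2)}.
  have [d _] := is_derive_half x t.
  exact/differentiable_continuous/derivable1_diffP.
have cs : {for t, continuous (fun t => sin ((x - t) / 2))}.
  exact: (continuous_comp cl (@continuous_sin R _)).
have cc : {for t, continuous (fun t => cos ((x - t) / 2))}.
  exact: (continuous_comp cl (@continuous_cos R _)).
by apply: cvgM; [apply: cvgM => //; apply: cvgV|exact: cvg_cst].
Qed.

Section truncated_kernel.
Variables (x r : R).
Hypotheses (r0 : 0 < r) (lr : - pi < x - r) (rr : x + r < pi).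

Let far t := (t < x - r) || (x + r <= t).
(** The kernel flattened to a constant at distance less than r from x. Its
    derivative is the cotangent kernel with the singularity removed as in the
    principal value. *)
Definition trunc_kernel t : R := if far t then logker (x - t) else logker r.
Definition trunc_cot t : R := if far t then half_cot x t else 0.

Let sin_neq0 t : - pi <= t <= pi -> t <= x - r \/ x + r <= t -> sin ((x - t) / 2) != 0.
Proof.
have [r0' lr' rr'] : [/\ 0 < r, - pi < x - r & x + r < pi] by [].
move=> /andP[lt tr] [h|h].
  by rewrite lt0r_neq0// sin_gt0_pi//; apply/andP; split; lra.
rewrite (_ : (x - t) / 2 = - ((t - x) / 2)); last by field.
by rewrite sinN oppr_eq0 lt0r_neq0// sin_gt0_pi//; apply/andP; split; lra.
Qed.

Lemma trunc_kernel_AC : AC trunc_kernel trunc_cot /\ I trunc_cot = 0.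
Proof.
have [r0' lr' rr'] : [/\ 0 < r, - pi < x - r & x + r < pi] by [].
suff /local_primitive_AC[h ->] : local_primitive trunc_kernel trunc_cot (- pi) pi.
  split => //; rewrite /trunc_kernel /far.
  rewrite (_ : x + r <= pi); last exact: ltW.
  rewrite orbT lr/= -(logkerD2pi (x - pi)).
  by rewrite (_ : x - pi + 2 * pi = x - - pi) ?subrr//; ring.
apply: (@local_primitive_cat _ _ _ (x - r)); [lra|lra| |].
  apply: (@local_primitive_FTC _ _ (fun t => logker (x - t)) (half_cot x)).
  - by move=> t /andP[lt tx]; apply/is_derive_logker/sin_neq0; [apply/andP; split; lra|left].
  - by move=> t /andP[lt tx]; apply/continuous_half_cot/sin_neq0; [apply/andP; split; lra|left].
  - move=> t /andP[_ tx]; rewrite /trunc_kernel /far; case: ltP => //= xt.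
    by case: ifP => // _; congr logker; lra.
  - by move=> t /andP[_ tx]; rewrite /trunc_cot /far tx.
apply: (@local_primitive_cat _ _ _ (x + r)); [lra|lra| |].
  apply: (@local_primitive_FTC _ _ (fun=> logker r) (fun=> 0)).
  - by move=> t _; exact: cvg_cst.
  - move=> t /andP[lt tx]; rewrite /trunc_kernel /far; case: ltP => /= [|_]; first lra.
    by case: leP => // h; rewrite -logkerN; congr logker; lra.
  - move=> t /andP[lt tx]; rewrite /trunc_cot /far; case: ltP => /= [|_]; first lra.
    by case: leP => //; lra.
apply: (@local_primitive_FTC _ _ (fun t => logker (x - t)) (half_cot x)).
- by move=> t /andP[lt tx]; apply/is_derive_logker/sin_neq0; [apply/andP; split; lra|right].
- by move=> t /andP[lt tx]; apply/continuous_half_cot/sin_neq0; [apply/andP; split; lra|right].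
- by move=> t /andP[lt _]; rewrite /trunc_kernel /far lt orbT.
- by move=> t /andP[lt _]; rewrite /trunc_cot /far lt orbT.
Qed.

Lemma trunc_kernel_le t : circle t -> t != x -> 0 <= trunc_kernel t <= logker (x - t).
Proof.
have [r0' lr' rr'] : [/\ 0 < r, - pi < x - r & x + r < pi] by [].
rewrite circleE => /andP[lt tr] tx; rewrite /trunc_kernel; case: ifPn => [_|].
  by rewrite logker_ge0 lexx.
rewrite /far negb_or -!leNgt -ltNge => /andP[h1 h2]; rewrite logker_ge0/= /logker lerN2.
have pi0 := @pi_gt0 R.
have sr : 0 < sin (r / 2) by rewrite sin_gt0_pi//; apply/andP; split; lra.
have s1 : `|sin ((x - t) / 2)| = sin (`|x - t| / 2).
  have [xt|xt] := leP 0 (x - t).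
    by rewrite (ger0_norm xt) ger0_norm// sin_ge0_pi//; apply/andP; split; lra.
  rewrite (ltr0_norm xt) opprB (_ : (x - t) / 2 = - ((t - x) / 2)); last by field.
  rewrite sinN normrN.
  by rewrite ger0_norm// sin_ge0_pi//; apply/andP; split; lra.
have xt0 : 0 < `|x - t| by rewrite normr_gt0 subr_eq0 eq_sym.
have xtr : `|x - t| <= r by rewrite ler_norml; apply/andP; split; lra.
rewrite s1 (gtr0_norm sr) ler_ln ?posrE//; last first.
  by rewrite sin_gt0_pi//; apply/andP; split; lra.
move: xtr; rewrite le_eqVlt => /predU1P[->//|xtr]; apply: ltW.
rewrite ltr_sin ?in_itv/=; first by lra.
  by apply/andP; split; lra.
by apply/andP; split; lra.
Qed.

Lemma trunc_kernel_far t : r < `|x - t| -> trunc_kernel t = logker (x - t).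
Proof.
have [r0' lr' rr'] : [/\ 0 < r, - pi < x - r & x + r < pi] by [].
move=> h; rewrite /trunc_kernel /far; case: ltP => //= h1; case: leP => // h2.
by exfalso; move: h; apply/negP; rewrite -leNgt ler_norml; apply/andP; split; lra.
Qed.

End truncated_kernel.
End hilbert_log_potential.

(** * The Hilbert transform as a logarithmic potential *)

Section hilbert_limit.
Context {R : realType}.
Notation lam := (@lebesgue_measure R).
Notation pi := (@pi R).
Notation integ f := (lam.-integrable circle (EFin \o f)).
Notation I f := (\int[lam]_(x in circle) f x).
Implicit Types (f g F K k w c u : R -> R) (x y t s a b r : R).

Local Notation "f =ae g" := ({ae lam, forall x, circle x -> f x = g x})
  (at level 70, only parsing).

Lemma ae_neq a : {ae lam, forall t : R, t <> a}.
Proof.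
exists [set a]; split => //; first exact: lebesgue_measure_set1.
by move=> x /= /contrapT.
Qed.

Lemma trunc_kernel_limit w x (r_ : nat -> R) : integ w ->
  integ (fun t => logker (x - t) * w t) ->
  (forall n, [/\ 0 < r_ n, - pi < x - r_ n & x + r_ n < pi]) ->
  r_ n @[n --> \oo] --> 0 ->
  I (fun t => w t * trunc_kernel x (r_ n) t) @[n --> \oo] --> log_potential w x.
Proof.
move=> wi Uw rP r0; have mc := @measurable_circle R.
have [] := @Rdominated_cvg _ _ _ lam circle
  (fun n t => w t * trunc_kernel x (r_ n) t) (fun t => logker (x - t) * w t)
  (fun t => `|logker (x - t) * w t|) mc.
- move=> n; have [r0' lr rr] := rP n.
  apply: measurable_funM; first exact: integrable_EFin_measurable wi.
  exact: AC_measurable (trunc_kernel_AC r0' lr rr).1.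
- exact: integrable_EFin_measurable Uw.
- apply: (aeS (ae_neq x)) => t tx ct; rewrite mulrC.
  apply: cvgM; first exact: cvg_cst.
  apply: cvg_near_cst; near=> n; have [r1 r2 r3] := rP n; apply: (trunc_kernel_far r1 r2 r3).
  near: n; apply: (cvgr_lt 0 r0).
  by rewrite normr_gt0 subr_eq0; apply/eqP => e; apply: tx.
- exact: integrable_norm Uw.
- apply: (aeS (ae_neq x)) => t tx ct n.
  have [r0' lr rr] := rP n.
  have /andP[k0 k1] := trunc_kernel_le r0' lr rr ct (introN eqP tx).
  by rewrite !normrM mulrC ler_wpM2r// ger0_norm// ger0_norm ?logker_ge0.
- by [].
Unshelve. all: end_near. Qed.

Lemma abs_sin_half x t : circle x -> circle t ->
  `|sin ((x - t) / 2)| = sin (`|x - t| / 2).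
Proof.
rewrite !circleE => /andP[lx xr] /andP[lt tr]; have pi0 := @pi_gt0 R.
have [xt|xt] := leP 0 (x - t).
  by rewrite (ger0_norm xt) ger0_norm// sin_ge0_pi//; apply/andP; split; lra.
rewrite (ltr0_norm xt) opprB (_ : (x - t) / 2 = - ((t - x) / 2)); last by field.
by rewrite sinN normrN ger0_norm// sin_ge0_pi//; apply/andP; split; lra.
Qed.

Lemma circle_dist_far x t r : 0 < r -> - pi < x - r -> x + r < pi -> circle t ->
  t <> x + r ->
  (2 * sin (r / 2) < circle_dist x t) = (t < x - r) || (x + r <= t).
Proof.
move=> r0 lr rr ct txr; have pi0 := @pi_gt0 R.
have cx : circle x by rewrite circleE; apply/andP; split; lra.
rewrite circle_distE abs_sin_half// ltr_pM2l//.
move: ct; rewrite circleE => /andP[lt tr].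
have -> : (t < x - r) || (x + r <= t) = (r < `|x - t|).
  apply/idP/idP => [/orP[h|h]|].
  - by rewrite ger0_norm; lra.
  - have {h}h : x + r < t by rewrite lt_neqAle h andbT eq_sym; exact/eqP.
    by rewrite ler0_norm; lra.
  - by rewrite lter_normr => /orP[h|h]; apply/orP; [left|right]; lra.
have xt0 := normr_ge0 (x - t).
have xt2 : `|x - t| < 2 * pi - r by rewrite ltr_norml; apply/andP; split; lra.
have [xtpi|xtpi] := leP `|x - t| pi.
  rewrite ltr_sin ?in_itv/=; first by apply/idP/idP; lra.
    by apply/andP; split; lra.
  by apply/andP; split; lra.
have -> : sin (`|x - t| / 2) = sin (pi - `|x - t| / 2).
  by rewrite sinB sinpi cospi; ring.
rewrite ltr_sin ?in_itv/=; first by apply/idP/idP; lra.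
  by apply/andP; split; lra.
by apply/andP; split; lra.
Qed.

(** Integration by parts against the truncated kernel. On the circle the chord
    condition 2 sin (r / 2) < circle_dist x t means r < |x - t|. *)
Lemma truncated_hilbertE f u w x r : AC u w -> I w = 0 -> f =ae u ->
  0 < r -> - pi < x - r -> x + r < pi ->
  \int[lam]_(t in circle `&` [set t | 2 * sin (r / 2) < circle_dist x t])
     (f t / tan ((x - t) / 2) / (2 * pi)) =
  - I (fun t => w t * trunc_kernel x r t) / pi.
Proof.
move=> uw w0 fu r0 lr rr; have pi0 := @pi_gt0 R.
have [kk k0] := trunc_kernel_AC r0 lr rr.
have mc := @measurable_circle R.
rewrite -(ACper_ibp uw w0 kk k0) Rintegral_mkcondr -RintegralZr//; last first.
  by apply: (eq_integrable_EFin mc (integM uw (proj1 kk))) => t _; rewrite mulrC.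
apply: ae_eq_Rintegral; apply: (aeS2 fu (ae_neq (x + r))) => t ft txr ct.
rewrite patchE (_ : (t \in _) = (2 * sin (r / 2) < circle_dist x t)); last first.
  by apply/idP/idP; rewrite inE.
rewrite circle_dist_far// ft// /trunc_cot; case: ifP => _; last by rewrite mulr0 mul0r.
by rewrite /half_cot [(2 * pi)^-1]invfM !mulrA.
Qed.

(** Integration by parts moves the derivative from the kernel to u and turns
    the singular cotangent into the integrable logarithm, whose truncations
    converge by domination. *)
Lemma hilbertE f u w x : AC u w -> I w = 0 -> f =ae u -> - pi < x -> x < pi ->
  integ (fun t => logker (x - t) * w t) ->
  hilbert f x = log_potential w x / pi.
Proof.
move=> uw w0 fu lx xr Uw; have [wi _] := uw; have pi0 := @pi_gt0 R.
rewrite /hilbert -[RHS]opprK -mulNr; congr (- _); apply: cvg_lim => //.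
apply/cvg_at_rightP => e_ [e0 ecvg].
have [d [d0 dl dr]] : exists d, [/\ 0 < d, d <= x + pi & d <= pi - x].
  exists (Num.min (x + pi) (pi - x)); rewrite lt_min !ge_min !lexx orbT; split => //.
  by apply/andP; split; lra.
(* the chord e subtends the arc 2 asin (e / 2); r'_ corrects the finitely
   many n for which this arc reaches beyond the fundamental domain *)
pose r_ n := 2 * asin (e_ n / 2).
have asin0 : asin 0 = 0 :> R.
  by rewrite -[in LHS]sin0 sinK// in_itv/=; apply/andP; split; lra.
have rcvg : r_ n @[n --> \oo] --> 0.
  rewrite -[X in _ --> X](mulr0 2); apply: cvgM; first exact: cvg_cst.
  have h : e_ n / 2 @[n --> \oo] --> 0.
    by rewrite -[X in _ --> X](mul0r 2^-1); apply: cvgM => //; exact: cvg_cst.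
  have c0 : {for 0, continuous (@asin R)} by apply: continuous_asin; apply/andP; split; lra.
  by rewrite -asin0; exact: (continuous_cvg _ c0 h).
pose r'_ n := if (0 < r_ n < d) then r_ n else d / 2 * n.+1%:R^-1.
have n10 (n : nat) : 0 < (n.+1%:R^-1 : R) by rewrite invr_gt0.
have n11 (n : nat) : (n.+1%:R^-1 : R) <= 1 by rewrite invf_le1 ?ltr0n// ler1n.
have r'P n : [/\ 0 < r'_ n, - pi < x - r'_ n & x + r'_ n < pi].
  rewrite /r'_; case: ifP => [/andP[h1 h2]|_].
    by move: (r_ n) h1 h2 => ? h1 h2; split => //; lra.
  have h1 : 0 < d / 2 * n.+1%:R^-1 by rewrite mulr_gt0// divr_gt0.
  have h2 : d / 2 * n.+1%:R^-1 <= d / 2 by rewrite ler_piMr// ltW// divr_gt0.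
  by move: (d / 2 * _) h1 h2 => ? h1 h2; split => //; lra.
have rgood : \forall n \near \oo, 0 < r_ n < d /\ 2 * sin (r_ n / 2) = e_ n.
  near=> n.
  have e1 : e_ n < 1 by near: n; apply: (cvgr_lt 0 ecvg); exact: ltr01.
  have se : sin (asin (e_ n / 2)) = e_ n / 2.
    by apply: asinK; rewrite in_itv/=; have := e0 n; move=> ?; apply/andP; split; lra.
  have rn : r_ n / 2 = asin (e_ n / 2) by rewrite /r_; field.
  split; last by rewrite rn se; field.
  have -> /= : r_ n < d by near: n; exact: (cvgr_lt 0 rcvg).
  rewrite andbT ltNge; apply/negP => h.
  have : sin (asin (e_ n / 2)) <= 0.
    rewrite -[asin _]opprK sinN oppr_le0 sin_ge0_pi// -rn.
    have hh : - (pi / 2) <= r_ n / 2.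
      by rewrite rn asin_geNpi2//; have := e0 n => ?; apply/andP; split; lra.
    by move: (r_ n) h hh => z h hh; apply/andP; split; lra.
  by rewrite se; have := e0 n => ?; lra.
have r'cvg : r'_ n @[n --> \oo] --> 0.
  apply: cvg_trans rcvg; apply: near_eq_cvg; near=> n.
  rewrite /r'_; case: ifP => //; have : 0 < r_ n < d; last by move=> ->.
  by near: n; apply: filterS rgood => n [].
have := trunc_kernel_limit wi Uw r'P r'cvg.
move=> h; have {}h : - I (fun t => w t * trunc_kernel x (r'_ n) t) / pi @[n --> \oo]
    --> - log_potential w x / pi.
  by apply: cvgM; [exact: cvgN|exact: cvg_cst].
apply: cvg_trans h; apply: near_eq_cvg; near=> n.
have [rd re] : 0 < r_ n < d /\ 2 * sin (r_ n / 2) = e_ n by near: n.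
have [h1 h2 h3] := r'P n.
rewrite -(truncated_hilbertE uw w0 fu h1 h2 h3) /r'_ rd.
by rewrite re.
Unshelve. all: end_near. Qed.
End hilbert_limit.

(** * Bounds on logarithmic potentials *)

Section potential_bounds.
Context {R : realType}.
Notation lam := (@lebesgue_measure R).
Notation pi := (@pi R).
Notation integ f := (lam.-integrable circle (EFin \o f)).
Notation I f := (\int[lam]_(x in circle) f x).
Implicit Types (f g F K k w c u : R -> R) (x y t s a b r : R).

Local Notation "f =ae g" := ({ae lam, forall x, circle x -> f x = g x})
  (at level 70, only parsing).

Definition logker_mass : R := I logker.

Lemma logker_mass_ge0 : 0 <= logker_mass.
Proof. by apply: Rintegral_ge0 => x _; exact: logker_ge0. Qed.

Lemma integ_logker_sub x : circle x -> integ (fun t => logker (x - t)).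
Proof.
move=> cx; apply: integrable_circle_reflection => //.
- exact: measurable_logker.
- exact: logkerD2pi.
- exact: integrable_logker.
Qed.

Lemma I_logker_sub x : circle x -> I (fun t => logker (x - t)) = logker_mass.
Proof.
move=> cx; rewrite (Rintegral_circle_reflection cx)//.
- exact: measurable_logker.
- exact: logkerD2pi.
Qed.

Lemma logkerC x y : logker (x - y) = logker (y - x).
Proof. by rewrite -logkerN opprB. Qed.

Lemma measurable_snd_circle w : measurable_fun circle w ->
  measurable_fun (circle `*` circle) (fun z : R * R => w z.2).
Proof.
move=> mw; apply: (measurable_comp (F := circle)) => //; first exact: measurable_circle.
- by move=> _ [z [? ?] <-].
- exact: measurable_funTS measurable_snd.
Qed.

Lemma measurable_logker_sub (D : set (R * R)) :
  measurable_fun D (fun z : R * R => logker (z.1 - z.2)).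
Proof.
apply: measurable_funTS; apply: measurableT_comp; first exact: measurable_logker.
by apply: measurable_funB; [exact: measurable_fst|exact: measurable_snd].
Qed.

Lemma potential_finite w : integ w ->
  (\int[lam]_(x in circle) \int[lam]_(t in circle) `|logker (x - t) * w t|%:E < +oo)%E.
Proof.
move=> wi; have mc := @measurable_circle R.
have mw := integrable_EFin_measurable wi.
have mf : measurable_fun (circle `*` circle) (fun z : R * R => `|logker (z.1 - z.2) * w z.2|%:E).
  apply/measurable_EFinP; apply: measurableT_comp => //; apply: measurable_funM.
    exact: measurable_logker_sub.
  exact: measurable_snd_circle.
rewrite (@tonelli_set _ _ _ _ _ lam lam _ _ mc mc (fun x t => `|logker (x - t) * w t|%:E) mf); last first.
  by move=> x t _ _; rewrite lee_fin.
rewrite (_ : (\int[lam]_(t in circle) _)%E = (\int[lam]_(t in circle) (logker_mass * `|w t|)%:E)%E).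
  apply: integrable_lty => //; apply: integrableEFinZ => //; exact: integrable_norm.
apply: eq_integral => t /set_mem ct.
rewrite -(I_logker_sub ct) -RintegralZr//; last exact: integ_logker_sub.
rewrite EFin_Rintegral//; last first.
  have := integrableEFinZ `|w t| mc (integ_logker_sub ct).
  by move=> h; apply: (eq_integrable_EFin mc h) => s _; rewrite mulrC.
by apply: eq_integral => s _; rewrite normrM ger0_norm ?logker_ge0// logkerC.
Qed.

Let mpot w : integ w ->
  measurable_fun (circle `*` circle) (fun z : R * R => logker (z.1 - z.2) * w z.2).
Proof.
move=> /integrable_EFin_measurable mw; apply: measurable_funM.
  exact: measurable_logker_sub.
exact: measurable_snd_circle.
Qed.

Lemma integ_log_potential w : integ w -> integ (log_potential w).
Proof.
move=> wi; have mc := @measurable_circle R.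
exact: (@Rfubini_integrable _ _ _ _ R lam lam _ _ mc mc _ (mpot wi) (potential_finite wi)).
Qed.

Lemma potential_ae w : integ w ->
  {ae lam, forall x, circle x -> integ (fun t => logker (x - t) * w t)}.
Proof.
move=> wi; have mc := @measurable_circle R.
exact: (@Rfubini_ae _ _ _ _ R lam lam _ _ mc mc _ (mpot wi) (potential_finite wi)).
Qed.

Lemma le_I_ae f g : integ f -> integ g ->
  {ae lam, forall x, circle x -> f x <= g x} -> I f <= I g.
Proof.
move=> fi gi fg; have mc := @measurable_circle R.
have mf := integrable_EFin_measurable fi; have mg := integrable_EFin_measurable gi.
have e : f =ae (fun x => Num.min (f x) (g x)).
  by apply: (aeS fg) => x h cx; rewrite min_l// h.
rewrite (ae_eq_Rintegral e); apply: le_Rintegral => //.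
- apply: (ae_eq_integrable mc e) => //; exact: measurable_minr.
- by move=> x _; rewrite ge_min lexx orbT.
Qed.

(** Fubini's theorem, as every translate of the kernel has the same mass. *)
Lemma log_potential_L1 w : integ w ->
  I (fun x => `|log_potential w x|) <= logker_mass * I (fun t => `|w t|).
Proof.
move=> wi; have mc := @measurable_circle R.
have nwi := integrable_norm wi.
have ip := integ_log_potential wi; have ipn := integ_log_potential nwi.
apply: (@le_trans _ _ (I (log_potential (fun t => `|w t|)))).
  apply: le_I_ae => //; first exact: integrable_norm.
  apply: (aeS (potential_ae wi)) => x Uw cx; rewrite /log_potential.
  apply: (le_trans (le_normr_Rintegral mc (Uw cx))).
  rewrite le_eqVlt; apply/orP; left; apply/eqP; apply: eq_Rintegral => t _.
  by rewrite normrM ger0_norm// logker_ge0.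
rewrite /log_potential.
rewrite (@Rfubini _ _ _ _ R lam lam _ _ mc mc _ (mpot nwi) (potential_finite nwi)).
rewrite -RintegralZl// le_eqVlt; apply/orP; left; apply/eqP; apply: eq_Rintegral => t /set_mem ct.
rewrite -(I_logker_sub ct) -RintegralZr//; last exact: integ_logker_sub.
by apply: eq_Rintegral => s _; rewrite logkerC.
Qed.

Lemma integ_potential_bounded w (B : R) x : measurable_fun circle w ->
  (forall t, circle t -> `|w t| <= B) -> circle x ->
  integ (fun t => logker (x - t) * w t).
Proof.
move=> mw wB cx; have mc := @measurable_circle R.
exact: integrableM_bounded mc (integ_logker_sub cx) mw wB.
Qed.

Lemma log_potential_bound w (B : R) x : measurable_fun circle w ->
  (forall t, circle t -> `|w t| <= B) -> circle x ->
  `|log_potential w x| <= B * logker_mass.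
Proof.
move=> mw wB cx; have mc := @measurable_circle R.
rewrite -(I_logker_sub cx) -RintegralZl//; last exact: integ_logker_sub.
apply: normr_Rintegral_le => //.
- exact: integrable_EFin_measurable (integ_potential_bounded mw wB cx).
- move=> t ct; rewrite normrM ger0_norm ?logker_ge0// mulrC ler_wpM2r ?logker_ge0//.
  exact: wB.
- exact: integrableEFinZ mc (integ_logker_sub cx).
Qed.

Lemma log_potentialB w w' (B : R) x : measurable_fun circle w ->
  measurable_fun circle w' -> (forall t, circle t -> `|w t| <= B) ->
  (forall t, circle t -> `|w' t| <= B) -> circle x ->
  log_potential (fun t => w t - w' t) x = log_potential w x - log_potential w' x.
Proof.
move=> mw mw' wB w'B cx; have mc := @measurable_circle R.
rewrite /log_potential -RintegralB//; [|exact: integ_potential_bounded wB cx|exact: integ_potential_bounded w'B cx].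
by apply: eq_Rintegral => t _; rewrite mulrBr.
Qed.

End potential_bounds.

(** * Fixed points of sup-norm contractions *)

Section fixed_point.
Context {R : realType} (X : Type).
Implicit Types (f g : X -> R) (x : X).

Lemma geometric_cvg (u : nat -> R) (B : R) :
  (forall n, `|u n.+1 - u n| <= B * 2^-1 ^+ n) ->
  exists l : R, forall n, `|u n - l| <= 2 * B * 2^-1 ^+ n.
Proof.
move=> uB.
have B0 : 0 <= B by have := uB 0%N; rewrite expr0 mulr1; apply: le_trans; exact: normr_ge0.
have h2 (n : nat) : (0 : R) < 2^-1 ^+ n by rewrite exprn_gt0// invr_gt0.
have far n m : `|u (n + m)%N - u n| <= 2 * B * 2^-1 ^+ n - 2 * B * 2^-1 ^+ (n + m).
  elim: m => [|m ih]; first by rewrite addn0 !subrr normr0.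
  rewrite addnS (_ : u (n + m).+1 - u n = (u (n + m).+1 - u (n + m)%N) + (u (n + m)%N - u n)); last by ring.
  apply: (le_trans (ler_normD _ _)).
  have := uB (n + m)%N; rewrite exprS => h.
  rewrite (_ : 2 * B * (2^-1 * 2^-1 ^+ (n + m)) = B * 2^-1 ^+ (n + m)); last by field.
  lra.
have far' n m : (n <= m)%N -> `|u m - u n| <= 2 * B * 2^-1 ^+ n.
  move=> nm; rewrite -(subnKC nm); apply: (le_trans (far _ _)).
  by rewrite lerBlDr lerDl !mulr_ge0// ltW.
have h0 : 2 * B * 2^-1 ^+ n @[n --> \oo] --> (0 : R).
  rewrite -[X in _ --> X](mulr0 (2 * B)); apply: cvgM; first exact: cvg_cst.
  by apply: cvg_expr; rewrite ger0_norm ?invr_ge0// invf_lt1// ltr1n.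
have /cauchy_cvgP/cvg_ex[/= l ul] : cauchy (u @ \oo).
  apply/cauchyP => e e0.
  have : \forall n \near \oo, 2 * B * 2^-1 ^+ n < e by apply: (cvgr_lt 0 h0).
  case=> n _ hn; exists (u n); exists n => // m /= nm.
  rewrite /ball/= distrC; apply: (@le_lt_trans _ _ (2 * B * 2^-1 ^+ n)); last exact: (hn n (leqnn n)).
  exact: far'.
exists l => n; rewrite distrC.
have h : `|u m - u n| @[m --> \oo] --> `|l - u n|.
  by apply: cvg_norm; apply: cvgB => //; exact: cvg_cst.
rewrite -(cvg_lim _ h)//; apply: limr_le; first by apply/cvg_ex; eexists; exact: h.
by near=> m; apply: far'; near: m; exists n.
Unshelve. all: end_near. Qed.

(** Banach's fixed point theorem: the iterates converge geometrically and
    uniformly on D. The class P records the regularity needed by T and is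
    only required to be stable under pointwise limits. *)
Lemma sup_contraction_fixpoint (D : set X) (P : (X -> R) -> Prop)
    (T : (X -> R) -> X -> R) (f0 : X -> R) (B : R) :
  P f0 -> (forall f, P f -> P (T f)) ->
  (forall x, D x -> `|T f0 x - f0 x| <= B) ->
  (forall f g (M : R), P f -> P g -> (forall x, D x -> `|f x - g x| <= M) ->
     forall x, D x -> `|T f x - T g x| <= M * 2^-1) ->
  (forall (u : nat -> X -> R) f, (forall n, P (u n)) ->
     (forall x, D x -> u n x @[n --> \oo] --> f x) -> P f) ->
  exists2 f, P f & forall x, D x -> T f x = f x.
Proof.
move=> P0 PT TB contr closed.
pose u n := iter n T f0.
have Pu n : P (u n) by elim: n => //= n; exact: PT.
have uB n x : D x -> `|u n.+1 x - u n x| <= B * 2^-1 ^+ n.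
  elim: n x => [|n ih] x Dx; first by rewrite expr0 mulr1; exact: TB.
  by rewrite exprSr mulrA; exact: (contr _ _ _ (Pu n.+1) (Pu n) ih).
have h x : exists l : R, D x -> forall n, `|u n x - l| <= 2 * B * 2^-1 ^+ n.
  have [Dx|nDx] := pselect (D x); last by exists 0.
  by have [l hl] := geometric_cvg (fun n => uB n x Dx); exists l.
have [f hf] := choice h.
have h0 (C : R) : C * 2^-1 ^+ n @[n --> \oo] --> (0 : R).
  rewrite -[X in _ --> X](mulr0 C); apply: cvgM; first exact: cvg_cst.
  by apply: cvg_expr; rewrite ger0_norm ?invr_ge0// invf_lt1// ltr1n.
have uf x : D x -> u n x @[n --> \oo] --> f x.
  move=> Dx; apply/cvgrPdist_le => e e0; near=> n; rewrite distrC.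
  apply: (le_trans (hf x Dx n)); near: n.
  by apply: (cvgr_le 0 (h0 _)).
have Pf : P f by exact: closed uf.
exists f => // x Dx; apply/eqP; rewrite -subr_eq0 -normr_le0.
apply/ler_addgt0Pr => e e0; rewrite add0r.
have : \forall n \near \oo, 2 * (2 * B) * 2^-1 ^+ n < e by apply: (cvgr_lt 0 (h0 _)).
case=> n _ /(_ n (leqnn n)) /= hn.
have h1 : `|T f x - u n.+1 x| <= 2 * B * 2^-1 ^+ n * 2^-1.
  by apply: contr => // y Dy; rewrite distrC; exact: hf.
have h2 := hf x Dx n.+1; rewrite exprS in h2.
rewrite (_ : T f x - f x = (T f x - u n.+1 x) + (u n.+1 x - f x)); last by ring.
apply: (le_trans (ler_normD _ _)); move: h1 h2 hn.
rewrite (_ : 2 * B * (2^-1 * 2^-1 ^+ n) = 2 * B * 2^-1 ^+ n * 2^-1); last by ring.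
by rewrite (_ : 2 * (2 * B) * 2^-1 ^+ n = 2 * (2 * B * 2^-1 ^+ n)); [lra|ring].
Unshelve. all: end_near. Qed.

End fixed_point.

(** * Periodic functions with Lipschitz derivative *)

Section C11_pairs.
Context {R : realType}.
Notation lam := (@lebesgue_measure R).
Notation pi := (@pi R).
Notation integ f := (lam.-integrable circle (EFin \o f)).
Notation I f := (\int[lam]_(x in circle) f x).
Implicit Types (f g F l k w c u : R -> R) (x y t s a b r : R).

(** l is periodic of class C^{1,1} with derivative g. Differentiability is
    expressed by a second order bound with the uniform constant K, a form that
    passes to pointwise limits and to convolutions; it also yields the
    Lipschitz bound on g. *)
Definition C11_pair (K : R) l g : Prop :=
  [/\ forall x, l (x + 2 * pi) = l x /\ g (x + 2 * pi) = g x,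
      forall x, `|l x| <= K /\ `|g x| <= K,
      forall x y, `|l y - l x| <= K * `|y - x| &
      forall x y, `|l y - l x - g x * (y - x)| <= K * (y - x) ^+ 2].

Lemma expR_diff_le (K a b : R) : `|a| <= K -> `|b| <= K ->
  `|expR b - expR a| <= expR K * `|b - a|.
Proof.
move=> aK bK.
have h x y : x <= K -> x <= y -> y <= K -> `|expR y - expR x| <= expR K * `|y - x|.
  move=> xK xy yK; rewrite ger0_norm ?subr_ge0 ?ler_expR// ger0_norm ?subr_ge0//.
  have h1 := expR_ge1Dx (x - y); rewrite expRB ler_pdivlMr ?expR_gt0// in h1.
  have h2 : expR y <= expR K by rewrite ler_expR.
  have := expR_gt0 y; nra.
have aK' := le_trans (ler_norm _) aK; have bK' := le_trans (ler_norm _) bK.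
have [ab|/ltW ba] := leP a b; first exact: h.
by rewrite distrC (distrC b); exact: h.
Qed.

(** By convexity the remainder is nonnegative and at most
    (exp b - exp a) (b - a). *)
Lemma expR_taylor_le (K a b : R) : `|a| <= K -> `|b| <= K ->
  `|expR b - expR a - expR a * (b - a)| <= expR K * (b - a) ^+ 2.
Proof.
move=> aK bK.
have h1 := expR_ge1Dx (b - a); rewrite expRB ler_pdivlMr ?expR_gt0// in h1.
have h2 := expR_ge1Dx (a - b); rewrite expRB ler_pdivlMr ?expR_gt0// in h2.
rewrite ger0_norm; last by nra.
have h3 := expR_diff_le aK bK.
have h4 : (expR b - expR a) * (b - a) <= expR K * (b - a) ^+ 2.
  apply: (le_trans (ler_norm _)); rewrite normrM -[X in _ <= _ * X]real_normK ?num_real//.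
  by rewrite expr2 mulrA ler_wpM2r.
by nra.
Qed.

Lemma lipschitz_continuous (K : R) l : (forall x y, `|l y - l x| <= K * `|y - x|) ->
  continuous l.
Proof.
move=> lK x; apply/cvgrPdist_lt => e e0.
have K1 : 0 < `|K| + 1 by rewrite ltr_wpDl.
near=> y; rewrite distrC; apply: (le_lt_trans (lK x y)).
have : `|x - y| < e / (`|K| + 1).
  by near: y; apply: (@cvgr_dist_lt _ _ _ _ _ id x cvg_id); rewrite divr_gt0.
rewrite ltr_pdivlMr// distrC mulrC; apply: le_lt_trans; rewrite ler_wpM2r//.
by rewrite (le_trans (ler_norm _))// lerDl.
Unshelve. all: end_near. Qed.

(** Add the second order bounds at x and at y. *)
Lemma C11_pair_lipg K l g : C11_pair K l g ->
  forall x y, `|g y - g x| <= 2 * K * `|y - x|.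
Proof.
move=> [_ _ _ h] x y; have [->|xy] := eqVneq y x; first by rewrite !subrr normr0 mulr0.
have xy0 : 0 < `|y - x| by rewrite normr_gt0 subr_eq0.
rewrite -(ler_pM2r xy0) -[leRHS]mulrA -expr2 real_normK ?num_real// -normrM.
have e : (g y - g x) * (y - x) =
   ((l x - l y - g y * (x - y)) + (l y - l x - g x * (y - x))) by ring.
rewrite e (le_trans (ler_normD _ _))//.
by have := h x y; have := h y x; rewrite -(opprB y x) sqrrN; lra.
Qed.

Lemma C11_pair_measurable K l g (D : set R) : C11_pair K l g ->
  measurable_fun D l /\ measurable_fun D g.
Proof.
move=> h; split; apply: measurable_funTS; apply: continuous_measurable_fun.
  by case: h => _ _ h _; exact: lipschitz_continuous h.
exact: lipschitz_continuous (C11_pair_lipg h).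
Qed.

Lemma C11_pair_derive K l g x : C11_pair K l g -> is_derive x 1 l (g x).
Proof.
move=> [_ _ _ h].
have K0 : 0 <= K.
  have := h x (x + 1); rewrite (_ : x + 1 - x = 1) ?expr1n ?mulr1; last by ring.
  by apply: le_trans.
have lim : h^-1 *: (l (h *: (1 : R) + x) - l x) @[h --> 0^'] --> g x.
  apply/cvgrPdist_lt => e e0; near=> d.
  have d0 : d != 0 by near: d; exact: nbhs_dnbhs_neq.
  rewrite distrC /GRing.scale/= mulr1.
  have := h x (d + x); rewrite addrK => hd.
  rewrite (_ : d^-1 * (l (d + x) - l x) - g x = d^-1 * (l (d + x) - l x - g x * d)); last by field.
  rewrite normrM normfV ltr_pdivrMl ?normr_gt0//; apply: (le_lt_trans hd).
  rewrite -[d ^+ 2]real_normK ?num_real// expr2 mulrA mulrC ltr_pM2l ?normr_gt0//.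
  have : `|d| < e / (K + 1).
    near: d; apply: dnbhs0_lt; rewrite divr_gt0//; lra.
  rewrite ltr_pdivlMr; last lra.
  have := normr_ge0 d; nra.
by apply: DeriveDef; [apply/cvg_ex; exists (g x)|exact: cvg_lim].
Unshelve. all: end_near. Qed.

Lemma C11_pair_expR K l g : 0 <= K -> C11_pair K l g ->
  C11_pair (expR K * (K + 1) ^+ 2) (fun x => expR (l x)) (fun x => expR (l x) * g x).
Proof.
move=> K0 [p b L S]; have E0 := expR_gt0 K.
have eK x : expR (l x) <= expR K by rewrite ler_expR (le_trans (ler_norm _))//; case: (b x).
have e0 x := expR_gt0 (l x).
split.
- by move=> x; have [-> ->] := p x.
- move=> x; have [_ gK] := b x; rewrite normrM !(ger0_norm (ltW (e0 x))).
  have := eK x; have := e0 x; have := normr_ge0 (g x); split; nra.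
- move=> x y; apply: (le_trans (expR_diff_le (proj1 (b x)) (proj1 (b y)))).
  rewrite -mulrA ler_pM2l//; apply: (le_trans (L x y)).
  by rewrite ler_wpM2r//; nra.
- move=> x y; have h1 := expR_taylor_le (proj1 (b x)) (proj1 (b y)).
  rewrite (_ : expR (l y) - expR (l x) - expR (l x) * g x * (y - x) =
    (expR (l y) - expR (l x) - expR (l x) * (l y - l x)) +
    expR (l x) * (l y - l x - g x * (y - x))); last by ring.
  apply: (le_trans (ler_normD _ _)); rewrite normrM (ger0_norm (ltW (e0 x))).
  have h2 : (l y - l x) ^+ 2 <= K ^+ 2 * (y - x) ^+ 2.
    rewrite -[X in X <= _]real_normK ?num_real// -[(y - x) ^+ 2]real_normK ?num_real//.
    by rewrite -exprMn lerXn2r ?nnegrE ?mulr_ge0.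
  have h3 : expR (l x) * `|l y - l x - g x * (y - x)| <= expR K * (K * (y - x) ^+ 2).
    by apply: ler_pM => //; exact: ltW.
  have h4 : expR K * (l y - l x) ^+ 2 <= expR K * (K ^+ 2 * (y - x) ^+ 2) by rewrite ler_pM2l.
  have q0 := sqr_ge0 (y - x).
  apply: (le_trans (lerD (le_trans h1 h4) h3)).
  rewrite -mulrDr -mulrA ler_pM2l//; nra.
Qed.

Lemma C11_pair_linear K1 K2 l1 g1 l2 g2 a b :
  C11_pair K1 l1 g1 -> C11_pair K2 l2 g2 ->
  C11_pair (`|a| * K1 + `|b| * K2) (fun x => a * l1 x + b * l2 x)
    (fun x => a * g1 x + b * g2 x).
Proof.
have tri (u v p q c : R) : `|u| <= p * c -> `|v| <= q * c ->
    `|a * u + b * v| <= (`|a| * p + `|b| * q) * c.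
  move=> h1 h2; apply: (le_trans (ler_normD _ _)); rewrite !normrM mulrDl -!mulrA.
  by apply: lerD; apply: ler_wpM2l.
move=> [p1 b1 L1 S1] [p2 b2 L2 S2]; split.
- by move=> x; have [-> ->] := p1 x; have [-> ->] := p2 x.
- move=> x; have [u1 u2] := b1 x; have [v1 v2] := b2 x.
  by split; rewrite -[X in _ <= X]mulr1; apply: tri; rewrite mulr1.
- move=> x y; rewrite (_ : _ - _ = a * (l1 y - l1 x) + b * (l2 y - l2 x)); last by ring.
  exact: tri.
- move=> x y; rewrite (_ : _ - _ = a * (l1 y - l1 x - g1 x * (y - x)) +
    b * (l2 y - l2 x - g2 x * (y - x))); last by ring.
  exact: tri.
Qed.

Lemma C11_pair_le K K' l g : K <= K' -> C11_pair K l g -> C11_pair K' l g.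
Proof.
move=> KK [p b L S]; split => //.
- by move=> x; have [h1 h2] := b x; split; exact: le_trans KK.
- by move=> x y; apply: (le_trans (L x y)); rewrite ler_wpM2r.
- by move=> x y; apply: (le_trans (S x y)); rewrite ler_wpM2r ?sqr_ge0.
Qed.

(** The logarithmic potential as a convolution with the singularity at s = 0,
    so that x enters through f only and bounds on f carry over. *)
Definition logconv f x : R := I (fun s => logker s * f (x - s)).

Lemma logker_average_bound F (B : R) : measurable_fun circle F ->
  (forall s, circle s -> `|F s| <= B) ->
  integ (fun s => logker s * F s) /\ `|I (fun s => logker s * F s)| <= B * logker_mass.
Proof.
move=> mF FB; have mc := @measurable_circle R.
have h := integrableM_bounded mc (@integrable_logker R) mF FB; split => //.
rewrite /logker_mass -RintegralZl//; last exact: integrable_logker.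
apply: normr_Rintegral_le => //.
- exact: integrable_EFin_measurable h.
- by move=> s cs; rewrite normrM ger0_norm ?logker_ge0// mulrC ler_wpM2r ?logker_ge0// FB.
- apply: integrableEFinZ => //; exact: integrable_logker.
Qed.

Lemma measurable_shift f x (D : set R) : measurable_fun setT f ->
  measurable_fun D (fun s => f (x - s)).
Proof.
move=> mf; apply: measurable_funTS; apply: measurableT_comp mf _.
by apply: measurable_funB => //; exact: measurable_id.
Qed.

Lemma logconv_log_potential f x : circle x -> measurable_fun setT f ->
  (forall t, f (t + 2 * pi) = f t) -> logconv f x = log_potential f x.
Proof.
move=> cx mf pf; rewrite /logconv /log_potential.
rewrite -(@Rintegral_circle_reflection R x (fun s => logker s * f (x - s)))//.
- by apply: eq_Rintegral => s _; rewrite subKr.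
- by apply: measurable_funM; [exact: measurable_logker|exact: measurable_shift].
- move=> t; rewrite logkerD2pi -(pf (x - (t + 2 * pi))).
  by congr (_ * f _); ring.
Qed.

Lemma logconv_taylor f (h : R -> R) x y (B d : R) :
  measurable_fun setT f -> measurable_fun setT h ->
  (exists C : R, forall x, `|f x| <= C) -> (exists C : R, forall x, `|h x| <= C) ->
  (forall s, `|f (y - s) - f (x - s) - h (x - s) * d| <= B) ->
  `|logconv f y - logconv f x - logconv h x * d| <= B * logker_mass.
Proof.
move=> mf mh [C fC] [C' hC] B0; have mc := @measurable_circle R.
have [i1 _] := logker_average_bound (measurable_shift y mf) (fun s _ => fC (y - s)).
have [i2 _] := logker_average_bound (measurable_shift x mf) (fun s _ => fC (x - s)).
have [i3 _] := logker_average_bound (measurable_shift x mh) (fun s _ => hC (x - s)).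
have mF : measurable_fun circle (fun s => f (y - s) - f (x - s) - h (x - s) * d).
  apply: measurable_funB; first by apply: measurable_funB; exact: measurable_shift.
  by apply: measurable_funM => //; exact: measurable_shift.
have [_ h4] := logker_average_bound mF (fun s _ => B0 s).
rewrite /logconv -RintegralZr// -!RintegralB//.
- by apply: le_trans h4; rewrite le_eqVlt; apply/orP; left; apply/eqP; congr `|_|;
    apply: eq_Rintegral => s _; ring.
- exact: integrableEFinB.
- by apply: (eq_integrable_EFin mc (integrableEFinZ d mc i3)) => s _; ring.
Qed.

(** Averaging against the kernel multiplies each bound by its mass. *)
Lemma C11_pair_logconv K l g : C11_pair K l g ->
  C11_pair (logker_mass * K) (logconv l) (logconv g).
Proof.
move=> lg; have [ml mg] := C11_pair_measurable setT lg.
have [p b L S] := lg; have bl := fun x => (b x).1; have bg := fun x => (b x).2.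
have B1 : exists C : R, forall x, `|l x| <= C by exists K.
have B2 : exists C : R, forall x, `|g x| <= C by exists K.
split.
- move=> x; split; apply: eq_Rintegral => s _; rewrite addrAC.
    by rewrite (p _).1.
  by rewrite (p _).2.
- by move=> x; rewrite mulrC; split;
    [have [] := logker_average_bound (measurable_shift x ml) (fun s _ => bl (x - s))
    |have [] := logker_average_bound (measurable_shift x mg) (fun s _ => bg (x - s))].
- move=> x y; have := @logconv_taylor l g x y (K * `|y - x|) 0 ml mg B1 B2.
  rewrite !mulr0 !subr0 (mulrC logker_mass) mulrAC; apply => s.
  by rewrite mulr0 subr0 (le_trans (L _ _))// opprD addrACA opprK addNr addr0.
- move=> x y; have := @logconv_taylor l g x y (K * (y - x) ^+ 2) (y - x) ml mg B1 B2.
  rewrite (mulrC logker_mass) mulrAC; apply => s.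
  have := S (x - s) (y - s).
  by rewrite (_ : y - s - (x - s) = y - x)//; ring.
Qed.

Lemma logconv_bound f x (B : R) : measurable_fun setT f -> (forall x, `|f x| <= B) ->
  `|logconv f x| <= B * logker_mass.
Proof.
move=> mf fB.
by have [] := logker_average_bound (measurable_shift x mf) (fun s _ => fB (x - s)).
Qed.

Lemma logconv_diff f f' x (B C : R) : measurable_fun setT f -> measurable_fun setT f' ->
  (forall x, `|f x| <= C) -> (forall x, `|f' x| <= C) ->
  (forall x, `|f x - f' x| <= B) -> `|logconv f x - logconv f' x| <= B * logker_mass.
Proof.
move=> mf mf' fC f'C ff; have mc := @measurable_circle R.
have [i1 _] := logker_average_bound (measurable_shift x mf) (fun s _ => fC (x - s)).
have [i2 _] := logker_average_bound (measurable_shift x mf') (fun s _ => f'C (x - s)).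
have mF : measurable_fun circle (fun s => f (x - s) - f' (x - s)).
  by apply: measurable_funB; exact: measurable_shift.
have [_ h4] := logker_average_bound mF (fun s _ => ff (x - s)).
rewrite /logconv -RintegralB//; apply: le_trans h4.
rewrite le_eqVlt; apply/orP; left; apply/eqP; congr `|_|.
by apply: eq_Rintegral => s _; rewrite mulrBr.
Qed.

End C11_pairs.

(** * Uniform bounds on the confining potential *)

Section equilibrium_density.
Context {R : realType}.
Notation lam := (@lebesgue_measure R).
Notation pi := (@pi R).
Notation integ f := (lam.-integrable circle (EFin \o f)).
Notation I f := (\int[lam]_(x in circle) f x).
Implicit Types (f g F l k w c u : R -> R) (x y t s a b r : R).

Lemma mean_value_between f g x y : (forall t, is_derive t 1 f (g t)) ->
  exists2 c : R, f y - f x = g c * (y - x) & `|c - x| <= `|y - x|.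
Proof.
move=> d.
have cf : continuous f.
  by move=> t; apply: differentiable_continuous; apply/derivable1_diffP; have [] := d t.
have [xy|/ltW yx] := leP x y.
  have [c /[!in_itv]/= /andP[xc cy] h] := MVT_segment xy (fun t _ => d t) (continuous_subspaceT cf).
  by exists c => //; rewrite !ger0_norm ?subr_ge0//; lra.
have [c /[!in_itv]/= /andP[xc cy] h] := MVT_segment yx (fun t _ => d t) (continuous_subspaceT cf).
by exists c; [lra|rewrite distrC (distrC y) !ger0_norm ?subr_ge0//; lra].
Qed.

Lemma norm_sin_le x : `|sin x| <= `|x|.
Proof.
have [c h _] := @mean_value_between sin cos 0 x (fun t => is_derive_sin t).
by move: h; rewrite sin0 !subr0 => ->; rewrite normrM ler_piMl// cos_max.
Qed.

Lemma circle_dist_le x y : circle_dist x y <= `|x - y|.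
Proof.
rewrite circle_distE; have := norm_sin_le ((x - y) / 2).
by rewrite normrM (@ger0_norm _ 2^-1) ?invr_ge0// => h; lra.
Qed.

Lemma periodic_bound f (B : R) : 0 <= B -> periodic f (2 * pi) ->
  (forall x, `|x| <= 2 * pi -> `|f x| <= B) -> forall x, `|f x| <= B.
Proof.
move=> B0 pf fB x; have p0 : 0 < 2 * pi by rewrite mulr_gt0 ?pi_gt0.
pose n := Num.truncn (`|x| / (2 * pi)).
have /andP[] : n%:R <= `|x| / (2 * pi) < n.+1%:R.
  by apply: truncn_itv; rewrite divr_ge0// ltW.
rewrite ler_pdivlMr// ltr_pdivrMr// -natr1 mulrDl mul1r => h1 h2.
have [x0|x0] := leP 0 x.
  rewrite -(subrK (2 * pi *+ n) x) periodicn//; apply: fB.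
  move: h1 h2; rewrite -mulr_natl ger0_norm// => h1 h2.
  by rewrite ger0_norm; lra.
rewrite -(periodicn pf n x); apply: fB.
move: h1 h2; rewrite -mulr_natl ltr0_norm// => h1 h2.
by rewrite ler0_norm; lra.
Qed.

(** The chordal distance is at most 2, which bounds V' and with periodicity V,
    and at most |x - y|, which gives the second order bound through the mean
    value theorem. *)
Lemma C11_C11_pair V : C11 V -> exists2 K : R, 0 <= K & C11_pair K V (derive1 V).
Proof.
move=> [pV dV [C0 hC0]]; pose C := `|C0|.
have hC x y : `|derive1 V x - derive1 V y| <= C * circle_dist x y.
  apply: (le_trans (hC0 x y)); rewrite ler_wpM2r ?ler_norm//.
  by rewrite circle_distE mulr_ge0.
have C_ge0 : 0 <= C by exact: normr_ge0.
have d t : is_derive t 1 V (derive1 V t) by rewrite derive1E; exact/derivableP.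
have pg x : derive1 V (x + 2 * pi) = derive1 V x.
  apply/eqP; rewrite -subr_eq0 -normr_le0; apply: (le_trans (hC _ _)).
  rewrite circle_distE (_ : (x + 2 * pi - x) / 2 = pi); last by field.
  by rewrite sinpi normr0 !mulr0.
pose M := `|derive1 V 0| + 2 * C.
have gM x : `|derive1 V x| <= M.
  rewrite -(subrK (derive1 V 0) (derive1 V x)) (le_trans (ler_normD _ _))// addrC lerD2l.
  apply: (le_trans (hC _ _)); rewrite mulrC ler_wpM2r// circle_distE ler_piMr// sin_max //.
have M0 : 0 <= M by exact: le_trans (gM 0).
have VM x : `|V x| <= `|V 0| + M * (2 * pi).
  apply: periodic_bound => //; first by rewrite addr_ge0// !mulr_ge0// pi_ge0.
  move=> {}x xp; rewrite -(subrK (V 0) (V x)) (le_trans (ler_normD _ _))// addrC lerD2l.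
  have [c -> _] := mean_value_between 0 x d.
  by rewrite normrM subr0 ler_pM.
exists (`|V 0| + M * (2 * pi) + M + C); first by rewrite !addr_ge0// !mulr_ge0// pi_ge0.
have h0 : 0 <= `|V 0| + M * (2 * pi) by rewrite addr_ge0// !mulr_ge0// pi_ge0.
split.
- by move=> x; rewrite pV pg.
- by move=> x; have := VM x; have := gM x; split; lra.
- move=> x y; have [c -> _] := mean_value_between x y d.
  rewrite normrM ler_wpM2r//; have := gM c; lra.
- move=> x y; have [c -> cx] := mean_value_between x y d.
  rewrite -mulrBl normrM -[(y - x) ^+ 2]real_normK ?num_real// expr2 mulrA ler_wpM2r//.
  apply: (le_trans (hC _ _)); apply: ler_pM => //; first by rewrite circle_distE mulr_ge0.
    by lra.
  exact: le_trans (circle_dist_le _ _) cx.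
Qed.

End equilibrium_density.

(** * The Euler-Lagrange equation as a fixed point *)

Section fixed_point_density.
Context {R : realType}.
Notation lam := (@lebesgue_measure R).
Notation pi := (@pi R).
Notation integ f := (lam.-integrable circle (EFin \o f)).
Notation I f := (\int[lam]_(x in circle) f x).
Notation C0 := (@logker_mass R).
Implicit Types (f g F l k w c u : R -> R) (x y t s a b r : R).

Lemma C11_pair_lim (u v : nat -> R -> R) (K : R) l g :
  (forall n, C11_pair K (u n) (v n)) ->
  (forall x, u n x @[n --> \oo] --> l x) -> (forall x, v n x @[n --> \oo] --> g x) ->
  C11_pair K l g.
Proof.
move=> h ul vg.
have lim_le (a : nat -> R) (L B : R) : a n @[n --> \oo] --> L -> (forall n, `|a n| <= B) -> `|L| <= B.
  move=> aL aB; have h1 : `|a n| @[n --> \oo] --> `|L| by exact: cvg_norm.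
  have <- := cvg_lim (@Rhausdorff R) h1; apply: limr_le; first by apply/cvg_ex; eexists; exact: h1.
  exact: nearW.
have lim_eq (a b : nat -> R) (L L' : R) : a n @[n --> \oo] --> L ->
    b n @[n --> \oo] --> L' -> (forall n, a n = b n) -> L = L'.
  move=> aL bL ab; rewrite -(cvg_lim (@Rhausdorff R) aL) -(cvg_lim (@Rhausdorff R) bL).
  by congr (lim (_ @ \oo)); apply/funext.
split.
- move=> x; split; [apply: (lim_eq _ _ _ _ (ul _) (ul _))|apply: (lim_eq _ _ _ _ (vg _) (vg _))].
    by move=> n; have [p _ _ _] := h n; have [] := p x.
  by move=> n; have [p _ _ _] := h n; have [] := p x.
- move=> x; split; [apply: (lim_le _ _ _ (ul _))|apply: (lim_le _ _ _ (vg _))].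
    by move=> n; have [_ p _ _] := h n; have [] := p x.
  by move=> n; have [_ p _ _] := h n; have [] := p x.
- move=> x y; apply: (lim_le (fun n => u n y - u n x)); first by apply: cvgB; exact: ul.
  by move=> n; have [_ _ p _] := h n.
- move=> x y; apply: (lim_le (fun n => u n y - u n x - v n x * (y - x))).
    by apply: cvgB; [apply: cvgB; exact: ul|apply: cvgM; [exact: vg|exact: cvg_cst]].
  by move=> n; have [_ _ _ p] := h n.
Qed.

(** 9 = 1 + 8: the first term comes from the variation of the numerator, the
    second from that of the denominator, where 8 bounds the length 2 pi. *)
Lemma quotient_diff_le (A E Z1 Z2 a1 a2 d : R) : 1 <= E ->
  E^-1 <= Z1 -> E^-1 <= Z2 -> `|Z1 - Z2| <= 8 * E * d ->
  `|a1 - a2| <= A * d -> `|a2| <= A ->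
  `|a1 / Z1 - a2 / Z2| <= 9 * A * E ^+ 3 * d.
Proof.
move=> E1 h1 h2 hZ ha aA.
have E0 : 0 < E by lra.
have z1 : 0 < Z1 by apply: lt_le_trans h1; rewrite invr_gt0.
have z2 : 0 < Z2 by apply: lt_le_trans h2; rewrite invr_gt0.
have A0 : 0 <= A by exact: le_trans aA.
have d0 : 0 <= d by have := normr_ge0 (Z1 - Z2); nra.
have i1 : Z1^-1 <= E by rewrite invf_ple ?posrE.
have i2 : Z2^-1 <= E by rewrite invf_ple ?posrE.
have e : a1 / Z1 - a2 / Z2 = (a1 - a2) * Z1^-1 - a2 * ((Z1 - Z2) * (Z1^-1 * Z2^-1)).
  by field; rewrite !gt_eqF.
rewrite e (le_trans (ler_normB _ _))//.
have g1 : `|(a1 - a2) * Z1^-1| <= A * d * E.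
  by rewrite normrM ler_pM// ger0_norm// invr_ge0 ltW.
have g2 : `|a2 * ((Z1 - Z2) * (Z1^-1 * Z2^-1))| <= A * (8 * E * d * (E * E)).
  rewrite !normrM ler_pM// ler_pM//.
  by rewrite ler_pM// ger0_norm// invr_ge0 ltW.
apply: (le_trans (lerD g1 g2)).
have Ad : 0 <= A * d by exact: mulr_ge0.
have E3 : E <= E ^+ 3 by rewrite -[leLHS]expr1; apply: ler_weXn2l.
have : A * d * E <= A * d * E ^+ 3 by rewrite ler_wpM2l.
rewrite (_ : A * (8 * E * d * (E * E)) = 8 * (A * d * E ^+ 3)); last by ring.
rewrite (_ : 9 * A * E ^+ 3 * d = 9 * (A * d * E ^+ 3)); last by ring.
lra.
Qed.

Lemma pi2_bounds : 1 <= 2 * pi <= 8.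
Proof.
by have h1 := @pi_ge2 R; have := @pihalf_lt2 R; rewrite ltr_pdivrMr// => h2; apply/andP; split; lra.
Qed.

Lemma I_between f (a b : R) : measurable_fun circle f -> 0 <= a ->
  (forall x, circle x -> a <= f x <= b) -> [/\ integ f, a * (2 * pi) <= I f & I f <= b * (2 * pi)].
Proof.
move=> mf a0 fab; have mc := @measurable_circle R.
have fi : integ f.
  apply: (circle_bounded_integrable mf) => x /fab/andP[h1 h2]; rewrite ger0_norm; first exact: h2.
  exact: le_trans h1.
have ci r : integ (fun _ : R => r) by exact: integ_cst.
split => //.
- by rewrite -(I_cst a); apply: le_Rintegral => // x /fab/andP[].
- by rewrite -(I_cst b); apply: le_Rintegral => // x /fab/andP[].
Qed.

Variables (V V' : R -> R) (KV : R).
Hypotheses (KV0 : 0 <= KV) (CV : C11_pair KV V V').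

Let K := KV + 1.
Let E := expR K.

Definition partition l : R := I (fun x => expR (l x)).

Lemma partition_bounds l g : C11_pair K l g ->
  E^-1 <= partition l /\ partition l <= 8 * E.
Proof.
move=> lg; have [ml _] := C11_pair_measurable (@circle R) lg; case: lg => _ lK _ _.
have h x : E^-1 <= expR (l x) <= E.
  rewrite -expRN !ler_expR; have := (lK x).1; rewrite ler_norml => /andP[-> ->] //.
have E0 : 0 < E := expR_gt0 _.
have [_ h1 h2] := I_between (measurableT_comp (@measurable_expR R) ml)
  (ltW (etrans (invr_gt0 E) E0)) (fun x _ => h x).
have /andP[p1 p2] := pi2_bounds; split.
  apply: le_trans h1; rewrite ler_peMr// invr_ge0 ltW//.
by apply: (le_trans h2); rewrite mulrC ler_wpM2r// ltW.
Qed.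

Lemma partition_diff l g l' g' (d : R) : C11_pair K l g -> C11_pair K l' g' ->
  (forall x, `|l x - l' x| <= d) -> `|partition l - partition l'| <= 8 * E * d.
Proof.
move=> lg lg' ll; have mc := @measurable_circle R.
have [ml _] := C11_pair_measurable (@circle R) lg; case: lg => _ lK _ _.
have [ml' _] := C11_pair_measurable (@circle R) lg'; case: lg' => _ lK' _ _.
have E0 : 0 < E := expR_gt0 _.
have i f : measurable_fun circle f -> (forall x, `|f x| <= K) -> integ (fun x => expR (f x)).
  move=> mf fK; apply: (@circle_bounded_integrable _ _ E).
    by apply: measurableT_comp mf; exact: measurable_expR.
  move=> x _; rewrite ger0_norm ?expR_ge0// ler_expR (le_trans (ler_norm _))//.
have il := i l ml (fun x => (lK x).1); have il' := i l' ml' (fun x => (lK' x).1).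
have d0 : 0 <= d by exact: le_trans (ll 0).
rewrite /partition -RintegralB//; apply: (@le_trans _ _ (I (fun _ => E * d))).
  apply: normr_Rintegral_le => //.
  - exact: (integrable_EFin_measurable (integrableEFinB mc il il')).
  - move=> x _; apply: (le_trans (expR_diff_le (lK' x).1 (lK x).1)).
    by rewrite ler_wpM2l// ltW.
  - exact: integ_cst.
rewrite I_cst; have /andP[p1 p2] := pi2_bounds.
have : 0 <= E * d by rewrite mulr_ge0// ltW.
nra.
Qed.

(** The Euler-Lagrange equation log rho + V + 2 beta U_rho = const for
    rho = exp l / Z reads l = - V - 2 beta U_(exp l) / Z up to a constant. The
    coordinate true carries the derivative of l, so that the C^{1,1} bounds
    are iterated together with l. *)
Definition fp_map (bt : R) (f : bool * R -> R) (z : bool * R) : R :=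
  let l x := f (false, x) in
  if z.1 then (-1) * V' z.2 + (- (2 * bt / partition l)) * logconv (fun x => expR (l x) * f (true, x)) z.2
  else (-1) * V z.2 + (- (2 * bt / partition l)) * logconv (fun x => expR (l x)) z.2.

Definition fp_class (f : bool * R -> R) :=
  C11_pair K (fun x => f (false, x)) (fun x => f (true, x)).

Let K1 : 1 <= K. Proof. by rewrite /K lerDr. Qed.

Let EK : K + 1 <= E. Proof. by rewrite addrC; exact: expR_ge1Dx. Qed.

Let E1 : 1 <= E. Proof. by have := EK; have := K1; lra. Qed.

Let C00 : 0 <= C0 := logker_mass_ge0.

Lemma exp_pair_diff (l g l' g' d : R) : `|l| <= K -> `|l'| <= K ->
  `|g| <= K -> `|g'| <= K -> `|l - l'| <= d -> `|g - g'| <= d ->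
  [/\ `|expR l| <= E * (K + 1), `|expR l * g| <= E * (K + 1),
      `|expR l - expR l'| <= E * (K + 1) * d &
      `|expR l * g - expR l' * g'| <= E * (K + 1) * d].
Proof.
move=> lK lK' gK gK' ll gg.
have e0 := expR_gt0 l; have e0' := expR_gt0 l'.
have eE : expR l <= E by rewrite ler_expR (le_trans (ler_norm _)).
have eE' : expR l' <= E by rewrite ler_expR (le_trans (ler_norm _)).
have d0 : 0 <= d by exact: le_trans gg.
have h3 : `|expR l - expR l'| <= E * d.
  by apply: (le_trans (expR_diff_le lK' lK)); rewrite ler_wpM2l// (le_trans _ E1).
have K1' := K1; have E1' := E1; have Ed : 0 <= E * d by rewrite mulr_ge0// (le_trans _ E1).
have EdK : 0 <= E * d * K by rewrite mulr_ge0// (le_trans _ K1).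
split.
- by rewrite ger0_norm ?expR_ge0//; nra.
- rewrite normrM (ger0_norm (ltW e0)); have := normr_ge0 g; nra.
- by apply: (le_trans h3); nra.
- rewrite (_ : _ - _ = (expR l - expR l') * g + expR l' * (g - g')); last by ring.
  rewrite (le_trans (ler_normD _ _))// !normrM (ger0_norm (ltW e0')).
  have : `|expR l - expR l'| * `|g| <= E * d * K by rewrite ler_pM.
  have : expR l' * `|g - g'| <= E * d by rewrite ler_pM// ltW.
  lra.
Qed.

(** Below this threshold fp_map preserves fp_class and contracts by 1/2. *)
Definition small_beta : R := (36 * (C0 + 1) * E ^+ 4 * (K + 1) ^+ 2)^-1.

Lemma small_beta_gt0 : 0 < small_beta.
Proof.
have K1' := K1; have E1' := E1; have C00' := C00.
rewrite invr_gt0 !mulr_gt0// ?exprn_gt0//; lra.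
Qed.

Section fixed_beta.
Variable bt : R.
Hypotheses (bt0 : 0 < bt) (bts : bt <= small_beta).

Lemma bt_smallE : bt * (36 * (C0 + 1) * E ^+ 4 * (K + 1) ^+ 2) <= 1.
Proof.
move: bts; rewrite /small_beta -ler_pdivlMr ?mul1r//.
have K1' := K1; have E1' := E1; have C00' := C00.
rewrite !mulr_gt0// ?exprn_gt0//; lra.
Qed.

Lemma fp_class_map (f : bool * R -> R) : fp_class f -> fp_class (fp_map bt f).
Proof.
move=> Pf; rewrite /fp_class/=.
have K0 : 0 <= K by apply: le_trans K1.
have h := C11_pair_logconv (C11_pair_expR K0 Pf).
apply: C11_pair_le (C11_pair_linear _ _ CV h).
rewrite normrN1 mul1r /K lerD2l normrN.
have [Z1 _] := partition_bounds Pf.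
set Z := partition _ in Z1 *.
have E1' := E1.
have z1 : 0 < Z by apply: lt_le_trans Z1; rewrite invr_gt0; lra.
have i1 : Z^-1 <= E by rewrite invf_ple ?posrE//; lra.
rewrite ger0_norm; last by rewrite divr_ge0 ?mulr_ge0// ltW.
rewrite -/K -/E.
have C00' := C00.
apply: le_trans bt_smallE.
set Q := (K + 1) ^+ 2; have Q0 : 0 <= Q by exact: sqr_ge0.
have E4 : E ^+ 2 <= E ^+ 4 by apply: ler_weXn2l.
have : 2 * bt / Z * (C0 * (E * Q)) <= 2 * bt * E * (C0 * (E * Q)).
  apply: ler_wpM2r; first by rewrite !mulr_ge0//; lra.
  by apply: ler_wpM2l => //; rewrite mulr_ge0// ltW.
have h0 : 0 <= bt * Q by rewrite mulr_ge0// ltW.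
rewrite (_ : 2 * bt * E * (C0 * (E * Q)) = 2 * (bt * Q) * (C0 * E ^+ 2)); last by ring.
rewrite (_ : bt * (36 * (C0 + 1) * E ^+ 4 * Q) = 36 * (bt * Q) * ((C0 + 1) * E ^+ 4)); last by ring.
move=> h1; apply: (le_trans h1); apply: ler_pM => //; first by rewrite mulr_ge0.
- by rewrite mulr_ge0 ?sqr_ge0.
- by lra.
- by apply: ler_pM => //; [exact: sqr_ge0|lra].
Qed.

Lemma fp_contraction (f g : bool * R -> R) (M : R) : fp_class f -> fp_class g ->
  (forall z, `|f z - g z| <= M) -> forall z, `|fp_map bt f z - fp_map bt g z| <= M * 2^-1.
Proof.
move=> Pf Pg fg z.
have K0 : 0 <= K by apply: le_trans K1.
have [Z1 _] := partition_bounds Pf; have [Z2 _] := partition_bounds Pg.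
have hZ := partition_diff Pf Pg (fun x => fg (false, x)).
have [mf1 mf2] := C11_pair_measurable setT Pf.
have [mg1 mg2] := C11_pair_measurable setT Pg.
have M0 : 0 <= M by exact: le_trans (fg z).
have ex x := exp_pair_diff (let: And4 _ b _ _ := Pf in (b x).1) (let: And4 _ b _ _ := Pg in (b x).1)
  (let: And4 _ b _ _ := Pf in (b x).2) (let: And4 _ b _ _ := Pg in (b x).2) (fg (false, x)) (fg (true, x)).
have ex' x := exp_pair_diff (let: And4 _ b _ _ := Pg in (b x).1) (let: And4 _ b _ _ := Pg in (b x).1)
  (let: And4 _ b _ _ := Pg in (b x).2) (let: And4 _ b _ _ := Pg in (b x).2)
  (d := 0) ltac:(by rewrite subrr normr0) ltac:(by rewrite subrr normr0).
have mexp (h : R -> R) : measurable_fun setT h -> measurable_fun setT (fun x => expR (h x)).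
  by move=> mh; apply: measurableT_comp mh; exact: measurable_expR.
have main (u v : R -> R) (W a : R) : measurable_fun setT u -> measurable_fun setT v ->
    (forall x, `|u x| <= E * (K + 1)) -> (forall x, `|v x| <= E * (K + 1)) ->
    (forall x, `|u x - v x| <= E * (K + 1) * M) ->
    `|(-1) * W + (- (2 * bt / partition (fun x => f (false, x)))) * logconv u a -
     ((-1) * W + (- (2 * bt / partition (fun x => g (false, x)))) * logconv v a)| <= M * 2^-1.
  move=> mu mv uB vB uv.
  have d1 := logconv_diff a mu mv uB vB uv.
  have d2 := logconv_bound a mv vB.
  have d1' : `|logconv u a - logconv v a| <= E * (K + 1) * C0 * M by rewrite mulrAC.
  have := quotient_diff_le E1 Z1 Z2 hZ d1' d2.
  set q := _ - _; rewrite (_ : _ - _ = - (2 * bt * q)); last by rewrite /q; ring.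
  move=> qB; rewrite normrN normrM (ger0_norm (_ : 0 <= 2 * bt)); last by rewrite mulr_ge0// ltW.
  apply: (@le_trans _ _ (2 * bt * (9 * (E * (K + 1) * C0) * E ^+ 3 * M))).
    by rewrite ler_wpM2l// mulr_ge0// ltW.
  have K1' := K1; have C00' := C00.
  have s : bt * (36 * C0 * E ^+ 4 * (K + 1)) <= 1.
    apply: le_trans bt_smallE; rewrite ler_wpM2l//; first exact: ltW.
    have e4 : 0 <= E ^+ 4 by rewrite exprn_ge0// (le_trans _ E1).
    have : 0 <= C0 * E ^+ 4 by rewrite mulr_ge0.
    nra.
  rewrite (_ : _ * _ = (bt * (36 * C0 * E ^+ 4 * (K + 1))) * (M * 2^-1)); last by field.
  by rewrite ler_piMl// mulr_ge0.
case: z => -[] a; rewrite /fp_map/=; apply: main.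
- by apply: measurable_funM => //; exact: mexp.
- by apply: measurable_funM => //; exact: mexp.
- by move=> x; have [] := ex x.
- by move=> x; have [] := ex' x.
- by move=> x; have [] := ex x.
- exact: mexp.
- exact: mexp.
- by move=> x; have [] := ex x.
- by move=> x; have [] := ex' x.
- by move=> x; have [] := ex x.
Qed.

Lemma fp_exists : exists2 f : bool * R -> R, fp_class f & forall z, fp_map bt f z = f z.
Proof.
have K0 : 0 <= K by apply: le_trans K1.
have P0 : fp_class (fun _ => 0).
  split=> [x|x|x y|x y] /=; first by split.
  - by rewrite normr0.
  - by rewrite subrr normr0 mulr_ge0.
  - by rewrite mul0r !subrr normr0 mulr_ge0 ?sqr_ge0.
have P1 := fp_class_map P0.
have bnd (f : bool * R -> R) z : fp_class f -> `|f z| <= K.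
  by case: z => -[] a [_ b _ _]; have [] := b a.
have [f Pf ff] := @sup_contraction_fixpoint R _ setT fp_class (fp_map bt) (fun _ => 0) K
  P0 fp_class_map (fun z _ => ltac:(by rewrite subr0; exact: bnd P1))
  (fun (f g : bool * R -> R) M Pf Pg fg z _ => fp_contraction Pf Pg (fun z => fg z Logic.I) z)
  (fun (u : nat -> bool * R -> R) (f : bool * R -> R) Pu uf => C11_pair_lim (u := fun n x => u n (false, x)) (v := fun n x => u n (true, x)) Pu (fun x => uf _ Logic.I) (fun x => uf _ Logic.I)).
by exists f => // z; exact: ff.
Qed.

End fixed_beta.
End fixed_point_density.

Section small_density.
Context {R : realType}.
Notation lam := (@lebesgue_measure R).
Notation pi := (@pi R).
Notation integ f := (lam.-integrable circle (EFin \o f)).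
Notation I f := (\int[lam]_(x in circle) f x).
Notation C0 := (@logker_mass R).
Implicit Types (f g F l k w c u : R -> R) (x y t s a b r : R).

(** For the fixed point l, the function l + V is - 2 beta times a bounded
    potential; hence exp l and its normalization differ from those of the
    Gibbs density by O(beta). *)
Lemma small_density V : C11 V ->
  (\int[lam]_(x in circle) (expR (- V x) / (2 * pi))%:E = 1)%E ->
  exists2 M : R, 1 <= M & exists2 b0 : R, 0 < b0 & forall bt, 0 < bt <= b0 ->
  exists rho g (e : R), [/\ C11_pair M rho (fun x => rho x * g x) /\ I rho = 1,
    forall x, is_derive x 1 (fun x => ln (rho x)) (g x),
    continuous g /\ (forall x, `|g x| <= M),
    forall x, M^-1 <= rho x &
    (forall x, circle x -> ln (rho x) = - V x - 2 * bt * log_potential rho x + e) /\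
    forall x, `|rho x - expR (- V x) / (2 * pi)| <= M * bt].
Proof.
move=> /C11_C11_pair[KV KV0 CV] hV1; have mc := @measurable_circle R.
pose K := KV + 1; pose E := expR K.
have K1 : 1 <= K by rewrite /K lerDr.
have EK : K + 1 <= E by rewrite addrC; exact: expR_ge1Dx.
have E1 : 1 <= E by lra.
have E0 : 0 < E by lra.
have C00 := @logker_mass_ge0 R.
have K0 : 0 <= K by lra.
have [mV _] := C11_pair_measurable (@circle R) CV.
have CNV : C11_pair K (fun x => - V x) (fun x => - derive1 V x).
  have := C11_pair_linear (-1) 0 CV CV.
  rewrite normrN1 mul1r normr0 mul0r addr0 => h.
  have -> : (fun x => - V x) = (fun x => -1 * V x + 0 * V x) by apply/funext => x; ring.
  have -> : (fun x => - derive1 V x) = (fun x => -1 * derive1 V x + 0 * derive1 V x).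
    by apply/funext => x; ring.
  by apply: C11_pair_le h; rewrite /K; lra.
have ZV : partition (fun x => - V x) = 2 * pi.
  have iV : integ (fun x => expR (- V x)).
    apply: (@circle_bounded_integrable _ _ E).
      apply: measurableT_comp; first exact: measurable_expR.
      by apply: measurableT_comp mV.
    move=> x _; rewrite ger0_norm ?expR_ge0// ler_expR.
    by case: CNV => _ h _ _; rewrite (le_trans (ler_norm _))//; case: (h x).
  have : I (fun x => expR (- V x) / (2 * pi)) = 1 by rewrite /Rintegral hV1.
  rewrite RintegralZr// -/(partition _) => h.
  by rewrite -[LHS](divfK (lt0r_neq0 (_ : 0 < 2 * pi))) ?h ?mul1r// mulr_gt0// pi_gt0.
pose M := 18 * (C0 + 1) * E ^+ 6.
have ME : E ^+ 6 <= M by rewrite /M ler_peMl ?exprn_ge0//; lra.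
have powE (n : nat) : (0 < n <= 6)%N -> E ^+ n <= M.
  by move=> /andP[_ n6]; apply: le_trans ME; apply: ler_weXn2l.
exists M; first by rewrite (le_trans E1)// -[E]expr1 powE.
exists (small_beta KV); first exact: small_beta_gt0.
move=> bt /andP[bt0 bts].
have [f Pf ff] := fp_exists KV0 CV bt0 bts.
pose l x := f (false, x); pose g x := f (true, x); pose Z := partition l.
pose rho x := expR (l x) / Z.
have Plg : C11_pair K l g := Pf.
have [Z1 Z2] := partition_bounds Plg.
rewrite -/Z -/K -/E in Z1 Z2.
have Z0 : 0 < Z by apply: lt_le_trans Z1; rewrite invr_gt0.
have iZ : Z^-1 <= E by rewrite invf_ple ?posrE.
have iZ0 : 0 <= Z^-1 by rewrite invr_ge0 ltW.
have h := C11_pair_expR K0 Plg.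
have lb x : `|l x| <= K by case: Plg => _ p _ _; case: (p x).
have gb x : `|g x| <= K by case: Plg => _ p _ _; case: (p x).
have [mexp _] := C11_pair_measurable setT h.
have eb x : `|expR (l x)| <= E.
  by rewrite ger0_norm ?expR_ge0// ler_expR (le_trans (ler_norm _)).
have Prho : C11_pair M rho (fun x => rho x * g x).
  have := C11_pair_linear (Z^-1) 0 h h.
  rewrite normr0 mul0r addr0 ger0_norm// => h1.
  have -> : rho = (fun x => Z^-1 * expR (l x) + 0 * expR (l x)) by apply/funext => x; rewrite /rho; ring.
  have -> : (fun x => (Z^-1 * expR (l x) + 0 * expR (l x)) * g x) =
     (fun x => Z^-1 * (expR (l x) * g x) + 0 * (expR (l x) * g x)).
    by apply/funext => x; ring.
  apply: C11_pair_le h1; apply: (le_trans _ (powE 4%N isT)).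
  rewrite (_ : E ^+ 4 = E * (E * E ^+ 2)); last by ring.
  apply: ler_pM => //; first by rewrite mulr_ge0 ?expR_ge0 ?sqr_ge0.
  by rewrite ler_pM2l ?expR_gt0// lerXn2r// nnegrE; lra.
have ie : integ (fun x => expR (l x)).
  by apply: (@circle_bounded_integrable _ _ E) => //; exact: measurable_funTS mexp.
have Irho : I rho = 1.
  by rewrite /rho RintegralZr// -/(partition l) divff// gt_eqF.
have lnrho x : ln (rho x) = l x - ln Z.
  by rewrite /rho ln_div ?posrE ?expR_gt0// expRK.
have [mrho _] := C11_pair_measurable setT Prho.
have le x : circle x -> l x = - V x - 2 * bt * log_potential rho x.
  move=> cx; rewrite -logconv_log_potential//; last by move=> t; case: Prho => p _ _ _; case: (p t).
  rewrite {1}/l -ff /fp_map/= mulN1r -/Z; congr (_ + _).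
  have [il _] := logker_average_bound (measurable_shift x mexp) (fun s _ => eb (x - s)).
  have -> : logconv rho x = logconv (fun y => expR (l y)) x / Z.
    rewrite /logconv -RintegralZr//; apply: eq_Rintegral => s _.
    by rewrite /rho mulrA.
  by rewrite mulNr; congr (- _); rewrite mulrAC mulrA.
exists rho, g, (- ln Z); split.
- by [].
- move=> x; have -> : (fun x => ln (rho x)) = (fun x => l x - ln Z) by apply/funext => y.
  have dl := C11_pair_derive x Plg.
  by apply: (is_derive_eq (is_deriveB dl (is_derive_cst (ln Z) x 1))); rewrite subr0.
- split; first by exact: lipschitz_continuous (C11_pair_lipg Plg).
  by move=> x; apply: (le_trans (gb x)); rewrite (le_trans _ (powE 1%N isT))// expr1; lra.
- move=> x.
  have h1 : E^-1 <= expR (l x).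
    by rewrite -expRN ler_expR; have := lb x; rewrite ler_norml => /andP[].
  have h2 : (8 * E)^-1 <= Z^-1 by rewrite lef_pV2 ?posrE// mulr_gt0.
  apply: (@le_trans _ _ (E^-1 * (8 * E)^-1)); last by rewrite ler_pM// invr_ge0; lra.
  have M0 : 0 < M by apply: lt_le_trans ME; rewrite exprn_gt0.
  have e8 : 0 < E * (8 * E) by rewrite !mulr_gt0.
  rewrite -invfM lef_pV2 ?posrE//.
  have : E ^+ 2 <= E ^+ 6 by apply: ler_weXn2l.
  have : 0 <= C0 * E ^+ 6 by rewrite mulr_ge0// exprn_ge0// ltW.
  have : 0 <= E ^+ 6 by rewrite exprn_ge0// ltW.
  by rewrite /M; lra.
split; first by move=> x cx; rewrite lnrho le//; ring.
move=> x.
have rhoE y : `|rho y| <= E ^+ 2.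
  by rewrite /rho normrM expr2 ler_pM// ger0_norm.
have lV y : `|l y - (- V y)| <= 2 * bt * C0 * E ^+ 2.
  rewrite {1}/l -ff /fp_map/= mulN1r -/Z (_ : - V y + _ - - V y = - (2 * bt / Z * logconv (fun y => expR (l y)) y)); last by rewrite -/l; ring.
  rewrite normrN normrM ger0_norm; last by rewrite divr_ge0 ?mulr_ge0// ltW.
  have := logconv_bound y mexp eb; have := normr_ge0 (logconv (fun x => expR (l x)) y).
  set q := `|logconv _ _| => q0 hq.
  rewrite (_ : 2 * bt * C0 * E ^+ 2 = (2 * bt * E) * (E * C0)); last by ring.
  apply: ler_pM => //; first by rewrite divr_ge0 ?mulr_ge0// ltW.
  by rewrite ler_wpM2l// mulr_ge0// ltW.
have [Z3 _] := partition_bounds CNV.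
have hZ := partition_diff Plg CNV lV.
have nVb : `|- V x| <= K by case: CNV => _ p _ _; case: (p x).
have he : `|expR (l x) - expR (- V x)| <= E * (2 * bt * C0 * E ^+ 2).
  by apply: (le_trans (expR_diff_le nVb (lb x))); rewrite ler_wpM2l// ltW.
have hV : `|expR (- V x)| <= E.
  by rewrite ger0_norm ?expR_ge0// ler_expR (le_trans (ler_norm _)).
have q : `|rho x - expR (- V x) / (2 * pi)| <= 9 * E * E ^+ 3 * (2 * bt * C0 * E ^+ 2).
  by rewrite /rho -ZV; exact: (quotient_diff_le E1 Z1 Z3 hZ he hV).
apply: (le_trans q); rewrite (_ : 9 * E * E ^+ 3 * (2 * bt * C0 * E ^+ 2) = bt * (18 * C0 * E ^+ 6)); last by ring.
rewrite (mulrC M) ler_wpM2l ?(ltW bt0)// /M ler_wpM2r ?exprn_ge0 ?(ltW E0)//.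
lra.
Qed.

End small_density.

(** * The linearized equation *)

Section linear_equation.
Context {R : realType}.
Notation lam := (@lebesgue_measure R).
Notation pi := (@pi R).
Notation integ f := (lam.-integrable circle (EFin \o f)).
Notation I f := (\int[lam]_(x in circle) f x).
Notation C0 := (@logker_mass R).
Implicit Types (f g F l k w c u : R -> R) (x y t s a b r : R).

Lemma I_bound f (B : R) : measurable_fun circle f -> (forall x, circle x -> `|f x| <= B) ->
  integ f /\ `|I f| <= 8 * B.
Proof.
move=> mf fB; have mc := @measurable_circle R.
split; first exact: circle_bounded_integrable mf fB.
have B0 : 0 <= B by apply: le_trans (fB _ (@circleNpi R)).
apply: (@le_trans _ _ (I (fun=> B))); first by apply: normr_Rintegral_le => //; exact: integ_cst.
by rewrite I_cst mulrC ler_wpM2r//; have /andP[] := @pi2_bounds R.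
Qed.

Lemma measurable_log_potential w (B : R) : measurable_fun circle w ->
  (forall x, circle x -> `|w x| <= B) -> measurable_fun circle (log_potential w).
Proof.
move=> mw wB.
exact: (integrable_EFin_measurable (integ_log_potential (circle_bounded_integrable mw wB))).
Qed.

(** The right-hand side is a sup-norm contraction in w for small beta. Its last
    term is the multiplier that gives w mean zero when rho has mass 1. *)
Lemma linear_equation (rho h : R -> R) (M B bt : R) :
  measurable_fun circle rho -> (forall x, circle x -> `|rho x| <= M) ->
  measurable_fun circle h -> (forall x, circle x -> `|h x| <= B) ->
  0 <= bt -> bt * (4 * C0 * (M + 8 * M ^+ 2)) <= 1 ->
  let r w x := rho x * (h x + 2 * bt * log_potential w x) in
  exists w, [/\ measurable_fun circle w, exists B', forall x, circle x -> `|w x| <= B' &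
    forall x, circle x -> w x = - r w x + rho x * I (r w)].
Proof.
move=> mrho rhoM mh hB bt0 bts r; have mc := @measurable_circle R.
have M0 : 0 <= M by apply: le_trans (rhoM _ (@circleNpi R)).
have B0 : 0 <= B by apply: le_trans (hB _ (@circleNpi R)).
pose N := M + 8 * M ^+ 2; pose B1 := 2 * N * B.
have N0 : 0 <= N by rewrite addr_ge0// mulr_ge0// sqr_ge0.
have B10 : 0 <= B1 by rewrite !mulr_ge0.
have C00 := @logker_mass_ge0 R.
pose P w := measurable_fun circle w /\ forall x, circle x -> `|w x| <= B1.
pose T w x := - r w x + rho x * I (r w).
(* T f - T g is this operator applied to a difference of potentials *)
have op (q : R -> R) (Q : R) : measurable_fun circle q -> (forall x, circle x -> `|q x| <= Q) ->
    forall x, circle x -> `|- (rho x * q x) + rho x * I (fun x => rho x * q x)| <= N * Q.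
  move=> mq qQ x cx; rewrite (le_trans (ler_normD _ _))// normrN !normrM.
  have [_ h1] := @I_bound (fun x => rho x * q x) (M * Q) (measurable_funM mrho mq)
     (fun x cx => ltac:(by rewrite normrM ler_pM// ?rhoM ?qQ)).
  rewrite /N mulrDl lerD//; first by rewrite ler_pM// ?rhoM ?qQ.
  rewrite (_ : 8 * M ^+ 2 * Q = M * (8 * (M * Q))); last by ring.
  by rewrite ler_pM// rhoM.
have mU w : P w -> measurable_fun circle (log_potential w).
  by move=> [mw wB]; exact: measurable_log_potential mw wB.
have mq w : P w -> measurable_fun circle (fun x => h x + 2 * bt * log_potential w x).
  by move=> Pw; apply: measurable_funD => //; apply: measurable_funM => //; exact: mU.
have UB w x : P w -> circle x -> `|log_potential w x| <= B1 * C0.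
  by move=> [mw wB] cx; exact: log_potential_bound mw wB cx.
have bC : bt * C0 * N <= 4^-1.
  by move: bts; rewrite -/N (_ : bt * (4 * C0 * N) = 4 * (bt * C0 * N)); [lra|ring].
have PT w : P w -> P (T w).
  move=> Pw; split.
    apply: measurable_funD; last by apply: measurable_funM.
    by apply: measurableT_comp => //; apply: measurable_funM => //; exact: mq.
  move=> x cx; have := op _ (B + 2 * bt * (B1 * C0)) (mq w Pw) _ x cx.
  rewrite -/(r w) -/(r w x) -/(T w x) => /(_ _)/le_trans; apply.
    move=> y cy; rewrite (le_trans (ler_normD _ _))// lerD ?hB// normrM ger0_norm ?mulr_ge0//.
    by rewrite ler_wpM2l ?mulr_ge0// UB.
  rewrite (_ : N * _ = N * B + 2 * (bt * C0 * N) * B1); last by ring.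
  have : 2 * (bt * C0 * N) * B1 <= 2^-1 * B1 by rewrite ler_wpM2r//; lra.
  by rewrite (_ : N * B = B1 / 2); [lra|rewrite /B1; field].
have P0 : P (fun=> 0) by split=> [|x _]; [exact: measurable_cst|rewrite normr0].
have contr f g (d : R) : P f -> P g -> (forall x, circle x -> `|f x - g x| <= d) ->
    forall x, circle x -> `|T f x - T g x| <= d * 2^-1.
  move=> Pf Pg fg x cx.
  pose q x := 2 * bt * log_potential (fun t => f t - g t) x.
  have d0 : 0 <= d by exact: le_trans (fg x cx).
  have [mf fB] := Pf; have [mg gB] := Pg.
  have qE y : circle y -> q y = (h y + 2 * bt * log_potential f y) - (h y + 2 * bt * log_potential g y).
    by move=> cy; rewrite /q (log_potentialB mf mg fB gB cy); ring.
  have mfg : measurable_fun circle (fun t => f t - g t) by exact: measurable_funB.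
  have mq' : measurable_fun circle q.
    apply: measurable_funM => //; exact: measurable_log_potential mfg fg.
  have qB y : circle y -> `|q y| <= 2 * bt * (d * C0).
    move=> cy; rewrite /q normrM ger0_norm ?mulr_ge0// ler_wpM2l ?mulr_ge0//.
    exact: log_potential_bound mfg fg cy.
  have ir w : P w -> integ (r w).
    move=> Pw; apply: (@circle_bounded_integrable _ _ (M * (B + 2 * bt * (B1 * C0)))).
      by apply: measurable_funM => //; exact: mq.
    move=> y cy; rewrite normrM ler_pM// ?rhoM//.
    rewrite (le_trans (ler_normD _ _))// lerD ?hB// normrM ger0_norm ?mulr_ge0//.
    by rewrite ler_wpM2l ?mulr_ge0// UB.
  have -> : T f x - T g x = - (rho x * q x) + rho x * I (fun x => rho x * q x).
    have -> : I (fun x => rho x * q x) = I (r f) - I (r g).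
      rewrite -RintegralB//; [|exact: ir|exact: ir].
      by apply: eq_I => y cy; rewrite qE// /r; ring.
    have rE v : r v x = rho x * (h x + 2 * bt * log_potential v x) by [].
    by rewrite /T qE// !rE; move: (I (r f)) (I (r g)) => A A'; ring.
  apply: (le_trans (op q _ mq' qB x cx)).
  rewrite (_ : N * _ = 2 * (bt * C0 * N) * d); last by ring.
  by rewrite (mulrC d) ler_wpM2r//; lra.
have Plim (u : nat -> R -> R) f : (forall n, P (u n)) ->
    (forall x, circle x -> u n x @[n --> \oo] --> f x) -> P f.
  move=> Pu uf; split.
    exact: (@measurable_fun_cvg _ (measurableTypeR R) R circle u f (fun n => (Pu n).1) uf).
  move=> x cx; have h1 : `|u n x| @[n --> \oo] --> `|f x| by apply: cvg_norm; exact: uf.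
  have <- := cvg_lim (@Rhausdorff R) h1; apply: limr_le; first by apply/cvg_ex; eexists; exact: h1.
  by apply: nearW => n; exact: (Pu n).2.
have T0 x : circle x -> `|T (fun=> 0) x - 0| <= B1 by move=> cx; rewrite subr0; exact: (PT _ P0).2.
have [w Pw wT] := @sup_contraction_fixpoint R _ circle P T (fun=> 0) B1 P0 PT T0 contr Plim.
by case: Pw => mw wB; exists w; split => //; [exists B1|move=> x cx; rewrite -{1}wT].
Qed.

End linear_equation.

(** * The operator of the linearized dynamics *)

Section operator.
Context {R : realType}.
Notation lam := (@lebesgue_measure R).
Notation pi := (@pi R).
Notation integ f := (lam.-integrable circle (EFin \o f)).
Notation I f := (\int[lam]_(x in circle) f x).
Notation C0 := (@logker_mass R).
Notation "f =ae g" := ({ae lam, forall x, circle x -> f x = g x})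
  (at level 70, only parsing).
Implicit Types (f F k w c u : R -> R) (x y t s a b r : R).

(** mu stands for a measure with positive density rho of class C^{1,1}, and g
    for the derivative of log rho. *)
Variables (mu : probability (measurableTypeR R) R) (rho g : R -> R) (M bt : R).
Hypothesis M1 : 1 <= M.
Hypothesis bt0 : 0 < bt.
Hypothesis Crho : C11_pair M rho (fun x => rho x * g x).
Hypothesis Irho : I rho = 1.
Hypothesis dln : forall x, is_derive x 1 (fun x => ln (rho x)) (g x).
Hypothesis cg : continuous g.
Hypothesis gM : forall x, `|g x| <= M.
Hypothesis rho_ge : forall x, M^-1 <= rho x.
Hypothesis mdens : measurable_fun circle (density mu).
Hypothesis dens : density mu =ae rho.
Hypothesis Emu : forall f f', f =ae f' -> measurable_fun circle f' ->
  \int[mu]_(x in circle) f x = I (fun x => f' x * rho x).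

Let M0 : 0 < M. Proof. by apply: lt_le_trans M1. Qed.

Lemma rho_gt0 x : 0 < rho x.
Proof. by apply: lt_le_trans (rho_ge x); rewrite invr_gt0. Qed.

Lemma rho_le x : `|rho x| <= M.
Proof. by case: Crho => _ h _ _; case: (h x). Qed.

Lemma rho_inv_le x : `|(rho x)^-1| <= M.
Proof.
by rewrite ger0_norm ?invr_ge0 ?(ltW (rho_gt0 _))// invf_ple ?posrE ?rho_gt0.
Qed.

Lemma rho_periodic x : rho (x + 2 * pi) = rho x.
Proof. by case: Crho => h _ _ _; case: (h x). Qed.

Lemma AC_periodic f F : (forall x, is_derive x 1 F (f x)) -> continuous f ->
  (forall x, F (x + 2 * pi) = F x) -> AC F f /\ I f = 0.
Proof.
move=> d cf pF; have [h1 h2] := C1_AC d cf; split=> //.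
by rewrite h2 -(pF (- pi)) (_ : - pi + 2 * pi = pi) ?subrr//; ring.
Qed.

Lemma AC_rho : AC rho (fun x => rho x * g x) /\ I (fun x => rho x * g x) = 0.
Proof.
apply: AC_periodic; [by move=> x; exact: C11_pair_derive Crho| |exact: rho_periodic].
exact: lipschitz_continuous (C11_pair_lipg Crho).
Qed.

Lemma AC_ln_rho : AC (fun x => ln (rho x)) g /\ I g = 0.
Proof. by apply: AC_periodic => // x; rewrite rho_periodic. Qed.

Lemma AC_rho_inv : AC (fun x => (rho x)^-1) (fun x => - (g x / rho x)) /\
  I (fun x => - (g x / rho x)) = 0.
Proof.
have rn x : rho x != 0 by rewrite gt_eqF ?rho_gt0.
apply: AC_periodic; last by move=> x; rewrite rho_periodic.
  move=> x; apply: (is_derive_eq (is_deriveV (rn x) (C11_pair_derive x Crho))).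
  by rewrite /GRing.scale/=; field.
have cr : continuous rho by case: Crho => _ _ h _; exact: lipschitz_continuous h.
move=> x; apply: cvgN; apply: cvgM; first exact: cg.
by apply: cvgV => //; exact: cr.
Qed.

Lemma AC_mul_per f w F k : AC f w -> I w = 0 -> AC F k -> I k = 0 ->
  AC (fun x => f x * F x) (fun x => w x * F x + f x * k x) /\
  I (fun x => w x * F x + f x * k x) = 0.
Proof.
move=> fw w0 Fk k0; split; first exact: AC_mul.
rewrite RintegralD//; first by rewrite (ACper_ibp fw w0 Fk k0) subrr.
- exact: @measurable_circle.
- by apply: (integM Fk); case: fw.
- by apply: (eq_integrable_EFin (@measurable_circle R) (integM fw (proj1 Fk))) => x _; rewrite mulrC.
Qed.

(** With u = rho phi' and w = u', the terms phi'' and (log rho)' phi' combine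
    into w / rho, and 2 pi H u is twice the logarithmic potential of w. *)
Lemma Lformula_ae phi p0 p q : weak_derivative phi p0 -> p0 =ae p -> AC p q -> I q = 0 ->
  let w x := q x * rho x + p x * (rho x * g x) in
  [/\ AC (fun x => p x * rho x) w, I w = 0, wderiv phi =ae p &
    Lformula mu bt phi =ae (fun x => - (w x / rho x + 2 * bt * log_potential w x))].
Proof.
move=> phip p0p pq q0 w; have mc := @measurable_circle R.
have [ACr Ir] := AC_rho.
have [ACw Iw] := AC_mul_per pq q0 ACr Ir.
have wd := wderivP phip.
have wp : wderiv phi =ae p by apply: ae_trans p0p; exact: weak_derivative_unique wd phip.
split => //.
have [_ wq] : weak_derivative (wderiv phi) (wderiv (wderiv phi)) /\ wderiv (wderiv phi) =ae q.
  by apply: (wderiv_ae pq) => //; case: wd.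
have [ACl Ig] := AC_ln_rho.
have lnd : (fun x => ln (density mu x)) =ae (fun x => ln (rho x)).
  by apply: (aeS dens) => x e cx; rewrite e.
have [_ lg] : weak_derivative (fun x => ln (density mu x)) (wderiv (fun x => ln (density mu x))) /\
    wderiv (fun x => ln (density mu x)) =ae g.
  apply: (wderiv_ae ACl) => //; apply: (ae_eq_integrable mc (ae_sym lnd)); last exact: AC_integ ACl.
  by apply: measurableT_comp mdens; exact: measurable_ln.
have up : (fun t => density mu t * wderiv phi t) =ae (fun x => p x * rho x).
  by apply: (aeS2 dens wp) => x e1 e2 cx; rewrite e1// e2// mulrC.
have iU := potential_ae (proj1 ACw).
have A1 : (fun x => wderiv (fun t => ln (density mu t)) x * wderiv phi x) =ae (fun x => g x * p x).
  by apply: (aeS2 lg wp) => x e1 e2 cx; rewrite e1// e2.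
have A2 : (fun x => wderiv (wderiv phi) x + wderiv (fun t => ln (density mu t)) x * wderiv phi x)
    =ae (fun x => q x + g x * p x).
  by apply: (aeS2 wq A1) => x e1 e2 cx; rewrite e1// e2.
have A3 : {ae lam, forall x, x <> - pi /\ (circle x -> integ (fun t => logker (x - t) * w t))}.
  by apply: (aeS2 (ae_neq (- pi)) iU) => x.
apply: (aeS2 A2 A3) => x e1 [xn e4] cx.
rewrite /Lformula addrAC e1//.
move: (cx); rewrite circleE => /andP[lx xr].
rewrite (hilbertE ACw Iw up)//; last exact: e4; last by rewrite lt_neqAle lx eq_sym andbT; exact/eqP.
rewrite -/w; have r0 := rho_gt0 x.
congr (- _).
have -> : 2 * pi * bt * (log_potential w x / pi) = 2 * bt * log_potential w x.
  rewrite -[in RHS](divfK (lt0r_neq0 (@pi_gt0 R)) (log_potential w x)).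
  by move: (log_potential w x / pi) (@trigo.pi R) => U P; ring.
by rewrite /w; field; rewrite gt_eqF.
Qed.

Lemma AC_shift f w (c0 : R) : AC f w -> AC (fun x => f x - c0) w.
Proof.
move=> fw; have h := AC_linear 1 (- c0) fw (AC_cst 1).
apply: (AC_ext (f := fun x => 1 * f x + (- c0) * 1)); first by move=> x _; ring.
by apply: AC_ext_deriv h => x _ /=; rewrite mulr0 addr0 mul1r.
Qed.

Lemma integ_rho : integ rho.
Proof. exact: AC_integ (proj1 AC_rho). Qed.

Lemma measurable_rho : measurable_fun circle rho.
Proof. exact: AC_measurable (proj1 AC_rho). Qed.

Lemma weak_L1_moment f (B : R) : measurable_fun circle f -> (forall x, circle x -> `|f x| <= B) ->
  `|I (fun x => f x * rho x)| <= B.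
Proof.
move=> mf fB; have mc := @measurable_circle R.
rewrite -[X in _ <= X]mulr1 -Irho -RintegralZl//; last exact: integ_rho.
apply: normr_Rintegral_le => //.
- by apply: measurable_funM => //; exact: measurable_rho.
- by move=> x cx; rewrite normrM (ger0_norm (ltW (rho_gt0 x))) ler_wpM2r ?fB// ltW ?rho_gt0.
- by apply: integrableEFinZ => //; exact: integ_rho.
Qed.

Definition centered F x : R := F x - I (fun x => F x * rho x).

Lemma center_ae psi F : psi =ae F -> measurable_fun circle F ->
  center mu psi =ae centered F.
Proof.
move=> pF mF; apply: (aeS pF) => x e cx.
by rewrite /center (Emu pF mF) e.
Qed.

Lemma centered_bound F (B : R) x : measurable_fun circle F ->
  (forall x, circle x -> `|F x| <= B) -> circle x -> `|centered F x| <= 2 * B.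
Proof.
move=> mF FB cx; rewrite /centered (le_trans (ler_normB _ _))// mulr_natl mulr2n lerD ?FB//.
exact: weak_L1_moment.
Qed.

Lemma I_centered F (B : R) : measurable_fun circle F ->
  (forall x, circle x -> `|F x| <= B) -> I (fun x => centered F x * rho x) = 0.
Proof.
move=> mF FB; have mc := @measurable_circle R.
rewrite (@eq_I _ _ (fun x => F x * rho x - I (fun x => F x * rho x) * rho x)); last first.
  by move=> x _; rewrite /centered; ring.
rewrite RintegralB//.
- by rewrite RintegralZl// ?Irho ?mulr1 ?subrr//; exact: integ_rho.
- by apply: (eq_integrable_EFin mc (integrableM_bounded mc integ_rho mF FB)) => x _; rewrite mulrC.
- by apply: integrableEFinZ => //; exact: integ_rho.
Qed.

(** Let h be the centered psi and w = (rho phi')'. The equation says that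
    w = - rho (h + 2 beta U_w) up to a multiple of rho, so integrating by parts
    the inner product is - int h w = int h^2 rho + 2 beta int h rho U_w. For
    small beta the potential term can be absorbed to bound w in L^1 by h, and
    then the last integral is bounded. *)
Lemma Hinner_estimate psi F dpsi phi (B : R) :
  AC F dpsi -> I dpsi = 0 -> psi =ae F -> integ psi ->
  (forall x, circle x -> `|F x| <= B) ->
  Hspace mu phi -> sobolev 2 phi -> ae_eq lam circle (Lop mu bt phi) (center mu psi) ->
  bt * (8 * M * C0) <= 1 ->
  `|Hinner mu (center mu psi) phi - I (fun x => centered F x ^+ 2 * rho x)| <=
    32 * M ^+ 2 * (2 * B) ^+ 2 * C0 * bt.
Proof.
move=> FA I0 pF ip FB _ [_ [p0 [phip0 [_ [q [p0q _]]]]]] Lphi bts.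
pose h := centered F.
have mc := @measurable_circle R.
have mr := measurable_rho; have ir := integ_rho.
have [p [pq p0p]] := weak_derivative_AC p0q; have q0 := weak_derivative_mean0 p0q.
pose w x := q x * rho x + p x * (rho x * g x); pose U := log_potential w.
have [ACw Iw phip Lw] : [/\ AC (fun x => p x * rho x) w, I w = 0, wderiv phi =ae p &
    Lformula mu bt phi =ae (fun x => - (w x / rho x + 2 * bt * U x))].
  exact: Lformula_ae phip0 p0p pq q0.
have [wi _] := ACw.
have iU : integ U by exact: integ_log_potential.
have C00 := @logker_mass_ge0 R.
have hA : AC h dpsi by exact: AC_shift.
have mF := AC_measurable FA; have mh := AC_measurable hA.
pose H := 2 * B.
have hB x : circle x -> `|h x| <= H.
  move=> cx; rewrite /h /centered (le_trans (ler_normB _ _))// /H mulr_natl mulr2n lerD ?FB//.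
  exact: weak_L1_moment.
have H0 : 0 <= H by apply: le_trans (hB _ (@circleNpi R)).
have cpsi := center_ae pF mF; rewrite -/h in cpsi *.
have ihr : integ (fun x => rho x * h x) by exact: integrableM_bounded mc ir mh hB.
have iUr : integ (fun x => U x * rho x).
  by apply: integrableM_bounded mc iU mr _ => x _; exact: rho_le.
have Ihr : I (fun x => rho x * h x) = 0.
  rewrite (_ : I (fun x => rho x * h x) = I (fun x => F x * rho x - I (fun x => F x * rho x) * rho x)); last first.
    by apply: eq_I => x _; rewrite /h /centered; ring.
  rewrite RintegralB//.
  - by rewrite RintegralZl// Irho mulr1 subrr.
  - by apply: (eq_integrable_EFin mc (integrableM_bounded mc ir mF FB)) => x _; rewrite mulrC.
  - exact: integrableEFinZ.
pose r x := rho x * h x + 2 * bt * (U x * rho x).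
have irr : integ r by apply: integrableEFinD => //; exact: integrableEFinZ.
have Ir : I r = 2 * bt * I (fun x => U x * rho x).
  rewrite RintegralD//; last exact: integrableEFinZ.
  by rewrite Ihr add0r RintegralZl.
pose e := \int[mu]_(t in circle) Lformula mu bt phi t.
have wr : w =ae (fun x => - r x - e * rho x).
  have a1 : (fun x => - (w x / rho x + 2 * bt * U x) - e) =ae h.
    apply: (aeS2 Lw (ae_trans Lphi cpsi)) => x e1 e2 cx.
    by rewrite -e1// -e2// /Lop /center -/e.
  apply: (aeS a1) => x e1 cx; have r0 := rho_gt0 x.
  rewrite /r -e1//; field.
  by rewrite gt_eqF.
have ew : e = - (2 * bt * I (fun x => U x * rho x)).
  have := Iw; rewrite (ae_eq_Rintegral wr).
  rewrite (_ : I (fun x => - r x - e * rho x) = I (fun x => - 1 * r x - e * rho x)); last by apply: eq_I => x _; rewrite mulN1r.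
  rewrite RintegralB//; [|exact: integrableEFinZ|exact: integrableEFinZ].
  rewrite !RintegralZl// Irho Ir; lra.
pose N1 := I (fun t => `|w t|).
have UN : I (fun x => `|U x|) <= C0 * N1 by exact: log_potential_L1.
have N10 : 0 <= N1 by apply: Rintegral_ge0.
have iaU : integ (fun x => `|U x|) by exact: integrable_norm iU.
have bound f (K : R) : measurable_fun circle f -> (forall x, circle x -> `|f x| <= K) ->
    `|I (fun x => U x * f x)| <= K * (C0 * N1).
  move=> mf fK; have K0 : 0 <= K by apply: le_trans (fK _ (@circleNpi R)).
  apply: (@le_trans _ _ (K * I (fun x => `|U x|))); last by rewrite ler_wpM2l.
  rewrite -RintegralZl//; apply: normr_Rintegral_le => //.
  - exact: measurable_funM (integrable_EFin_measurable iU) mf.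
  - by move=> x cx; rewrite normrM mulrC ler_wpM2r// fK.
  - exact: integrableEFinZ.
have eb : `|e| <= 2 * bt * (M * (C0 * N1)).
  rewrite ew normrN normrM ger0_norm; last by rewrite mulr_ge0// ltW.
  by rewrite ler_wpM2l ?mulr_ge0 ?(ltW bt0)//; apply: bound => // x _; exact: rho_le.
have N1b : N1 <= 16 * M * H.
  have : N1 <= I (fun x => M * H + (2 * bt * M) * `|U x| + `|e| * rho x).
    apply: le_I_ae.
    - exact: integrable_norm wi.
    - apply: integrableEFinD => //; last exact: integrableEFinZ.
      by apply: integrableEFinD => //; [exact: integ_cst|exact: integrableEFinZ].
    apply: (aeS wr) => x e1 cx; rewrite e1// (le_trans (ler_normB _ _))// normrN normrM.
    rewrite (ger0_norm (ltW (rho_gt0 x))) lerD2r /r (le_trans (ler_normD _ _))// !normrM lerD//.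
      by rewrite ler_pM// ?rho_le ?hB.
    rewrite (@ger0_norm _ 2)// (ger0_norm (ltW bt0)) -!mulrA !ler_wpM2l ?(ltW bt0)// mulrC.
    by rewrite ler_wpM2r// rho_le.
  rewrite RintegralD//; [|by apply: integrableEFinD => //; [exact: integ_cst|exact: integrableEFinZ]|exact: integrableEFinZ].
  rewrite RintegralD//; [|exact: integ_cst|exact: integrableEFinZ].
  rewrite I_cst !RintegralZl// Irho mulr1.
  have /andP[_ p8] := @pi2_bounds R.
  have MH0 : 0 <= M * H by rewrite mulr_ge0// ltW.
  have h1 : M * H * (2 * pi) <= M * H * 8 by rewrite ler_wpM2l.
  have h2 : 2 * bt * M * I (fun x => `|U x|) <= 2 * bt * M * (C0 * N1).
    by rewrite ler_wpM2l// !mulr_ge0// ltW.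
  have h3 : bt * (8 * M * C0) * N1 <= 1 * N1 by rewrite ler_wpM2r.
  move: h1 h2 h3 eb; rewrite (_ : 2 * bt * M * (C0 * N1) = 4^-1 * (bt * (8 * M * C0) * N1)); last by field.
  rewrite (_ : 2 * bt * (M * (C0 * N1)) = 4^-1 * (bt * (8 * M * C0) * N1)); last by field.
  rewrite (_ : 16 * M * H = 16 * (M * H)); last by ring.
  lra.
have -> : Hinner mu (center mu psi) phi = - I (fun x => h x * w x).
  have [_ wc] : weak_derivative (center mu psi) (wderiv (center mu psi)) /\ wderiv (center mu psi) =ae dpsi.
    by apply: (wderiv_ae hA I0 cpsi); exact: (integrableEFinB mc ip (integ_cst _)).
  rewrite (ACper_ibp hA I0 ACw Iw) opprK /Hinner.
  rewrite (Emu (f' := fun x => dpsi x * p x)).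
  - by apply: eq_I => x _; ring.
  - by apply: (aeS2 wc phip) => x e1 e2 cx; rewrite e1// e2.
  - apply: measurable_funM; last exact: AC_measurable pq.
    exact: (integrable_EFin_measurable (proj1 FA)).
have -> : - I (fun x => h x * w x) = I (fun x => h x ^+ 2 * rho x) + 2 * bt * I (fun x => U x * (rho x * h x)).
  have e1 : (fun x => h x * w x) =ae (fun x => (-1) * (h x ^+ 2 * rho x) + (- (2 * bt)) * (U x * (rho x * h x)) + (- e) * (rho x * h x)).
    by apply: (aeS wr) => x e1 cx; rewrite e1// /r; ring.
  have i1 : integ (fun x => h x ^+ 2 * rho x).
    by apply: (eq_integrable_EFin mc (integrableM_bounded mc ihr mh hB)) => x _; ring.
  have i2 : integ (fun x => U x * (rho x * h x)).
    by apply: (eq_integrable_EFin mc (integrableM_bounded mc iUr mh hB)) => x _; ring.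
  rewrite (ae_eq_Rintegral e1) RintegralD//; [|by apply: integrableEFinD => //; exact: integrableEFinZ|exact: integrableEFinZ].
  rewrite RintegralD//; [|exact: integrableEFinZ|exact: integrableEFinZ].
  by rewrite !RintegralZl// Ihr; ring.
rewrite addrAC subrr add0r normrM ger0_norm; last by rewrite mulr_ge0// ltW.
have := @bound (fun x => rho x * h x) (M * H) (measurable_funM mr mh)
  (fun x cx => ltac:(by rewrite normrM ler_pM// ?rho_le ?hB)).
move=> hb; apply: (@le_trans _ _ (2 * bt * (M * H * (C0 * (16 * M * H))))).
  rewrite ler_wpM2l ?mulr_ge0 ?(ltW bt0)//; apply: (le_trans hb).
  apply: ler_wpM2l; first by rewrite mulr_ge0// ltW.
  exact: ler_wpM2l.
by rewrite le_eqVlt /H; apply/orP; left; apply/eqP; ring.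
Qed.

Lemma L2_bounded f (B : R) : measurable_fun circle f -> (forall x, circle x -> `|f x| <= B) -> L2 f.
Proof.
move=> mf fB; split => //; apply: (@circle_bounded_integrable _ _ (B ^+ 2)).
  by apply: measurable_funX.
by move=> x cx; rewrite normrX lerXn2r ?nnegrE ?fB//; exact: le_trans (fB x cx).
Qed.

(** The linearized equation gives w = (rho phi')', and phi is recovered by two
    integrations; the constants make phi' of mean zero, so that phi is
    periodic, and phi centered. *)
Lemma Linv_solution_exists psi F dpsi (B : R) :
  AC F dpsi -> I dpsi = 0 -> psi =ae F -> (forall x, circle x -> `|F x| <= B) ->
  bt * (4 * C0 * (M + 8 * M ^+ 2)) <= 1 ->
  exists phi, [/\ Hspace mu phi, sobolev 2 phi &
    ae_eq lam circle (Lop mu bt phi) (center mu psi)].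
Proof.
move=> FA I0 pF FB bts; have mc := @measurable_circle R.
have mr := measurable_rho; have ir := integ_rho.
pose h := centered F.
have mF := AC_measurable FA; have hA : AC h dpsi by exact: AC_shift.
have mh := AC_measurable hA.
have hB x : circle x -> `|h x| <= 2 * B by exact: centered_bound.
have [w [mw [B' wB] wE]] := linear_equation mr (fun x _ => rho_le x) mh hB (ltW bt0) bts.
set r := fun x => rho x * _ in wE.
have wi : integ w by exact: circle_bounded_integrable mw wB.
have mU := measurable_log_potential mw wB.
have irr : integ r.
  have i0 := integrableEFinD mc (AC_integ hA) (integrableEFinZ (2 * bt) mc (integ_log_potential wi)).
  have i1 := integrableM_bounded mc i0 mr (fun x _ => rho_le x).
  by apply: (eq_integrable_EFin mc i1) => x _; rewrite mulrC.
have Iw : I w = 0.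
  rewrite (@eq_I _ _ (fun x => I r * rho x - r x)); last by move=> x cx; rewrite wE// addrC mulrC.
  rewrite RintegralB//; last exact: integrableEFinZ.
  by rewrite RintegralZl// Irho mulr1 subrr.
have [Ai Ii] := AC_rho_inv; have mri := AC_measurable Ai; have iri := AC_integ Ai.
pose a := - I (fun x => (rho x)^-1 * prim w x) / I (fun x => (rho x)^-1).
pose u x := prim w x - - a.
have uA : AC u w by apply: AC_shift; exact: AC_prim.
have [pA Iq] := AC_mul_per uA Iw Ai Ii.
set p := fun x => u x * _ in pA; set q := fun x => w x * _ + _ in pA Iq.
have Irig0 : 0 < I (fun x => (rho x)^-1).
  have [_ + _] := @I_between _ (fun x => (rho x)^-1) M^-1 M mri (ltac:(by rewrite invr_ge0 ltW)) (fun x _ => ltac:(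
    by rewrite lef_pV2 ?posrE ?rho_gt0// (le_trans (ler_norm _) (rho_le x))/= (le_trans (ler_norm _) (rho_inv_le x)))).
  by apply: lt_le_trans; rewrite mulr_gt0 ?invr_gt0// mulr_gt0// pi_gt0.
have Ip : I p = 0.
  rewrite (@eq_I _ _ (fun x => (rho x)^-1 * prim w x + a * (rho x)^-1)); last first.
    by move=> x _; rewrite /p /u; ring.
  have i1 := integM (AC_prim wi) iri.
  rewrite RintegralD//; last exact: integrableEFinZ.
  by rewrite RintegralZl// /a divfK ?addrN// gt_eqF.
have pi_ : integ p by exact: AC_integ pA.
pose phi := centered (prim p).
have phiA : AC phi p by apply: AC_shift; exact: AC_prim.
have wdphi : weak_derivative phi p by exact: ACper_weak_derivative.
have wdp : weak_derivative p q by exact: ACper_weak_derivative.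
have mq : measurable_fun circle q := integrable_EFin_measurable (proj1 pA).
have L2AC f f' : AC f f' -> L2 f.
  by move=> fA; apply: (L2_bounded (AC_measurable fA)) => x cx; exact: AC_bound fA cx.
have L2q : L2 q.
  apply: (@L2_bounded _ (B' * M + (`|u (- pi)| + I (fun t => `|w t|)) * (M * M)) mq) => x cx.
  rewrite /q (le_trans (ler_normD _ _))// !normrM normrN lerD//.
    by rewrite ler_pM// ?wB// rho_inv_le.
  rewrite normrM ler_pM//; first exact: AC_bound uA cx.
  by rewrite ler_pM// ?gM ?rho_inv_le.
have s1 : sobolev 1 p by split; [exact: L2AC pA|exists q].
exists phi; split.
- split; first by split; [exact: L2AC phiA|exists p; split => //; exact: L2AC pA].
  have mp := AC_measurable (AC_prim pi_).
  rewrite (Emu (f' := phi)); [|by apply: aeW|exact: AC_measurable phiA].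
  by apply: (I_centered mp) => x cx; exact: AC_bound (AC_prim pi_) cx.
- by split; [exact: L2AC phiA|exists p; split].
have pp : p =ae p by apply: aeW.
pose w' x := q x * rho x + p x * (rho x * g x).
have Lf : Lformula mu bt phi =ae (fun x => - (w' x / rho x + 2 * bt * log_potential w' x)).
  by have [] := Lformula_ae wdphi pp pA Iq.
have w'E x : w' x = w x.
  rewrite /w' /q /p; have := rho_gt0 x; move: (rho x) => r0 r0_gt0; field.
  by rewrite gt_eqF.
have {}w'E : w' = w by apply/funext.
rewrite w'E in Lf.
pose L x := h x - I r.
have LL : Lformula mu bt phi =ae L.
  apply: (aeS Lf) => x e cx; rewrite e// wE// /L /r; have := rho_gt0 x.
  move: (rho x) => r0 r0_gt0; field; by rewrite gt_eqF.
have mL : measurable_fun circle L by apply: measurable_funB.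
have CL := center_ae LL mL; apply: ae_trans (ae_sym (center_ae pF mF)).
apply: (aeS CL) => x e cx; rewrite /Lop e// /centered -/(centered F x).
rewrite (_ : I (fun x => L x * rho x) = - I r); first by rewrite /L opprK subrK.
rewrite (@eq_I _ _ (fun x => h x * rho x - I r * rho x)); last by move=> y _; rewrite /L; ring.
rewrite RintegralB//; last exact: integrableEFinZ.
  by rewrite (I_centered mF FB) RintegralZl// Irho mulr1 add0r.
by apply: (eq_integrable_EFin mc (integrableM_bounded mc ir mh hB)) => y _; rewrite mulrC.
Qed.

End operator.

(** * Measures with a density *)

Section density.
Context d (T : measurableType d) (R : realType).
Variables (m : {sigma_finite_measure set T -> \bar R}) (P : {finite_measure set T -> \bar R}).
Variables (D : set T) (r : T -> R).
Hypotheses (mD : measurable D) (mr : measurable_fun D r) (r0 : forall x, D x -> 0 <= r x).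
Hypothesis Pr : forall A, measurable A -> P A = (\int[m]_(x in A `&` D) (r x)%:E)%E.

Let mrE : measurable_fun D (EFin \o r). Proof. exact/measurable_EFinP. Qed.

Lemma density_dominates : P `<< m.
Proof.
apply/null_content_dominatesP => A mA A0; rewrite Pr//.
have mAD : measurable (A `&` D) by exact: measurableI.
apply: null_set_integral => //; last first.
  by apply/eqP; rewrite eq_le measure_ge0 andbT -A0 le_measure ?inE//; exact: subIsetl.
by apply: measurable_funS mrE => //; exact: subIsetr.
Qed.

Lemma density_RN : {ae m, forall x, D x -> Radon_Nikodym_SigmaFinite.f P m x = (r x)%:E}.
Proof.
have Pm := density_dominates.
apply: (integral_ae_eq mD) => //.
  apply: (integrableS measurableT) => //; exact: Radon_Nikodym_SigmaFinite.f_integrable.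
move=> E ED mE; rewrite -Radon_Nikodym_SigmaFinite.f_integral// Pr//.
by rewrite (setIidl ED).
Qed.

Lemma density_ge0_integral (E : set T) (f : T -> \bar R) : measurable E -> E `<=` D ->
  (forall x, 0 <= f x)%E -> measurable_fun E f ->
  (\int[P]_(x in E) f x = \int[m]_(x in E) (f x * (r x)%:E))%E.
Proof.
move=> mE ED f0 mf; rewrite -(Radon_Nikodym_SigmaFinite.change_of_variables density_dominates)//.
apply: ae_eq_integral_any; have := density_RN.
by apply: filterS => x h Ex; rewrite h//; exact: ED.
Qed.

Lemma density_Rintegral (f : T -> R) : measurable_fun D f ->
  (\int[P]_(x in D) (f x)%:E = \int[m]_(x in D) (f x * r x)%:E)%E.
Proof.
move=> mf; rewrite integralE [RHS]integralE; congr (_ - _)%E.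
  rewrite density_ge0_integral//; last exact/measurable_funepos/measurable_EFinP.
  apply: eq_integral => x /set_mem Dx; rewrite !funeposE -!EFin_max -EFinM.
  by rewrite maxr_pMl ?r0// mul0r.
rewrite density_ge0_integral//; last exact/measurable_funeneg/measurable_EFinP.
apply: eq_integral => x /set_mem Dx; rewrite !funenegE -!EFinN -!EFin_max -EFinM.
by rewrite maxr_pMl ?r0// mul0r mulNr.
Qed.

End density.

Section density_probability.
Context {R : realType}.
Notation lam := (@lebesgue_measure R).
Notation measR := (probability (measurableTypeR R) R).

Definition has_density (P : measR) (r : R -> R) :=
  forall A, measurable A -> P A = (\int[lam]_(x in A `&` circle) (r x)%:E)%E.

Lemma has_density_exists (r : R -> R) : measurable_fun circle r ->
  (forall x, circle x -> 0 <= r x) -> (\int[lam]_(x in circle) (r x)%:E = 1)%E ->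
  exists P, has_density P r.
Proof.
move=> mr r0 r1; have mc := @measurable_circle R.
pose P (A : set (measurableTypeR R)) := (\int[lam]_(x in A `&` circle) (r x)%:E)%E.
have P0 : P set0 = 0%E by rewrite /P set0I integral_set0.
have Pge0 A : (0 <= P A)%E.
  by apply: integral_ge0 => x [_ cx]; rewrite lee_fin r0.
have Psig : semi_sigma_additive P.
  move=> F mF tF mUF; rewrite /P setI_bigcupl ge0_integral_bigcup//=.
  - apply: is_cvg_nneseries_cond => n _ _; exact: Pge0.
  - by move=> n; exact: measurableI.
  - by apply/measurable_EFinP; apply: measurable_funS mr => // x [n _ []].
  - by move=> x [n _ [_ cx]]; rewrite lee_fin r0.
  - exact: trivIset_setIr.
have PT : P setT = 1%E by rewrite /P setTI.
pose Pm : {measure set (measurableTypeR R) -> \bar R} :=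
  HB.pack P (isMeasure.Build _ _ _ P P0 Pge0 Psig).
pose PP : measR := HB.pack P (isMeasure.Build _ _ _ P P0 Pge0 Psig)
   (Measure_isProbability.Build _ _ _ (Measure.sort Pm) PT).
by exists PP.
Qed.

End density_probability.

(** * The logarithmic series and positive definite kernels *)

Section log_series.
Context {R : realType}.
Implicit Types (x y t : R).

Definition log_partial (n : nat) t : R := \sum_(i < n) t ^+ i.+1 / i.+1%:R.

Lemma is_derive_log_partial n t : is_derive t 1 (log_partial n) (\sum_(i < n) t ^+ i).
Proof.
elim: n => [|n ih].
  have -> : log_partial 0 = cst 0 by apply/funext => s; rewrite /log_partial big_ord0.
  by rewrite big_ord0; exact: is_derive_cst.
have -> : log_partial n.+1 = log_partial n + (fun s => s ^+ n.+1 * n.+1%:R^-1).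
  by apply/funext => s; rewrite /log_partial big_ord_recr.
rewrite big_ord_recr/=; apply: is_deriveD.
have n0 : n.+1%:R != 0 :> R by rewrite pnatr_eq0.
have h : is_derive t 1 (fun s : R => s ^+ n.+1) (n.+1%:R * t ^+ n).
  have -> : (fun s : R => s ^+ n.+1) = (fun s : R => s) ^+ n.+1 by apply/funext => s; rewrite exprfctE.
  by apply: (is_derive_eq (is_deriveX n.+1 (is_derive_id t 1))); rewrite /GRing.scale/= mulr1.
apply: (is_derive_eq (is_deriveM h (is_derive_cst (n.+1%:R^-1 : R) t 1))).
by rewrite /GRing.scale/= mulr0 add0r mulrA mulVf// mul1r.
Qed.

(** The remainder vanishes at 0 and has derivative t^n / (1 - t). *)
Lemma log_partial_remainder n y : 0 <= y < 1 ->
  0 <= - ln (1 - y) - log_partial n y <= y ^+ n / (1 - y).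
Proof.
move=> /andP[y0 y1].
pose F t := - ln (1 - t) - log_partial n t.
pose f t := (1 - t)^-1 - \sum_(i < n) t ^+ i.
have dF t : t < 1 -> is_derive t 1 F (f t).
  move=> t1; apply: is_deriveB; last exact: is_derive_log_partial.
  have h1 : is_derive t 1 (fun s : R => 1 - s) (-1).
    by apply: (is_derive_eq (is_deriveB (is_derive_cst (1 : R) t 1) (is_derive_id t 1))); rewrite sub0r.
  have h2 : is_derive (1 - t) 1 (@ln R) (1 - t)^-1 by apply: is_derive1_ln; rewrite subr_gt0.
  have h3 : is_derive t 1 (fun s : R => ln (1 - s)) ((1 - t)^-1 * -1).
    exact: (@is_derive1_comp R (@ln R) (fun s => 1 - s) t _ _ h2 h1).
  apply: (is_derive_eq (is_deriveN h3)).
  by rewrite mulrN1 opprK.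
have fE t : t < 1 -> f t = t ^+ n / (1 - t).
  move=> t1; have t1n : 1 - t != 0 by rewrite subr_eq0 gt_eqF.
  apply: (mulIf t1n); rewrite divfK// /f mulrBl mulVf//.
  have := subrX1 t n => h.
  by rewrite (_ : (\sum_(i < n) t ^+ i) * (1 - t) = - ((t - 1) * \sum_(i < n) t ^+ i)); [rewrite -h; ring|ring].
have [c] : exists2 c, c \in `[0, y] & F y - F 0 = f c * (y - 0).
  apply: MVT_segment => //.
    by move=> t; rewrite in_itv/= => /andP[_ ty]; apply: dF; exact: lt_trans y1.
  apply: derivable_within_continuous => t; rewrite in_itv/= => /andP[_ ty].
  by have [] := dF t (le_lt_trans ty y1).
rewrite in_itv/= => /andP[c0 cy].
have F0 : F 0 = 0.
  by rewrite /F subr0 ln1 oppr0 /log_partial big1 ?subr0// => i _; rewrite expr0n mul0r.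
have c1 : c < 1 by exact: le_lt_trans y1.
rewrite F0 !subr0 fE// -/(F y) => ->.
have a0 : 0 <= c ^+ n / (1 - c) by rewrite divr_ge0 ?exprn_ge0 ?subr_ge0// ltW.
have a1 : c ^+ n / (1 - c) <= y ^+ n / (1 - y).
  rewrite ler_pM ?exprn_ge0 ?invr_ge0 ?subr_ge0 ?(ltW c1)// ?lerXn2r ?nnegrE//.
  by rewrite lef_pV2 ?posrE ?subr_gt0// lerB.
rewrite mulr_ge0//=; apply: le_trans a1.
by rewrite ler_piMr// ltW.
Qed.

Lemma log_partial_cvg y : 0 <= y < 1 -> log_partial n y @[n --> \oo] --> - ln (1 - y).
Proof.
move=> y01; have /andP[y0 y1] := y01.
have h0 : - ln (1 - y) - y ^+ n / (1 - y) @[n --> \oo] --> - ln (1 - y) - 0 * (1 - y)^-1.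
  apply: cvgB; first exact: cvg_cst; apply: cvgM; last exact: cvg_cst.
  by apply: cvg_expr; rewrite ger0_norm.
rewrite mul0r subr0 in h0.
apply: (squeeze_cvgr _ h0 (cvg_cst _)); apply: nearW => n.
by have /andP[a b] := log_partial_remainder n y01; apply/andP; split; lra.
Qed.

Lemma log_partial_ge0 n y : 0 <= y -> 0 <= log_partial n y.
Proof. by move=> y0; apply: sumr_ge0 => i _; rewrite divr_ge0// exprn_ge0. Qed.

End log_series.

Section positive_kernels.
Context {R : realType}.
Notation measR := (probability (measurableTypeR R) R).
Implicit Types (phi : R -> R) (K L : R -> R -> R) (P Q : measR).

Definition bounded_measurable phi :=
  measurable_fun setT phi /\ exists C : R, forall x, `|phi x| <= C.

(** Finite sums of kernels phi x * phi y, a class of positive semidefinite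
    kernels closed under products. *)
Inductive pdk : (R -> R -> R) -> Prop :=
| pdk1 phi : bounded_measurable phi -> pdk (fun x y => phi x * phi y)
| pdkD K L : pdk K -> pdk L -> pdk (fun x y => K x y + L x y).

Lemma aePS P (A B : R -> Prop) : {ae P, forall x, A x} ->
  (forall x, A x -> B x) -> {ae P, forall x, B x}.
Proof. by move=> h AB; apply: (@filterS _ _ (ae_filter_ringOfSetsType P) _ _ AB). Qed.

Lemma bounded_measurableM f g : bounded_measurable f -> bounded_measurable g ->
  bounded_measurable (fun x => f x * g x).
Proof.
move=> [mf [C fC]] [mg [C' gC]]; split; first exact: measurable_funM.
by exists (C * C') => x; rewrite normrM ler_pM.
Qed.

Lemma bounded_measurableD f g : bounded_measurable f -> bounded_measurable g ->
  bounded_measurable (fun x => f x + g x).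
Proof.
move=> [mf [C fC]] [mg [C' gC]]; split; first exact: measurable_funD.
by exists (C + C') => x; rewrite (le_trans (ler_normD _ _))// lerD.
Qed.

Lemma bounded_measurable_cst (c : R) : bounded_measurable (fun=> c).
Proof. by split; [exact: measurable_cst|exists `|c|]. Qed.

Lemma bounded_measurable_integrable phi P : bounded_measurable phi ->
  P.-integrable circle (EFin \o phi).
Proof.
move=> [mf [C fC]]; have mc := @measurable_circle R.
apply: (measurable_bounded_integrable mc).
- by rewrite (le_lt_trans (probability_le1 P mc))// ltry.
- exact: measurable_funTS.
- by exists C; split; [exact: num_real|move=> y Cy x _; exact: (le_trans (fC x) (ltW Cy))].
Qed.

Lemma pdkM K L : pdk K -> pdk L -> pdk (fun x y => K x y * L x y).
Proof.
move=> pK pL; elim: pK => [phi bphi|K1 K2 _ h1 _ h2].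
  elim: pL => [psi bpsi|L1 L2 _ h1 _ h2].
    rewrite (_ : (fun x y => _) = (fun x y => (phi x * psi x) * (phi y * psi y))).
      by apply: pdk1; exact: bounded_measurableM.
    by apply/funext => x; apply/funext => y; ring.
  rewrite (_ : (fun x y => _) = (fun x y => (phi x * phi y) * L1 x y + (phi x * phi y) * L2 x y)).
    exact: pdkD.
  by apply/funext => x; apply/funext => y; ring.
rewrite (_ : (fun x y => _) = (fun x y => K1 x y * L x y + K2 x y * L x y)); first exact: pdkD.
by apply/funext => x; apply/funext => y; ring.
Qed.

Lemma pdk_cst (c : R) : 0 <= c -> pdk (fun _ _ => c).
Proof.
move=> c0; rewrite (_ : (fun _ _ => _) = (fun _ _ : R => Num.sqrt c * Num.sqrt c)).
  by apply: (@pdk1 (fun=> Num.sqrt c)); exact: bounded_measurable_cst.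
by apply/funext => x; apply/funext => y; rewrite -expr2 sqr_sqrtr.
Qed.

Lemma pdkX K n : pdk K -> pdk (fun x y => K x y ^+ n).
Proof.
move=> pK; elim: n => [|n ih]; first by rewrite (_ : (fun x y => _) = (fun _ _ => 1)) ?ler01//; exact: pdk_cst.
rewrite (_ : (fun x y => _) = (fun x y => K x y * K x y ^+ n)); first exact: pdkM.
by apply/funext => x; apply/funext => y; rewrite exprS.
Qed.

Definition double_integral K P Q : R :=
  \int[P]_(x in circle) \int[Q]_(y in circle) K x y.

Lemma pdk_regular K : pdk K ->
  [/\ forall x, bounded_measurable (K x), exists C : R, forall x y, `|K x y| <= C &
   forall Q, bounded_measurable (fun x => \int[Q]_(y in circle) K x y)].
Proof.
have mc := @measurable_circle R.
elim=> [phi bphi|K1 K2 _ [m1 [C1 b1] i1] _ [m2 [C2 b2] i2]].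
  have [mphi [C phiC]] := bphi; split.
  - by move=> x; apply: bounded_measurableM => //; exact: bounded_measurable_cst.
  - by exists (C * C) => x y; rewrite normrM ler_pM.
  - move=> Q; rewrite (_ : (fun x => _) = (fun x => phi x * \int[Q]_(y in circle) phi y)).
      by apply: bounded_measurableM => //; exact: bounded_measurable_cst.
    by apply/funext => x; rewrite RintegralZl//; exact: bounded_measurable_integrable.
split.
- by move=> x; exact: bounded_measurableD.
- by exists (C1 + C2) => x y; rewrite (le_trans (ler_normD _ _))// lerD.
- move=> Q; rewrite (_ : (fun x => _) = (fun x => \int[Q]_(y in circle) K1 x y + \int[Q]_(y in circle) K2 x y)).
    exact: bounded_measurableD.
  by apply/funext => x; rewrite RintegralD//; exact: bounded_measurable_integrable.
Qed.

(** For one summand phi x * phi y, with a and b the integrals of phi, this is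
    2 a b <= a^2 + b^2. *)
Lemma pdk_square K P Q : pdk K ->
  2 * double_integral K P Q <= double_integral K P P + double_integral K Q Q.
Proof.
have mc := @measurable_circle R.
elim=> [phi bphi|K1 K2 p1 h1 p2 h2].
  have iphi (S : measR) := bounded_measurable_integrable S bphi.
  have e (S S' : measR) : double_integral (fun x y => phi x * phi y) S S' =
     (\int[S]_(x in circle) phi x) * \int[S']_(y in circle) phi y.
    rewrite /double_integral -RintegralZr//; last exact: iphi.
    by apply: eq_Rintegral => x _; rewrite RintegralZl//; exact: iphi.
  rewrite !e; set a := \int[P]_(x in circle) _; set b := \int[Q]_(x in circle) _.
  by have := sqr_ge0 (a - b); nra.
have [m1 _ i1] := pdk_regular p1; have [m2 _ i2] := pdk_regular p2.
have e (S S' : measR) : double_integral (fun x y => K1 x y + K2 x y) S S' =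
    double_integral K1 S S' + double_integral K2 S S'.
  rewrite /double_integral -RintegralD//; [|exact: bounded_measurable_integrable|exact: bounded_measurable_integrable].
  by apply: eq_Rintegral => x _; rewrite RintegralD//; exact: bounded_measurable_integrable.
by rewrite !e mulrDr addrACA lerD.
Qed.

End positive_kernels.

(** * Positivity of the logarithmic energy *)

Section energy.
Context {R : realType}.
Notation pi := (@pi R).
Notation measR := (probability (measurableTypeR R) R).
Implicit Types (P Q : measR) (x y t : R).

(** cos^2 ((x - y) / 2), as a positive semidefinite kernel. *)
Definition half_angle x y : R := (1 + cos x * cos y + sin x * sin y) * 2^-1.

(** As - ln |sin d| = - ln (1 - cos^2 d) / 2, the logarithmic kernel is the
    series of cos^(2 n) ((x - y) / 2) / (2 n), with positive semidefinite
    terms. *)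
Definition log_kernel_partial n x y : R := log_partial n (half_angle x y) * 2^-1.

Lemma half_angleE x y : half_angle x y = 1 - sin ((x - y) / 2) ^+ 2.
Proof.
have c2 : cos (x - y) = 1 - 2 * sin ((x - y) / 2) ^+ 2.
  rewrite {1}(_ : x - y = ((x - y) / 2) *+ 2) ?cos_mulr2n ?cos2sin2; first by ring.
  by field.
have : cos (x - y) = cos x * cos y + sin x * sin y by rewrite cosB.
by rewrite /half_angle; lra.
Qed.

Lemma half_angle01 x y : 0 <= half_angle x y <= 1.
Proof.
rewrite half_angleE; set s := sin _.
have h : s ^+ 2 <= 1 by rewrite -[s ^+ 2]real_normK ?num_real// expr_le1// sin_max.
by have q := sqr_ge0 s; apply/andP; split; lra.
Qed.

Lemma pdk_log_partial n : pdk (log_kernel_partial n).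
Proof.
have bcos : bounded_measurable (@cos R).
  by split; [apply: continuous_measurable_fun; exact: continuous_cos|exists 1 => x; exact: cos_max].
have bsin : bounded_measurable (@sin R).
  by split; [apply: continuous_measurable_fun; exact: continuous_sin|exists 1 => x; exact: sin_max].
have pha : pdk half_angle.
  apply: (pdkM (K := fun x y : R => 1 + cos x * cos y + sin x * sin y) (L := fun _ _ => 2^-1)).
    apply: pdkD; last exact: pdk1.
    by apply: pdkD; [exact: pdk_cst|exact: pdk1].
  by apply: pdk_cst; rewrite invr_ge0.
apply: (pdkM (K := fun x y : R => log_partial n (half_angle x y)) (L := fun _ _ => 2^-1)); last first.
  by apply: pdk_cst; rewrite invr_ge0.
elim: n => [|n ih].
  rewrite (_ : (fun x y => _) = (fun _ _ => 0)); first exact: pdk_cst.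
  by apply/funext => x; apply/funext => y; rewrite /log_partial big_ord0.
rewrite (_ : (fun x y => _) = (fun x y => log_partial n (half_angle x y) + half_angle x y ^+ n.+1 * n.+1%:R^-1)).
  apply: pdkD => //; apply: pdkM; first exact: pdkX.
  by apply: pdk_cst; rewrite invr_ge0.
by apply/funext => x; apply/funext => y; rewrite /log_partial big_ord_recr.
Qed.

Lemma log_kernel_partial_ge0 n x y : 0 <= log_kernel_partial n x y.
Proof.
by rewrite mulr_ge0 ?invr_ge0// log_partial_ge0//; have /andP[] := half_angle01 x y.
Qed.

Lemma half_angle_lt1 x y : sin ((x - y) / 2) != 0 -> 0 <= half_angle x y < 1.
Proof.
move=> s0; have /andP[-> _] := half_angle01 x y.
by rewrite half_angleE ltrBlDr ltrDl exprn_even_gt0.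
Qed.

Lemma logker_half_angle x y : - ln (1 - half_angle x y) * 2^-1 = logker (x - y).
Proof. by rewrite logkerE half_angleE subKr mulNr. Qed.

Lemma log_kernel_partial_le n x y : sin ((x - y) / 2) != 0 ->
  log_kernel_partial n x y <= logker (x - y).
Proof.
move=> s0; rewrite -logker_half_angle /log_kernel_partial ler_wpM2r ?invr_ge0//.
by have /andP[] := log_partial_remainder n (half_angle_lt1 s0); lra.
Qed.

Lemma log_kernel_partial_cvg x y : sin ((x - y) / 2) != 0 ->
  log_kernel_partial n x y @[n --> \oo] --> logker (x - y).
Proof.
move=> s0; rewrite -logker_half_angle; apply: cvgM; last exact: cvg_cst.
exact: log_partial_cvg (half_angle_lt1 s0).
Qed.

Lemma lne_logker x y : sin ((x - y) / 2) != 0 ->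
  (- lne (`|sin ((x - y) / 2)|%:E) = (logker (x - y))%:E)%E.
Proof. by move=> s0; rewrite lne_EFin ?normr_gt0// EFinN. Qed.

Lemma log_kernel_partial_lne n x y :
  ((log_kernel_partial n x y)%:E <= - lne (`|sin ((x - y) / 2)|%:E))%E.
Proof.
have [s0|s0] := eqVneq (sin ((x - y) / 2)) 0.
  by rewrite s0 normr0 le0_lneNy// leey.
by rewrite lne_logker// lee_fin log_kernel_partial_le.
Qed.

Lemma sin_half_neq0 x y : circle x -> circle y -> y <> x -> sin ((x - y) / 2) != 0.
Proof.
rewrite !circleE => /andP[x1 x2] /andP[y1 y2] /eqP yx.
have h a b : - pi <= b -> b < a -> a < pi -> sin ((a - b) / 2) != 0.
  move=> b1 ba a2; rewrite gt_eqF// sin_gt0_pi//; apply/andP; split; lra.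
have [lt|lt|e] := ltgtP x y.
- by rewrite -oppr_eq0 -sinN -mulNr opprB h.
- exact: h.
- by rewrite e eqxx in yx.
Qed.

Lemma log_energy_ge0 P : (0 <= log_energy P)%E.
Proof.
apply: integral_ge0 => x _; apply: integral_ge0 => y _.
by rewrite leeNr oppe0 lne_le0 lee_fin sin_max.
Qed.

Variables (Q : measR) (C : R).
Hypothesis Qneq : forall x, {ae Q, forall y : R, y <> x}.
Hypothesis Qint : forall x, circle x -> Q.-integrable circle (EFin \o (fun y => logker (x - y))).
Definition potential x : R := \int[Q]_(y in circle) logker (x - y).
Hypothesis QC : forall x, circle x -> potential x <= C.
Hypothesis mQ : measurable_fun circle potential.

Lemma potential_ge0 x : 0 <= potential x.
Proof. by apply: Rintegral_ge0 => y _; exact: logker_ge0. Qed.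

Lemma potential_integrable P : P.-integrable circle (EFin \o potential).
Proof.
have mc := @measurable_circle R.
apply: (measurable_bounded_integrable mc) => //.
- by rewrite (le_lt_trans (probability_le1 P mc))// ltry.
- exists C; split; first exact: num_real.
  move=> y Cy x cx; have h : `|potential x| <= y; last exact: h.
  by rewrite ger0_norm ?potential_ge0// (le_trans (QC cx))// ltW.
Qed.

Lemma partial_potential_le n x : circle x ->
  0 <= \int[Q]_(y in circle) log_kernel_partial n x y <= potential x.
Proof.
move=> cx; have mc := @measurable_circle R; apply/andP; split.
  by apply: Rintegral_ge0 => y _; exact: log_kernel_partial_ge0.
have [m _ _] := pdk_regular (pdk_log_partial n).
have i1 := bounded_measurable_integrable Q (m x).
rewrite -lee_fin !EFin_Rintegral//; last exact: Qint.
apply: ae_le_integral_any; apply: (aePS (Qneq x)) => y yx cy.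
by rewrite lee_fin log_kernel_partial_le// sin_half_neq0.
Qed.

Lemma partial_potential_cvg x : circle x ->
  \int[Q]_(y in circle) log_kernel_partial n x y @[n --> \oo] --> potential x.
Proof.
move=> cx; have mc := @measurable_circle R.
apply: (Rdominated_cvg mc _ _ _ (Qint cx) _).2.
- by move=> n; have [m _ _] := pdk_regular (pdk_log_partial n); have [+ _] := m x; exact: measurable_funTS.
- exact: (integrable_EFin_measurable (Qint cx)).
- apply: (aePS (Qneq x)) => y yx cy; exact/log_kernel_partial_cvg/sin_half_neq0.
- apply: (aePS (Qneq x)) => y yx cy n; rewrite ger0_norm ?log_kernel_partial_ge0//.
  exact/log_kernel_partial_le/sin_half_neq0.
Qed.

Lemma cross_energy_cvg P : double_integral (log_kernel_partial n) P Q @[n --> \oo] -->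
  \int[P]_(x in circle) potential x.
Proof.
have mc := @measurable_circle R.
apply: (Rdominated_cvg mc _ mQ _ (potential_integrable P) _).2.
- by move=> n; have [_ _ m] := pdk_regular (pdk_log_partial n); have [+ _] := m Q; exact: measurable_funTS.
- by apply: aeW => x cx; exact: partial_potential_cvg.
- by apply: aeW => x cx n; have /andP[h1 h2] := partial_potential_le n cx; rewrite ger0_norm.
Qed.

Lemma log_energy_partial n P :
  ((double_integral (log_kernel_partial n) P P)%:E <= log_energy P)%E.
Proof.
have mc := @measurable_circle R.
have [m _ mi] := pdk_regular (pdk_log_partial n).
rewrite /double_integral EFin_Rintegral//; last exact: bounded_measurable_integrable.
apply: ae_le_integral_any; apply: aeW => x _.
rewrite EFin_Rintegral//; last exact: bounded_measurable_integrable.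
by apply: ae_le_integral_any; apply: aeW => y _; exact: log_kernel_partial_lne.
Qed.

Lemma log_energy_density : log_energy Q = (\int[Q]_(x in circle) potential x)%:E.
Proof.
have mc := @measurable_circle R.
rewrite EFin_Rintegral//; last exact: potential_integrable.
apply: ae_eq_integral_any; apply: aeW => x cx.
rewrite EFin_Rintegral//; last exact: Qint.
apply: ae_eq_integral_any; apply: (aePS (Qneq x)) => y yx cy.
by rewrite lne_logker// sin_half_neq0.
Qed.

(** The energy of the signed measure P - Q is nonnegative: the inequality holds
    for the truncated series, which lies below the logarithmic kernel, and the
    cross term passes to the limit because the potential of Q is bounded. *)
Lemma log_energy_cross P :
  ((2 * \int[P]_(x in circle) potential x - \int[Q]_(x in circle) potential x)%:E <= log_energy P)%E.
Proof.
have mc := @measurable_circle R.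
have := log_energy_ge0 P; case E : (log_energy P) => [e| |]; [|by move=> _; exact: leey|by rewrite leeNy_eq].
move=> _; rewrite lee_fin lerBlDr.
have h n : 2 * double_integral (log_kernel_partial n) P Q <= e + \int[Q]_(x in circle) potential x.
  apply: (le_trans (pdk_square P Q (pdk_log_partial n))); apply: lerD.
    by rewrite -lee_fin -E; exact: log_energy_partial.
  have [_ _ mi] := pdk_regular (pdk_log_partial n).
  apply: (le_Rintegral mc (bounded_measurable_integrable Q (mi Q)) (potential_integrable Q)).
  by move=> x cx; have /andP[] := partial_potential_le n cx.
have h2 : 2 * double_integral (log_kernel_partial n) P Q @[n --> \oo] --> 2 * \int[P]_(x in circle) potential x.
  by apply: cvgM; [exact: cvg_cst|exact: cross_energy_cvg].
rewrite -(cvg_lim (@Rhausdorff R) h2); apply: limr_le; first by apply/cvg_ex; eexists; exact: h2.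
exact: nearW.
Qed.

End energy.

(** * The Gibbs variational principle with Hellinger remainder *)

Section entropy.
Context {R : realType}.
Notation measR := (probability (measurableTypeR R) R).
Variables (G P : measR) (L : R -> R) (B : R).
Hypothesis cP : P circle = 1%E.
Hypotheses (mL : measurable_fun circle L) (LB : forall x, circle x -> `|L x| <= B).
Hypothesis L1 : (\int[G]_(x in circle) (expR (L x))%:E = 1)%E.
Hypothesis PG : P `<< G.

Let mc := @measurable_circle R.
Let f x : R := fine (Radon_Nikodym_SigmaFinite.f P G x).

Lemma RNfE x : Radon_Nikodym_SigmaFinite.f P G x = (f x)%:E.
Proof. by rewrite /f fineK//; exact: Radon_Nikodym_SigmaFinite.f_fin_num. Qed.

Lemma RNf_ge0 x : 0 <= f x.
Proof. by rewrite -lee_fin -RNfE; exact: Radon_Nikodym_SigmaFinite.f_ge0. Qed.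

Lemma RNf_integrable : G.-integrable setT (EFin \o f).
Proof.
have h := Radon_Nikodym_SigmaFinite.f_integrable PG.
by apply: eq_integrable h => // x _; rewrite RNfE.
Qed.

Lemma RNf_integral A : measurable A -> P A = (\int[G]_(x in A) (f x)%:E)%E.
Proof.
move=> mA; rewrite (Radon_Nikodym_SigmaFinite.f_integral PG mA).
by apply: eq_integral => x _; rewrite RNfE.
Qed.

Lemma RNf_integrable_circle : G.-integrable circle (EFin \o f).
Proof. exact: (integrableS measurableT mc (@subsetT _ _) RNf_integrable). Qed.

Lemma probability_bounded_integrable (S : measR) (k : R -> R) (K : R) : measurable_fun circle k ->
  (forall x, circle x -> `|k x| <= K) -> S.-integrable circle (EFin \o k).
Proof.
move=> mk kK; apply: (measurable_bounded_integrable mc) => //.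
- by rewrite (le_lt_trans (probability_le1 S mc))// ltry.
- exists K; split; first exact: num_real.
  by move=> y Cy x cx; exact: (le_trans (kK x cx) (ltW Cy)).
Qed.

Lemma expL_integrable : G.-integrable circle (EFin \o (fun x => expR (L x))).
Proof.
apply: (@probability_bounded_integrable _ _ (expR B)).
  by apply: measurableT_comp mL; exact: measurable_expR.
by move=> x cx; rewrite ger0_norm ?expR_ge0// ler_expR (le_trans (ler_norm _))// LB.
Qed.

Let h x : R := expR ((L x - ln (f x)) / 2).
Let root_f x : R := Num.sqrt (f x).
Let root_L x : R := expR (L x / 2).

(** Where f vanishes both sides are 0, whatever the value of ln 0. *)
Lemma hellinger_weight x : h x * f x = root_L x * root_f x.
Proof.
have f0 := RNf_ge0 x; rewrite /h /root_L /root_f.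
have [->|fn] := eqVneq (f x) 0; first by rewrite sqrtr0 !mulr0.
have fp : 0 < f x by rewrite lt_neqAle eq_sym fn.
have e : f x = expR (ln (f x) / 2) ^+ 2.
  by rewrite -expRM_natl -mulr_natl mulrC divfK ?pnatr_eq0// lnK.
rewrite mulrBl expRB {2 3}e sqrtr_sqr ger0_norm ?expR_ge0// expr2 mulrA divfK//.
by rewrite gt_eqF ?expR_gt0.
Qed.

Lemma root_L_sqr x : root_L x ^+ 2 = expR (L x).
Proof. by rewrite /root_L -expRM_natl -mulr_natl mulrC divfK// pnatr_eq0. Qed.

Lemma measurable_f : measurable_fun circle f.
Proof. exact: (integrable_EFin_measurable RNf_integrable_circle). Qed.

Lemma measurable_h : measurable_fun circle h.
Proof.
apply: measurableT_comp; first exact: measurable_expR.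
apply: measurable_funM => //; apply: measurable_funB => //.
by apply: measurableT_comp measurable_f; exact: measurable_ln.
Qed.

Let gap x : R := (root_f x - root_L x) ^+ 2.

Lemma gapE x : gap x = f x + expR (L x) - 2 * (h x * f x).
Proof.
rewrite hellinger_weight -root_L_sqr -{1}(sqr_sqrtr (RNf_ge0 x)) /gap.
by rewrite -/(root_f x); ring.
Qed.

Lemma hf_integrable : G.-integrable circle (EFin \o (fun x => h x * f x)).
Proof.
apply: (le_integrable_EFin (g := fun x => f x + expR (L x)) mc).
- by apply: measurable_funM; [exact: measurable_h|exact: measurable_f].
- move=> x _; have := gapE x; have g0 : 0 <= gap x by exact: sqr_ge0.
  have h0 : 0 <= h x * f x by rewrite mulr_ge0 ?expR_ge0 ?RNf_ge0.
  by rewrite ger0_norm//; lra.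
- by apply: integrableEFinD => //; [exact: RNf_integrable_circle|exact: expL_integrable].
Qed.

Lemma h_integral : (\int[P]_(x in circle) (h x)%:E = \int[G]_(x in circle) (h x * f x)%:E)%E.
Proof.
rewrite -(Radon_Nikodym_SigmaFinite.change_of_variables PG)//.
- by apply: eq_integral => x _; rewrite RNfE EFinM.
- by move=> x; rewrite lee_fin expR_ge0.
- by apply/measurable_EFinP; exact: measurable_h.
Qed.

Lemma h_integrable : P.-integrable circle (EFin \o h).
Proof.
apply/integrableP; split; first by apply/measurable_EFinP; exact: measurable_h.
have -> : (\int[P]_(x in circle) `|(EFin \o h) x| = \int[P]_(x in circle) (h x)%:E)%E.
  by apply: eq_integral => x _ /=; rewrite ger0_norm// expR_ge0.
by rewrite h_integral -EFin_Rintegral ?ltry//; exact: hf_integrable.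
Qed.

Definition hellinger_gap : R := \int[G]_(x in circle) gap x.

Lemma hellinger_gap_ge0 : 0 <= hellinger_gap.
Proof. by apply: Rintegral_ge0 => x _; exact: sqr_ge0. Qed.

Lemma gap_integrable : G.-integrable circle (EFin \o gap).
Proof.
apply: (eq_integrable_EFin (f := fun x => f x + expR (L x) - 2 * (h x * f x)) mc); last first.
  by move=> x _; rewrite gapE.
apply: integrableEFinB => //; last by apply: integrableEFinZ => //; exact: hf_integrable.
by apply: integrableEFinD => //; [exact: RNf_integrable_circle|exact: expL_integrable].
Qed.

Lemma hellinger_gapE : hellinger_gap = 2 - 2 * \int[P]_(x in circle) h x.
Proof.
have i1 := RNf_integrable_circle; have i2 := expL_integrable; have i3 := hf_integrable.
rewrite /hellinger_gap; under eq_Rintegral do rewrite gapE.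
rewrite RintegralB//; [|exact: integrableEFinD|exact: integrableEFinZ].
rewrite RintegralD// RintegralZl//.
have -> : \int[G]_(x in circle) f x = 1 by rewrite /Rintegral -RNf_integral// cP.
have -> : \int[G]_(x in circle) expR (L x) = 1 by rewrite /Rintegral L1.
by rewrite [in RHS]/Rintegral h_integral.
Qed.

Lemma RN_ae : {ae P, forall x : R, circle x ->
  Radon_Nikodym (charge_of_finite_measure P) G x = (f x)%:E}.
Proof.
have h1 := ae_eq_Radon_Nikodym_SigmaFinite PG mc.
apply: (aePS (null_dominates_ae_eq mc PG h1)) => x e cx.
by rewrite -e// RNfE.
Qed.

Lemma RN_pos_ae : {ae P, forall x : R, circle x -> 0 < f x}.
Proof.
have mZ : measurable (circle `&` (f @^-1` [set 0])) by exact: measurable_f mc _ (measurable_set1 0).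
exists (circle `&` (f @^-1` [set 0])); split => //.
- rewrite RNf_integral//; apply: integral0_eq => x [_ /= ->] //.
- move=> x /= /not_implyP[cx fx]; split => //=.
  by apply/eqP; rewrite eq_le RNf_ge0 andbT leNgt; apply/negP.
Qed.

(** With h = exp ((L - ln f) / 2) the inequality exp z >= 1 + z gives
    ln f - L >= 2 (1 - h) almost everywhere for P, and the integral of the
    right-hand side is the squared Hellinger distance between P and
    exp L * G. The remainder therefore detects equality. *)
Lemma entropy_gap : ((\int[P]_(x in circle) L x + hellinger_gap)%:E <=
  \int[P]_(x in circle) lne (Radon_Nikodym (charge_of_finite_measure P) G x))%E.
Proof.
have iL : P.-integrable circle (EFin \o L) by exact: probability_bounded_integrable LB.
have ih := h_integrable.
have i1 : P.-integrable circle (EFin \o (fun=> 1 : R)).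
  by apply: (@probability_bounded_integrable _ _ 1) => // x _; rewrite normr1.
have iB : P.-integrable circle (EFin \o (fun x => 2 * (1 - h x))).
  by apply: integrableEFinZ => //; exact: integrableEFinB.
have e : \int[P]_(x in circle) L x + hellinger_gap = \int[P]_(x in circle) (L x + 2 * (1 - h x)).
  rewrite RintegralD// RintegralZl//; last exact: integrableEFinB.
  rewrite RintegralB// hellinger_gapE.
  have -> : \int[P]_(x in circle) 1 = 1 :> R.
    by transitivity (1 * fine (P circle)); [exact: Rintegral_cst|rewrite cP mul1r].
  by ring.
rewrite e EFin_Rintegral//; last exact: integrableEFinD.
apply: ae_le_integral_any.
have h3 : {ae P, forall x : R, circle x -> Radon_Nikodym (charge_of_finite_measure P) G x = (f x)%:E /\ 0 < f x}.
  have := @filterS2 _ _ (ae_filter_ringOfSetsType P) _ _ _ _ RN_ae RN_pos_ae; apply => x a b cx.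
  by split; [exact: a|exact: b].
apply: (aePS h3) => x k cx; have [-> fx] := k cx.
rewrite lne_EFin// lee_fin /h.
have := expR_ge1Dx ((L x - ln (f x)) / 2); lra.
Qed.

Lemma hellinger_gap0 : hellinger_gap = 0 -> forall A, measurable A ->
  P A = (\int[G]_(x in A `&` circle) (expR (L x))%:E)%E.
Proof.
move=> g0 A mA.
have e : ae_eq G circle (EFin \o gap) (cst 0%E).
  apply/(ae_eq_integral_abs G mc ((measurable_EFinP _ _).2 (integrable_EFin_measurable gap_integrable))).
  transitivity (\int[G]_(x in circle) (gap x)%:E)%E.
    by apply: eq_integral => x _ /=; rewrite ger0_norm// sqr_ge0.
  by rewrite -EFin_Rintegral ?[X in X%:E]g0//; exact: gap_integrable.
have PA : P A = P (A `&` circle).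
  have mAD : measurable (A `\` circle) by exact: measurableD.
  have nul : P (A `\` circle) = 0%E.
    have le_c : (P (A `\` circle) <= P (~` circle))%E.
      by apply: (@le_measure _ _ _ P); rewrite ?inE//; try exact: measurableC; move=> x [].
    apply/eqP; rewrite eq_le measure_ge0 andbT; apply: (le_trans le_c).
    by rewrite probability_setC// cP subee.
  have s := measureDI P mA mc.
  transitivity (P (A `\` circle) + P (A `&` circle))%E; first exact: s.
  by rewrite -[RHS]add0e; congr (_ + _)%E; exact: nul.
rewrite PA RNf_integral//; last exact: measurableI.
apply: ae_eq_integral_any; apply: (aePS e) => x k [_ cx].
have /eqP := k cx; rewrite eqe sqrf_eq0 subr_eq0 => /eqP r.
by rewrite -root_L_sqr -r sqr_sqrtr// RNf_ge0.
Qed.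

End entropy.

(** * The equilibrium measure *)

Section equilibrium.
Context {R : realType}.
Notation lam := (@lebesgue_measure R).
Notation pi := (@pi R).
Notation measR := (probability (measurableTypeR R) R).
Notation integ f := (lam.-integrable circle (EFin \o f)).
Notation I f := (\int[lam]_(x in circle) f x).
Notation C0 := (@logker_mass R).

Section consequences.
Variables (P : measR) (r : R -> R).
Hypotheses (mr : measurable_fun circle r) (r0 : forall x, circle x -> 0 <= r x).
Hypothesis Pr : has_density P r.

Let mc := @measurable_circle R.

Lemma has_density_dominates : P `<< lam.
Proof. exact: (@density_dominates _ (measurableTypeR R) R lam P circle r mc mr Pr). Qed.

Lemma has_density_Rintegral (f : R -> R) : measurable_fun circle f ->
  (\int[P]_(x in circle) (f x)%:E = \int[lam]_(x in circle) (f x * r x)%:E)%E.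
Proof. by move=> mf; exact: (@density_Rintegral _ (measurableTypeR R) R lam P circle r mc mr r0 Pr f mf). Qed.

Lemma has_density_neq x : {ae P, forall y : R, y <> x}.
Proof.
exists [set x]; split; first exact: measurable_set1.
  have /null_content_dominatesP := has_density_dominates; apply; first exact: measurable_set1.
  exact: lebesgue_measure_set1.
by move=> y /= /contrapT.
Qed.

Lemma has_density_ae (f g : R -> R) : {ae lam, forall x, circle x -> f x = g x} ->
  {ae P, forall x : R, circle x -> f x = g x}.
Proof. by move=> fg; exact: (null_dominates_ae_eq mc has_density_dominates fg). Qed.

Lemma has_density_expectation (f f' : R -> R) : {ae lam, forall x, circle x -> f x = f' x} ->
  measurable_fun circle f' -> \int[P]_(x in circle) f x = I (fun x => f' x * r x).
Proof.
move=> ff mf'; rewrite (ae_eq_Rintegral (has_density_ae ff)).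
by rewrite /Rintegral has_density_Rintegral.
Qed.

Lemma density_measurable : measurable_fun circle (density P).
Proof.
have h := Radon_Nikodym_integrable (nu := charge_of_finite_measure P) has_density_dominates.
have [h2 _] := fine_integrable mc (integrableS measurableT mc (@subsetT _ _) h).
exact: (integrable_EFin_measurable h2).
Qed.

Lemma density_ae : {ae lam, forall x, circle x -> density P x = r x}.
Proof.
have h1 := @density_RN _ (measurableTypeR R) R lam P circle r mc mr Pr.
have h2 := ae_eq_Radon_Nikodym_SigmaFinite has_density_dominates mc.
by apply: (aeS2 h1 h2) => x e1 e2 cx; rewrite /density -e2// e1.
Qed.

End consequences.

(** rho solves the Euler-Lagrange equation of the free energy, with multiplier
    e. *)
Variables (V rho : R -> R) (bt M e : R).
Hypotheses (mV : measurable_fun circle V) (bt0 : 0 < bt).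
Hypothesis hV1 : (\int[lam]_(x in circle) (expR (- V x) / (2 * pi))%:E = 1)%E.
Hypothesis mrho : measurable_fun circle rho.
Hypothesis rho_gt0 : forall x, 0 < rho x.
Hypothesis rhoM : forall x, rho x <= M.
Hypothesis Irho : I rho = 1.
Hypothesis rhoE : forall x, circle x -> ln (rho x) = - V x - 2 * bt * log_potential rho x + e.

Let mc := @measurable_circle R.

Definition gibbs_density x : R := expR (- V x) / (2 * pi).

Let p2 : 0 < 2 * pi. Proof. by rewrite mulr_gt0// pi_gt0. Qed.

Lemma measurable_gibbs_density : measurable_fun circle gibbs_density.
Proof.
apply: measurable_funM => //; apply: measurableT_comp; first exact: measurable_expR.
exact: measurableT_comp mV.
Qed.

Lemma gibbs_density_ge0 x : 0 <= gibbs_density x.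
Proof. by rewrite divr_ge0 ?expR_ge0// ltW. Qed.

Lemma gibbs_has_density : has_density (gibbs V) gibbs_density.
Proof.
have [P hP] := has_density_exists measurable_gibbs_density (fun x _ => gibbs_density_ge0 x) hV1.
exact: (getPex (ex_intro _ P hP : exists P, [set P : measR | forall A, measurable A ->
         P A = (\int[lam]_(x in A `&` circle) (expR (- V x) / (2 * pi))%:E)%E] P)).
Qed.

Lemma has_density_circle (P : measR) (r : R -> R) : has_density P r ->
  (\int[lam]_(x in circle) (r x)%:E = 1)%E -> P circle = 1%E.
Proof. by move=> Pr r1; rewrite Pr// setIid. Qed.

Lemma rho_integral1 : (\int[lam]_(x in circle) (rho x)%:E = 1)%E.
Proof.
rewrite -EFin_Rintegral ?Irho//; apply: (@circle_bounded_integrable _ _ M) => // x _.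
by rewrite gtr0_norm.
Qed.

Let rho_ge0 x : circle x -> 0 <= rho x. Proof. by rewrite ltW. Qed.

Section with_density.
Variable Q : measR.
Hypothesis Qrho : has_density Q rho.

Let cQ : Q circle = 1%E.
Proof. exact: has_density_circle Qrho rho_integral1. Qed.

Lemma Q_potential x : potential Q x = log_potential rho x.
Proof.
rewrite /potential /Rintegral (has_density_Rintegral mrho rho_ge0 Qrho)//.
apply: measurable_funTS; apply: measurableT_comp; first exact: measurable_logker.
by apply: measurable_funB => //; exact: measurable_id.
Qed.

Lemma Q_integrable x : circle x -> Q.-integrable circle (EFin \o (fun y => logker (x - y))).
Proof.
move=> cx.
have ml : measurable_fun circle (fun y => logker (x - y)).
  apply: measurable_funTS; apply: measurableT_comp; first exact: measurable_logker.
  by apply: measurable_funB => //; exact: measurable_id.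
apply/integrableP; split; first exact/measurable_EFinP.
have -> : (\int[Q]_(y in circle) `|(EFin \o (fun y => logker (x - y))) y| =
    \int[Q]_(y in circle) (logker (x - y))%:E)%E.
  by apply: eq_integral => y _ /=; rewrite ger0_norm// logker_ge0.
rewrite (has_density_Rintegral mrho rho_ge0 Qrho)// -EFin_Rintegral ?ltry//.
by apply: (integ_potential_bounded (B := M)) => // y _; rewrite gtr0_norm.
Qed.

Lemma Q_potential_le x : circle x -> potential Q x <= M * C0.
Proof.
move=> cx; rewrite Q_potential (le_trans (ler_norm _))//.
by apply: log_potential_bound => // y _; rewrite gtr0_norm.
Qed.

Lemma Q_potential_measurable : measurable_fun circle (potential Q).
Proof.
have -> : potential Q = log_potential rho by apply/funext => x; exact: Q_potential.
by apply: (measurable_log_potential (B := M)) => // x _; rewrite gtr0_norm.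
Qed.

Let energy_cross := log_energy_cross (has_density_neq mrho Qrho) Q_integrable Q_potential_le Q_potential_measurable.
Let energy_Q := log_energy_density (has_density_neq mrho Qrho) Q_integrable Q_potential_le Q_potential_measurable.
Let potential_int := potential_integrable Q_potential_le Q_potential_measurable.

Let c := e + ln (2 * pi).
Let L x : R := - (2 * bt) * potential Q x + c.

Lemma relative_density x : circle x -> expR (L x) * gibbs_density x = rho x.
Proof.
move=> cx; rewrite -[RHS]lnK ?posrE// rhoE// /L /c Q_potential /gibbs_density.
rewrite (_ : _ - _ + e = (- (2 * bt) * log_potential rho x + e) + - V x); last by ring.
rewrite addrA !expRD lnK ?posrE//; move: (2 * pi) (lt0r_neq0 p2) => q qn.
by field.
Qed.

Let mL : measurable_fun circle L.
Proof.
apply: measurable_funD => //; apply: measurable_funM => //.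
exact: Q_potential_measurable.
Qed.

Let BL := 2 * bt * (M * C0) + `|c|.

Let LB x : circle x -> `|L x| <= BL.
Proof.
move=> cx; rewrite /L (le_trans (ler_normD _ _))// lerD// normrM normrN.
rewrite (ger0_norm (_ : 0 <= 2 * bt)) ?mulr_ge0 ?(ltW bt0)//.
rewrite ler_wpM2l ?mulr_ge0 ?(ltW bt0)// ger0_norm ?potential_ge0//.
exact: Q_potential_le.
Qed.

Let G_integral (A : set (measurableTypeR R)) : measurable A ->
  (\int[gibbs V]_(x in A `&` circle) (expR (L x))%:E = \int[lam]_(x in A `&` circle) (rho x)%:E)%E.
Proof.
move=> mA.
have mAc : measurable (A `&` circle) by exact: measurableI.
have h := @density_ge0_integral _ (measurableTypeR R) R lam (gibbs V) circle gibbs_density mc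
  measurable_gibbs_density gibbs_has_density (A `&` circle) (fun x => (expR (L x))%:E) mAc
  (@subIsetr _ _ _).
rewrite h.
- by apply: eq_integral => x /set_mem[_ cx]; rewrite -EFinM relative_density.
- by move=> x; rewrite lee_fin expR_ge0.
- apply/measurable_EFinP; apply: measurable_funS (@subIsetr _ _ _) _ => //.
  by apply: measurableT_comp mL; exact: measurable_expR.
Qed.

Let L1 : (\int[gibbs V]_(x in circle) (expR (L x))%:E = 1)%E.
Proof.
rewrite -rho_integral1; have := @G_integral setT measurableT.
by rewrite setTI.
Qed.

Let Q_gibbs (A : set (measurableTypeR R)) : measurable A ->
  Q A = (\int[gibbs V]_(x in A `&` circle) (expR (L x))%:E)%E.
Proof. by move=> mA; rewrite G_integral// Qrho. Qed.

Let mexpL : measurable_fun circle (fun x => expR (L x)).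
Proof. by apply: measurableT_comp mL; exact: measurable_expR. Qed.

Let L_expectation (P : measR) : P circle = 1%E ->
  \int[P]_(x in circle) L x = - (2 * bt) * \int[P]_(x in circle) potential Q x + c.
Proof.
move=> cP; have ip := potential_int P.
have ic : P.-integrable circle (EFin \o (fun=> c)).
  by apply: (@probability_bounded_integrable _ _ _ `|c|).
rewrite RintegralD//; last exact: integrableEFinZ.
rewrite RintegralZl//; congr (_ + _).
by transitivity (c * fine (P circle)); [exact: Rintegral_cst|rewrite cP mulr1].
Qed.

Let X (P : measR) : R := \int[P]_(x in circle) potential Q x.

Lemma free_energy_density : free_energy V bt Q = (c - bt * X Q)%:E.
Proof.
have QG := @density_dominates _ (measurableTypeR R) R (gibbs V) Q circle _ mc mexpL Q_gibbs.
have h1 := @density_RN _ (measurableTypeR R) R (gibbs V) Q circle _ mc mexpL Q_gibbs.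
have h2 := RN_ae QG.
have h3 : {ae Q, forall x : R, circle x ->
    Radon_Nikodym_SigmaFinite.f Q (gibbs V) x = (expR (L x))%:E}.
  exact: (null_dominates_ae_eq mc QG h1).
rewrite /free_energy energy_Q /relative_entropy asboolT//.
have -> : (\int[Q]_(x in circle) lne (Radon_Nikodym (charge_of_finite_measure Q) (gibbs V) x) =
    \int[Q]_(x in circle) (L x)%:E)%E.
  apply: ae_eq_integral_any.
  have := @filterS2 _ _ (ae_filter_ringOfSetsType Q) _ _ _ _ h2 h3; apply => x a b cx.
  by rewrite a// -(RNfE QG) b// lne_EFin ?expR_gt0// expRK.
rewrite -EFin_Rintegral//; last exact: probability_bounded_integrable LB.
rewrite (L_expectation cQ) -/(X Q) -EFinM -EFinD; congr (_%:E); ring.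
Qed.

(** The bounds log_energy_cross and entropy_gap are both affine in P through
    the integral of the potential of Q, and these two terms cancel. *)
Lemma free_energy_lower (P : measR) : P circle = 1%E -> P `<< gibbs V ->
  ((c - bt * X Q + hellinger_gap (gibbs V) P L)%:E <= free_energy V bt P)%E.
Proof.
move=> cP PG; rewrite /free_energy /relative_entropy asboolT//.
have h1 := energy_cross P; have h2 := entropy_gap cP mL LB L1 PG.
rewrite (L_expectation cP) in h2.
have -> : c - bt * X Q + hellinger_gap (gibbs V) P L =
   bt * (2 * X P - X Q) + (- (2 * bt) * X P + c + hellinger_gap (gibbs V) P L) by ring.
rewrite EFinD EFinM; apply: leeD; last exact: h2.
by rewrite lee_pmul2l// lte_fin.
Qed.

Lemma free_energy_singular (P : measR) : ~ (P `<< gibbs V) -> free_energy V bt P = +oo%E.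
Proof.
move=> PG; rewrite /free_energy /relative_entropy asboolF// addey//.
by rewrite gt_eqF// (lt_le_trans _ (mule_ge0 _ (log_energy_ge0 P)))// lee_fin ltW.
Qed.

Lemma density_is_minimizer : is_minimizer V bt Q.
Proof.
split => // P cP; have [PG|PG] := pselect (P `<< gibbs V); last by rewrite (free_energy_singular PG); exact: leey.
apply: le_trans (free_energy_lower cP PG); rewrite free_energy_density lee_fin lerDl.
exact: hellinger_gap_ge0.
Qed.

Lemma minimizer_density (P : measR) : is_minimizer V bt P -> has_density P rho.
Proof.
move=> [cP /(_ Q cQ)]; rewrite free_energy_density => PQ.
have PG : P `<< gibbs V.
  by apply: contrapT => PG; move: PQ; rewrite free_energy_singular.
have := le_trans (free_energy_lower cP PG) PQ; rewrite lee_fin gerDl => g0.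
have g1 : hellinger_gap (gibbs V) P L = 0.
  by apply/eqP; rewrite eq_le g0 hellinger_gap_ge0.
by move=> A mA; rewrite (hellinger_gap0 cP mL LB PG g1 mA) G_integral.
Qed.

End with_density.

(** A minimizer exists, namely the measure with density rho, and by the
    Hellinger remainder every minimizer has this density. *)
Lemma equilibrium_density : has_density (equilibrium V bt) rho.
Proof.
have [Q Qrho] := has_density_exists mrho rho_ge0 rho_integral1.
apply: (minimizer_density Qrho).
exact: (getPex (ex_intro _ Q (density_is_minimizer Qrho) : exists P, [set mu | is_minimizer V bt mu] P)).
Qed.

End equilibrium.

(** * Variance estimates and the limit *)

Section variance_estimates.
Context {R : realType}.
Notation lam := (@lebesgue_measure R).
Notation pi := (@pi R).
Notation integ f := (lam.-integrable circle (EFin \o f)).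
Notation I f := (\int[lam]_(x in circle) f x).
Notation C0 := (@logker_mass R).
Notation "f =ae g" := ({ae lam, forall x, circle x -> f x = g x})
  (at level 70, only parsing).

Lemma I_variance (F r : R -> R) (B K : R) : measurable_fun circle F ->
  (forall x, circle x -> `|F x| <= B) -> measurable_fun circle r ->
  (forall x, circle x -> `|r x| <= K) -> I r = 1 ->
  I (fun x => centered r F x ^+ 2 * r x) =
  I (fun x => F x ^+ 2 * r x) - I (fun x => F x * r x) ^+ 2.
Proof.
move=> mF FB mr rK Ir; have mc := @measurable_circle R.
have ir : integ r by exact: circle_bounded_integrable mr rK.
have i1 : integ (fun x => F x * r x).
  by apply: (eq_integrable_EFin mc (integrableM_bounded mc ir mF FB)) => x _; rewrite mulrC.
have i2 : integ (fun x => F x ^+ 2 * r x).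
  by apply: (eq_integrable_EFin mc (integrableM_bounded mc i1 mF FB)) => x _; ring.
set a := I (fun x => F x * r x).
rewrite (@eq_I _ _ (fun x => F x ^+ 2 * r x - 2 * a * (F x * r x) + a ^+ 2 * r x)); last first.
  by move=> x _; rewrite /centered -/a; ring.
rewrite RintegralD//; [|by apply: integrableEFinB => //; exact: integrableEFinZ|exact: integrableEFinZ].
rewrite RintegralB//; last exact: integrableEFinZ.
by rewrite !RintegralZl// Ir -/a; ring.
Qed.

Lemma I_weight_diff (F r s : R -> R) (B K d : R) : measurable_fun circle F ->
  (forall x, circle x -> `|F x| <= B) ->
  measurable_fun circle r -> measurable_fun circle s ->
  (forall x, circle x -> `|r x| <= K) -> (forall x, circle x -> `|s x| <= K) ->
  (forall x, circle x -> `|r x - s x| <= d) ->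
  `|I (fun x => F x * r x) - I (fun x => F x * s x)| <= 8 * (B * d).
Proof.
move=> mF FB mr ms rK sK rs; have mc := @measurable_circle R.
have i (t : R -> R) : measurable_fun circle t -> (forall x, circle x -> `|t x| <= K) ->
    integ (fun x => F x * t x).
  move=> mt tK; apply: (@circle_bounded_integrable _ _ (B * K)); first exact: measurable_funM.
  by move=> x cx; rewrite normrM ler_pM// ?FB ?tK.
rewrite -RintegralB//; [|exact: i|exact: i].
have [] // := @I_bound R (fun x => F x * r x - F x * s x) (B * d).
  by apply: measurable_funB; exact: measurable_funM.
by move=> x cx; rewrite -mulrBr normrM ler_pM// ?FB ?rs.
Qed.

Lemma variance_diff (F r s : R -> R) (B K d : R) : measurable_fun circle F ->
  (forall x, circle x -> `|F x| <= B) ->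
  measurable_fun circle r -> measurable_fun circle s ->
  (forall x, circle x -> `|r x| <= K) -> (forall x, circle x -> `|s x| <= K) ->
  (forall x, circle x -> `|r x - s x| <= d) -> I r = 1 -> I s = 1 ->
  `|I (fun x => centered r F x ^+ 2 * r x) - I (fun x => centered s F x ^+ 2 * s x)|
    <= (8 + 128 * K) * B ^+ 2 * d.
Proof.
move=> mF FB mr ms rK sK rs Ir Is.
have B0 : 0 <= B by apply: le_trans (FB _ (@circleNpi R)).
have K0 : 0 <= K by apply: le_trans (rK _ (@circleNpi R)).
have d0 : 0 <= d by apply: le_trans (rs _ (@circleNpi R)).
rewrite (I_variance mF FB mr rK Ir) (I_variance mF FB ms sK Is).
have mF2 : measurable_fun circle (fun x => F x ^+ 2) by exact: measurable_funX.
have F2B x : circle x -> `|F x ^+ 2| <= B ^+ 2.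
  by move=> cx; rewrite normrX lerXn2r ?nnegrE ?FB.
have h1 := I_weight_diff mF FB mr ms rK sK rs.
have h2 := I_weight_diff mF2 F2B mr ms rK sK rs.
have mom (t : R -> R) : measurable_fun circle t -> (forall x, circle x -> `|t x| <= K) ->
    `|I (fun x => F x * t x)| <= 8 * (B * K).
  move=> mt tK; have [] // := @I_bound R (fun x => F x * t x) (B * K).
    exact: measurable_funM.
  by move=> x cx; rewrite normrM ler_pM// ?FB ?tK.
have m1 := mom r mr rK; have m2 := mom s ms sK.
move: h1 h2 m1 m2; set a := I (fun x => F x * r x); set b := I (fun x => F x * s x).
set u := I (fun x => F x ^+ 2 * r x); set v := I (fun x => F x ^+ 2 * s x) => h1 h2 m1 m2.
rewrite (_ : u - a ^+ 2 - (v - b ^+ 2) = (u - v) - (a - b) * (a + b)); last by ring.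
rewrite (le_trans (ler_normB _ _))// normrM.
have h3 : `|a - b| * `|a + b| <= 8 * (B * d) * (16 * (B * K)).
  rewrite ler_pM// (le_trans (ler_normD _ _))//; lra.
apply: (le_trans (lerD h2 h3)).
by rewrite le_eqVlt; apply/orP; left; apply/eqP; ring.
Qed.

Lemma sobolev1_AC psi : sobolev 1 psi -> exists F dpsi (B : R),
  [/\ AC F dpsi, I dpsi = 0, psi =ae F, integ psi & forall x, circle x -> `|F x| <= B].
Proof.
move=> [_ [dpsi [wd _]]]; have [F [FA pF]] := weak_derivative_AC wd.
exists F, dpsi, (`|F (- pi)| + I (fun t => `|dpsi t|)); split => //.
- exact: weak_derivative_mean0 wd.
- by case: wd.
- by move=> x cx; exact: AC_bound FA cx.
Qed.

Lemma expectation_square (P : probability (measurableTypeR R) R) (r psi F : R -> R) :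
  measurable_fun circle r -> (forall x, circle x -> 0 <= r x) -> has_density P r ->
  psi =ae F -> measurable_fun circle F ->
  \int[P]_(x in circle) (center P psi x ^+ 2) = I (fun x => centered r F x ^+ 2 * r x).
Proof.
move=> mr r0 Pr pF mF.
rewrite (has_density_expectation mr r0 Pr (f' := fun x => centered r F x ^+ 2))//.
- apply: (aeS pF) => x e cx.
  by rewrite /center e// (has_density_expectation mr r0 Pr pF mF).
- by apply: measurable_funX; apply: measurable_funB.
Qed.

(** Up to O(beta) the square of sigma is the variance of psi under the
    equilibrium density, and that density is O(beta) close to the Gibbs
    density. *)
Lemma sigma_estimate (V psi : R -> R) : C11 V ->
  (\int[lam]_(x in circle) (expR (- V x) / (2 * pi))%:E = 1)%E -> sobolev 1 psi ->
  exists2 b1 : R, 0 < b1 & exists s (D : R), [/\ 0 <= D,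
    sigma V 0 psi = Num.sqrt s &
    forall bt, 0 < bt < b1 -> exists2 s', sigma V bt psi = Num.sqrt s' & `|s' - s| <= D * bt].
Proof.
move=> hV hV1 hpsi.
have [F [dpsi [B [FA I0 pF ip FB]]]] := sobolev1_AC hpsi.
have mF := AC_measurable FA.
have [KV KV0 CV] := C11_C11_pair hV.
have [mV _] := C11_pair_measurable (@circle R) CV.
have [M M1 [b0 b00 small]] := small_density hV hV1.
have M0 : 0 < M by exact: lt_le_trans M1.
have C00 := @logker_mass_ge0 R.
pose N := 4 * C0 * (M + 8 * M ^+ 2) + 8 * M * C0 + 1.
have n1 : 0 <= 4 * C0 * (M + 8 * M ^+ 2).
  by rewrite !mulr_ge0// addr_ge0 ?(ltW M0)// mulr_ge0 ?sqr_ge0.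
have n2 : 0 <= 8 * M * C0 by rewrite !mulr_ge0// ltW.
have N0 : 0 < N by rewrite /N; lra.
have B0 : 0 <= B by apply: le_trans (FB _ (@circleNpi R)).
have mg := measurable_gibbs_density mV.
have g0 x : circle x -> 0 <= gibbs_density V x by move=> _; exact: gibbs_density_ge0.
pose K := M + M * b0.
exists (Num.min b0 N^-1); first by rewrite lt_min b00 invr_gt0.
pose D1 := 32 * M ^+ 2 * (2 * B) ^+ 2 * C0; pose D2 := (8 + 128 * K) * B ^+ 2 * M.
have K0 : 0 <= K by rewrite addr_ge0 ?mulr_ge0 ?(ltW M0) ?(ltW b00).
exists (I (fun x => centered (gibbs_density V) F x ^+ 2 * gibbs_density V x)), (D1 + D2); split.
- by rewrite addr_ge0// !mulr_ge0 ?sqr_ge0 ?(ltW M0)// addr_ge0// mulr_ge0.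
- by rewrite /sigma eqxx (expectation_square mg g0 (gibbs_has_density mV hV1) pF mF).
move=> bt; rewrite lt_min => /andP[bt0 /andP[btb btN]].
have [|rho [g [e [[Crho Irho] dln [cg gM] rho_ge [rhoE rhoV]]]]] := small bt.
  by rewrite bt0 ltW.
have [mrho _] := C11_pair_measurable (@circle R) Crho.
have rpos x : 0 < rho x by apply: lt_le_trans (rho_ge x); rewrite invr_gt0.
have rM x : rho x <= M.
  by case: Crho => _ h _ _; have [h1 _] := h x; exact: (le_trans (ler_norm _) h1).
have hd := equilibrium_density mV bt0 hV1 mrho rpos rM Irho rhoE.
have r0 x : circle x -> 0 <= rho x by move=> _; exact: ltW.
have mdens := density_measurable mrho hd; have dens := density_ae mrho hd.
have Emu := has_density_expectation mrho r0 hd.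
have btN1 : bt * N <= 1 by rewrite -ler_pdivlMr// mul1r ltW.
have s1 : bt * (4 * C0 * (M + 8 * M ^+ 2)) <= 1.
  by apply: le_trans btN1; rewrite ler_pM2l// /N; lra.
have s2 : bt * (8 * M * C0) <= 1.
  by apply: le_trans btN1; rewrite ler_pM2l// /N; lra.
have ex := Linv_solution_exists M1 bt0 Crho Irho dln cg gM rho_ge mdens dens Emu FA I0 pF FB s1.
have [h1 h2 h3] : [set phi | [/\ Hspace (equilibrium V bt) phi, sobolev 2 phi &
    ae_eq lam circle (Lop (equilibrium V bt) bt phi) (center (equilibrium V bt) psi)]]
    (Linv (equilibrium V bt) bt (center (equilibrium V bt) psi)) := getPex ex.
have est := Hinner_estimate M1 bt0 Crho Irho dln cg rho_ge mdens dens Emu FA I0 pF ip FB h1 h2 h3 s2.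
exists (Hinner (equilibrium V bt) (center (equilibrium V bt) psi)
   (Linv (equilibrium V bt) bt (center (equilibrium V bt) psi))).
  by rewrite /sigma gt_eqF.
have rK x : circle x -> `|rho x| <= K.
  move=> _; rewrite gtr0_norm// (le_trans (rM x))// /K lerDl mulr_ge0//; [exact: ltW|exact: ltW].
have gK x : circle x -> `|gibbs_density V x| <= K.
  move=> cx; rewrite ger0_norm ?g0//.
  have := rhoV x; rewrite distrC => /(le_trans (ler_norm _)).
  have : M * bt <= M * b0 by rewrite ler_pM2l// ltW.
  by have := rM x; rewrite /K /gibbs_density; lra.
have Ig : I (gibbs_density V) = 1 by rewrite /Rintegral hV1.
have vd := variance_diff mF FB mrho mg rK gK (fun x _ => rhoV x) Irho Ig.
apply: (le_trans (ler_distD (I (fun x => centered rho F x ^+ 2 * rho x)) _ _)).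
rewrite mulrDl; apply: lerD; first exact: est.
by apply: (le_trans vd); rewrite /D2 mulrA.
Qed.

End variance_estimates.

Theorem proposition8p2 (R : realType) (V psi : R -> R)
  (hV : C11 V)
  (hV1 : (\int[lebesgue_measure]_(x in circle)
             (expR (- V x) / (2 * pi))%:E = 1)%E)
  (hpsi : sobolev 1 psi) :
  sigma V beta psi @[beta --> 0^'+] --> sigma V 0 psi.
Proof.
have [b1 b10 [s [D [D0 s0 est]]]] := sigma_estimate hV hV1 hpsi.
rewrite s0.
have sD (bt : R) : exists s', 0 < bt < b1 -> sigma V bt psi = Num.sqrt s' /\ `|s' - s| <= D * bt.
  have [h|h] := pselect (0 < bt < b1); last by exists 0.
  by have [s' e1 e2] := est bt h; exists s'.
have [f fE] := choice sD.
have fs : f beta @[beta --> 0^'+] --> s.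
  apply/cvgrPdist_le => eps eps0; near=> bt.
  have h : 0 < bt < b1 by apply/andP; split; near: bt; [exact: nbhs_right_gt|exact: nbhs_right_lt].
  rewrite distrC; apply: (le_trans (fE bt h).2).
  have : bt <= eps / (D + 1).
    by near: bt; apply: nbhs_right_le; rewrite divr_gt0// ltr_wpDl.
  rewrite ler_pdivlMr ?ltr_wpDl// => h2.
  have /andP[b0 _] := h; nra.
have sq : Num.sqrt (f beta) @[beta --> 0^'+] --> Num.sqrt s.
  by have := cvg_comp _ _ fs (@sqrt_continuous R s).
apply: cvg_trans sq; apply: near_eq_cvg; near=> bt.
have h : 0 < bt < b1 by apply/andP; split; near: bt; [exact: nbhs_right_gt|exact: nbhs_right_lt].
by rewrite (fE bt h).1.
Unshelve. all: end_near. Qed.
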